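(* Let $A$ be an Artinian local ring, let $B$ be a finitely generated standard $\mathbb{N}^r$-graded $A$-algebra, and let $M$ be a finitely generated $\mathbb{Z}^r$-graded $B$-module. Let $d_{++}=\dim(\mathrm{Supp}_{++}(M))$. Then: (i) For $\nu\gg\mathbf 0$, the function $\nu\mapsto\mathrm{length}_A([M]_\nu)$ becomes a polynomial in $\mathbb{Q}[X_1,\ldots,X_r]$ of total degree $d_{++}$ which can be written in the form $$\sum_{\mathbf n\in\mathbb{N}^r,\ |\mathbf n|=d_{++}}\frac{e_{\mathbf n}\big(M/\mathrm{H}^0_{\mathfrak N}(M)\big)}{\mathbf n!}\,X_1^{n_1}\cdots X_r^{n_r}+(\text{terms of total degree}<d_{++}).$$ (ii) For each $\mathbf n\in\mathbb{N}^r$ with $|\mathbf n|\ge d_{++}$, $$e(\mathbf n;M)=e_{\mathbf n}\big(M/\mathrm{H}^0_{\mathfrak N}(M)\big).$$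
   Context: $\mathbb{N}=\{0,1,2,\ldots\}$, $r\ge1$. Standard means that $[B]_{\mathbf 0}=A$ and $B$ is generated over $A$ by finitely many elements of degrees $\mathbf e_1,\ldots,\mathbf e_r$ (standard basis vectors). $|\mathbf n|=n_1+\cdots+n_r$, $\mathbf n!=n_1!\cdots n_r!$, $\mathbf 0=(0,\ldots,0)$, $\mathbf 1=(1,\ldots,1)$; inequalities of vectors are componentwise; ''for $\nu\gg\mathbf 0$'' means for all $\nu\ge\nu_0$ for some $\nu_0$. Conventions: $\dim(0)=\dim(\emptyset)=-\infty$, and the zero polynomial has degree $-\infty$. $\mathfrak N=\bigoplus_{\nu_1>0,\ldots,\nu_r>0}[B]_\nu$ is the irrelevant ideal, $\mathrm{H}^0_{\mathfrak N}(M)=\{m\in M:\mathfrak N^km=0\text{ for some }k\}$, $\mathrm{MultiProj}(B)$ is the space of graded primes of $B$ not containing $\mathfrak N$, and $\mathrm{Supp}_{++}(M)=\mathrm{Supp}(M)\cap\mathrm{MultiProj}(B)$ with its topological dimension; one has $\dim(M/\mathrm{H}^0_{\mathfrak N}(M))=r+d_{++}$. Mixed multiplicities via Hilbert series: for a finitely generated graded $B$-module $E$ of Krull dimension $d$, the series $\mathrm{Hilb}_E(\mathbf t)=\sum_{\nu\in\mathbb{Z}^r}\mathrm{length}_A([E]_\nu)t_1^{\nu_1}\cdots t_r^{\nu_r}$ can be written as $\sum_{\mathbf n\in\mathbb{N}^r,|\mathbf n|=d}Q_{\mathbf n}(\mathbf t)/((1-t_1)^{n_1}\cdots(1-t_r)^{n_r})$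 with $Q_{\mathbf n}\in\mathbb{Z}[t_1^{\pm1},\ldots,t_r^{\pm1}]$, $Q_{\mathbf n}(\mathbf 1)\ge0$, and the values $Q_{\mathbf n}(\mathbf 1)$ do not depend on the decomposition. For $\mathbf n\in\mathbb{Z}^r$ with $\mathbf n\ge-\mathbf 1$ and $|\mathbf n+\mathbf 1|\ge d$, set $e_{\mathbf n}(E)=Q_{\mathbf n+\mathbf 1}(\mathbf 1)$ if $|\mathbf n+\mathbf 1|=d$ and $e_{\mathbf n}(E)=0$ if $|\mathbf n+\mathbf 1|>d$. Mixed multiplicities via Hilbert polynomials: let $P_M(X_1,\ldots,X_r)$ be the polynomial agreeing with $\mathrm{length}_A([M]_\nu)$ for $\nu\gg\mathbf 0$, written as $P_M=\sum_{n_1,\ldots,n_r\ge0}e(n_1,\ldots,n_r)\binom{X_1+n_1}{n_1}\cdots\binom{X_r+n_r}{n_r}$. For $\mathbf n\in\mathbb{N}^r$ with $|\mathbf n|\ge d_{++}$, set $e(\mathbf n;M)=e(n_1,\ldots,n_r)$ if $|\mathbf n|=d_{++}$ and $e(\mathbf n;M)=0$ if $|\mathbf n|>d_{++}$. *)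

(* Defs.v *)
From HB Require Import structures.
From mathcomp Require Import all_boot all_order all_algebra.
From mathcomp Require Import mpoly.
From mathcomp Require Import finmap boolp classical_sets constructive_ereal.

Set Implicit Arguments.
Unset Strict Implicit.
Unset Printing Implicit Defensive.

Import Order.TTheory GRing.Theory Num.Theory.

Local Open Scope classical_set_scope.
Local Open Scope ring_scope.

Definition is_ideal (R : comNzRingType) (I : set R) : Prop :=
  I 0 /\ forall a x y, I x -> I y -> I (a * x + y).

Definition artinian (R : comNzRingType) : Prop :=
  forall I : nat -> set R, (forall n, is_ideal (I n)) ->
    (forall n, I n.+1 `<=` I n) ->
  exists k, forall n, (k <= n)%N -> I n = I k.

Definition maximal_ideal (R : comNzRingType) (I : set R) : Prop :=
  [/\ is_ideal I, I <> setT &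
      forall J, is_ideal J -> I `<=` J -> J = I \/ J = setT].

Definition local_ring (R : comNzRingType) : Prop :=
  exists! I : set R, maximal_ideal I.

(* Degrees in Z^r; degrees in N^r are the multi-indices of mpoly, with [mdeg]
   for |n|. *)
Definition grade (r : nat) := {ffun 'I_r -> int}.

Definition gradeN (r : nat) (n : 'X_{1..r}) : grade r := [ffun i => (n i)%:Z].

Definition for_large (r : nat) (P : set (grade r)) : Prop :=
  exists nu0 : grade r, forall nu : grade r, (forall i, nu0 i <= nu i) -> P nu.

Definition direct_sum (I : eqType) (V : zmodType) (G : I -> set V) : Prop :=
  [/\ forall i, G i 0 /\ (forall x y, G i x -> G i y -> G i (x - y)),
      forall v, exists (s : seq I) (f : I -> V),
        [/\ uniq s, forall i, G i (f i) & v = \sum_(i <- s) f i] &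
      forall (s : seq I) (f : I -> V), uniq s -> (forall i, G i (f i)) ->
        \sum_(i <- s) f i = 0 -> forall i, i \in s -> f i = 0].

Section Graded.
Variables (A : comNzRingType) (B : comAlgType A) (r : nat).
Variable Bg : 'X_{1..r} -> set B.

Definition graded_ring : Prop :=
  [/\ direct_sum Bg, Bg 0%MM 1 &
      forall m n x y, Bg m x -> Bg n y -> Bg (m + n)%MM (x * y)].

Definition standard : Prop :=
  [/\ injective (in_alg B), Bg 0%MM = range (in_alg B) &
      exists s : seq B,
        (forall b, b \in s -> exists i : 'I_r, Bg U_(i)%MM b) /\
        (forall b, exists p : {mpoly A[size s]},
           b = mmap (in_alg B) (fun i => s`_i) p)].

Definition graded_module (M : lmodType B) (Mg : grade r -> set M) : Prop :=
  direct_sum Mg /\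
  forall m nu b x, Bg m b -> Mg nu x -> Mg (gradeN m + nu) (b *: x).

Definition is_prime (P : set B) : Prop :=
  idealr_closed (mem P) /\ prime_idealr_closed (mem P).

Definition homogeneous (P : set B) : Prop :=
  forall (s : seq 'X_{1..r}) (f : 'X_{1..r} -> B),
    uniq s -> (forall n, Bg n (f n)) -> P (\sum_(n <- s) f n) ->
  forall n, n \in s -> P (f n).

Definition irrelevant : set B :=
  [set b | exists (s : seq 'X_{1..r}) (f : 'X_{1..r} -> B),
     [/\ forall n, n \in s -> forall i, (0 < n i)%N,
         forall n, Bg n (f n) & b = \sum_(n <- s) f n]].

Definition MultiProj : set (set B) :=
  [set P | [/\ is_prime P, homogeneous P & ~ irrelevant `<=` P]].
End Graded.

(* With values in \bar int, the supremum of the empty set being -oo. *)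
Definition sup_nat (S : set nat) : \bar int :=
  supremum -oo%E [set (Posz n)%:E | n in S].

(* A topology is given by its collection of closed sets. *)
Definition irreducible (T : Type) (closed : set (set T)) (Z : set T) : Prop :=
  Z !=set0 /\ forall Z1 Z2, closed Z1 -> closed Z2 ->
    Z `<=` Z1 `|` Z2 -> Z `<=` Z1 \/ Z `<=` Z2.

Definition topological_dim (T : Type) (closed : set (set T)) : \bar int :=
  sup_nat [set n | exists Z : nat -> set T,
    (forall i, (i <= n)%N -> closed (Z i) /\ irreducible closed (Z i)) /\
    (forall i, (i < n)%N -> Z i `<` Z i.+1)].

Definition zariski (R : Type) (X : set (set R)) : set (set (set R)) :=
  [set X `&` [set P | S `<=` P] | S in [set: set R]].

Section Dimension.
Variables (A : comNzRingType) (B : comAlgType A) (M : lmodType B).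

(* The localization of M at P is nonzero iff m/1 <> 0 for some m in M, i.e.
   no element outside P annihilates m. *)
Definition support : set (set B) :=
  [set P | is_prime P /\ exists m : M, forall b, ~ P b -> b *: m <> 0].

Definition krull_dim : \bar int :=
  sup_nat [set n | exists P : nat -> set B,
    (forall i, (i <= n)%N ->
       is_prime (P i) /\ [set b | forall m : M, b *: m = 0] `<=` P i) /\
    (forall i, (i < n)%N -> P i `<` P i.+1)].

Definition support_pp (r : nat) (Bg : 'X_{1..r} -> set B) : set (set B) :=
  support `&` MultiProj Bg.

Definition dim_pp (r : nat) (Bg : 'X_{1..r} -> set B) : \bar int :=
  topological_dim (zariski (support_pp Bg)).

Definition fin_gen : Prop :=
  exists s : seq M, forall m, exists c : 'I_(size s) -> B,
    m = \sum_(i < size s) c i *: s`_i.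

Definition is_Asubmodule (N : set M) : Prop :=
  N 0 /\ forall (a : A) x y, N x -> N y -> N ((a%:A : B) *: x + y).

Definition Alength (X : set M) : \bar int :=
  sup_nat [set n | exists N : nat -> set M,
    (forall i, (i <= n)%N -> is_Asubmodule (N i) /\ N i `<=` X) /\
    (forall i, (i < n)%N -> N i `<` N i.+1)].
End Dimension.

Arguments krull_dim {A B} M.
Arguments support {A B} M.
Arguments support_pp {A B} M {r} Bg.
Arguments dim_pp {A B} M {r} Bg.
Arguments fin_gen {A B} M.

Section QuotientModule.
Variables (R : comNzRingType) (V : lmodType R) (W : submodClosed V).

(* submodClosed does not inherit from zmodClosed. *)
Definition submod_pred : {pred V} := W.
HB.instance Definition _ := GRing.isZmodClosed.Build V submod_pred
  (GRing.submod_closedB (submodClosedP W)).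

Definition quotmod : Type := Quotient.quot submod_pred.
HB.instance Definition _ := GRing.Zmodule.on quotmod.

Definition quotmod_pi (x : V) : quotmod := \pi_(Quotient.quot submod_pred)%qT x.
Definition quotmod_scale (a : R) (x : quotmod) : quotmod :=
  quotmod_pi (a *: repr (x : Quotient.quot submod_pred)).

Lemma quotmod_piE x y : quotmod_pi x = quotmod_pi y <-> x - y \in submod_pred.
Proof.
rewrite /quotmod_pi Quotient.idealrBE.
by split=> [->|/eqP].
Qed.

Lemma quotmod_reprK (x : quotmod) :
  quotmod_pi (repr (x : Quotient.quot submod_pred)) = x.
Proof. by rewrite /quotmod_pi reprK. Qed.

Lemma quotmod_piZ a x : quotmod_scale a (quotmod_pi x) = quotmod_pi (a *: x).
Proof.
apply/quotmod_piE; rewrite -scalerBr rpredZ //.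
by apply/quotmod_piE; rewrite quotmod_reprK.
Qed.

Lemma quotmod_piD x y : quotmod_pi (x + y) = quotmod_pi x + quotmod_pi y.
Proof. by rewrite /quotmod_pi raddfD. Qed.

Fact quotmod_scalerA a b v :
  quotmod_scale a (quotmod_scale b v) = quotmod_scale (a * b) v.
Proof. by rewrite -(quotmod_reprK v) !quotmod_piZ scalerA. Qed.

Fact quotmod_scale1r : left_id 1 quotmod_scale.
Proof. by move=> v; rewrite -(quotmod_reprK v) quotmod_piZ scale1r. Qed.

Fact quotmod_scalerDr : right_distributive quotmod_scale +%R.
Proof.
move=> a u v; rewrite -(quotmod_reprK u) -(quotmod_reprK v).
by rewrite -quotmod_piD !quotmod_piZ -quotmod_piD scalerDr.
Qed.

Fact quotmod_scalerDl v : {morph quotmod_scale^~ v : a b / a + b}.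
Proof.
move=> a b; rewrite -(quotmod_reprK v) !quotmod_piZ.
by rewrite scalerDl quotmod_piD.
Qed.

HB.instance Definition _ := GRing.Zmodule_isLmodule.Build R quotmod
  quotmod_scalerA quotmod_scale1r quotmod_scalerDr quotmod_scalerDl.
End QuotientModule.

Section LocalCohomology.
Variables (A : comNzRingType) (B : comAlgType A) (r : nat).
Variables (Bg : 'X_{1..r} -> set B) (M : lmodType B).

(* The k-th power of an ideal is generated by the products of k elements. *)
Definition kills_pow (k : nat) (m : M) : Prop :=
  forall t : k.-tuple B, (forall i, irrelevant Bg (tnth t i)) ->
    (\prod_(i < k) tnth t i) *: m = 0.

Definition H0 : {pred M} := [pred m | `[< exists k, kills_pow k m >]].

Fact H0_submod_closed : submod_closed H0.
Proof.
split; first by apply/asboolP; exists 0%N => t _; rewrite scaler0.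
have mono k l m : (k <= l)%N -> kills_pow k m -> kills_pow l m.
  move=> /subnK <-; move: (l - k)%N => j; elim: j => [//|j IH] /IH {IH}.
  rewrite addSn => Hm t Ht; rewrite big_ord_recl -scalerA.
  have := Hm (behead_tuple t) => /=.
  under eq_bigr do rewrite tnth_behead.
  have e (i : 'I_(j + k)) : inord i.+1 = lift ord0 i :> 'I_(j + k).+1.
    by apply/val_inj; rewrite /= inordK // ltnS.
  under eq_bigr do rewrite e.
  by move=> ->; rewrite ?scaler0 // => i; rewrite tnth_behead.
move=> a x y /asboolP[k xk] /asboolP[l yl]; apply/asboolP.
exists (maxn k l) => t Ht; rewrite scalerDr scalerA mulrC -scalerA.
rewrite (mono _ _ _ (leq_maxl k l) xk) // (mono _ _ _ (leq_maxr k l) yl) //.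
by rewrite scaler0 addr0.
Qed.

HB.instance Definition _ := GRing.isSubmodClosed.Build B M H0 H0_submod_closed.

Definition modH0 : lmodType B := quotmod H0.

Definition modH0_grading (Mg : grade r -> set M) (nu : grade r) : set modH0 :=
  [set @quotmod_pi _ _ H0 x | x in Mg nu].
End LocalCohomology.

Arguments modH0 {A B r} Bg M.
Arguments modH0_grading {A B r} Bg {M} Mg nu.

(* Empty when d is infinite. *)
Definition mnm_of_deg (r : nat) (d : \bar int) : seq 'X_{1..r} :=
  [seq bmnm m | m <- enum {: 'X_{1..r < `|fine d|%N.+1}} & (mdeg (bmnm m))%:Z%:E == d].

(* Laurent polynomials over the integers, by their coefficients. *)
Definition laurent (r : nat) := {fsfun grade r -> int with 0}.

Definition laurent_at1 (r : nat) (Q : laurent r) : int :=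
  \sum_(a <- finsupp Q) Q a.

(* The coefficient of t^k in (1-t)^-n; for n = 0 and k > 0 it is
   'C(k - 1, k) = 0. *)
Definition pole_coef (n : nat) (k : int) : nat :=
  if k is Posz j then 'C((n + j).-1, j) else 0.

Section HilbertSeries.
Variables (A : comNzRingType) (B : comAlgType A) (r : nat).
Variables (E : lmodType B) (Eg : grade r -> set E).

(* Comparison of the coefficients of t^nu in
   Hilb_E(t) = \sum_(|n| = d) Q_n(t) / (1-t)^n. *)
Definition hilbert_decomposition (Q : 'X_{1..r} -> laurent r) : Prop :=
  (forall n, (mdeg n)%:Z%:E = krull_dim E -> 0 <= laurent_at1 (Q n)) /\
  (forall nu : grade r, Alength (Eg nu) =
     (\sum_(n <- mnm_of_deg r (krull_dim E)) \sum_(a <- finsupp (Q n))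
        Q n a * (\prod_(i < r) pole_coef (n i) (nu i - a i))%:Z)%:E).

(* e_n(E), for n >= -1 and |n + 1| >= dim E. The value at 1 of the numerators
   does not depend on the decomposition. *)
Definition mixed_mult_series (n : grade r) : int :=
  let n1 := [multinom `|(n i + 1)%R|%N | i < r] in
  if (mdeg n1)%:Z%:E == krull_dim E then
    xget 0 [set c | exists2 Q, hilbert_decomposition Q & c = laurent_at1 (Q n1)]
  else 0.
End HilbertSeries.

(* binom(X_1 + n_1, n_1) ... binom(X_r + n_r, n_r), as
   binom(X + n, n) = (X + 1) ... (X + n) / n!. *)
Definition binom_mpoly (r : nat) (n : 'X_{1..r}) : {mpoly rat[r]} :=
  \prod_(i < r) (((n i)`!)%:R^-1 *: \prod_(j < n i) ('X_i + j.+1%:R)).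

Definition total_degree (r : nat) (P : {mpoly rat[r]}) : \bar int :=
  if P == 0 then -oo%E else ((msize P).-1)%:Z%:E.

Section HilbertPolynomial.
Variables (A : comNzRingType) (B : comAlgType A) (r : nat).
Variables (M : lmodType B) (Mg : grade r -> set M).

Definition hilbert_polynomial (P : {mpoly rat[r]}) : Prop :=
  for_large [set nu : grade r |
    er_map intr (Alength (Mg nu)) = (P.@[fun i => (nu i)%:~R])%:E].

(* e(n; M), for n in N^r with |n| >= d_++. *)
Definition mixed_mult_poly (Bg : 'X_{1..r} -> set B) (n : 'X_{1..r}) : rat :=
  if (mdeg n)%:Z%:E == dim_pp M Bg then
    xget 0 [set c | exists (P : {mpoly rat[r]})
                           (e : {fsfun 'X_{1..r} -> rat with 0}),
      [/\ hilbert_polynomial P,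
          P = \sum_(m <- finsupp e) e m *: binom_mpoly m & c = e n]]
  else 0.
End HilbertPolynomial.

(* Main.v *)
From Stdlib Require List.
Require Import Defs.
From HB Require Import structures.
From mathcomp Require Import all_boot all_order all_algebra.
From mathcomp Require Import mpoly.
From mathcomp Require Import finmap boolp classical_sets constructive_ereal.
From mathcomp Require Import zify ring.

Set Implicit Arguments.
Unset Strict Implicit.
Unset Printing Implicit Defensive.

Import Order.TTheory GRing.Theory Num.Theory.

Local Open Scope classical_set_scope.
Local Open Scope ring_scope.

(* Every graded module M over the noetherian algebra B has a filtration whose
   successive quotients are shifts of B/P with P a graded prime, so Hilbert functions
   and dimensions reduce to the rings B/P.  For a generator x of degree e_i outside P,
   the Hilbert series of B/P is that of B/(P + xB) divided by 1 - t_i; noetherian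
   induction on P gives a decomposition of the series of B/P of pole order d together
   with a chain of d + 1 graded primes starting at P.  No longer chain of primes exists,
   graded or not: a step of a chain raises by one the order of growth of
   N |-> length (B/P in degrees at most (N, ..., N)), and a pole order d bounds this
   order of growth by d.  Hence d = dim B/P.
   If P is relevant, i.e. does not contain the irrelevant ideal, the Hilbert function
   is nondecreasing in each variable, so its polynomial has degree exactly d - r, and
   cutting by an element of degree (1, ..., 1) produces a chain of d - r + 1 relevant
   primes.  In a filtration of M/H^0 every prime contains a relevant one, because H^0 is
   saturated; hence dim M/H^0 = r + d_{++}.  Finally H^0 vanishes in large degrees, and
   the part Q_n(t)/(1-t)^n of the Hilbert series contributes to the Hilbert polynomial
   the top coefficient Q_n(1)/(n - 1)! if n >= 1, and nothing otherwise. *)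

(** * Ideals and artinian local rings *)

(** Krull dimension counts chains of arbitrary primes, while filtrations produce only graded ones.
    Comparing orders of growth treats both kinds at once, so no ungraded prime ever has to be
    replaced by a graded one. The comparison is made on sums over the cubes [0,N]^r: a pole order d
    bounds them by a multiple of (N+1)^d, even though the numerators have coefficients of both
    signs. For a relevant prime the function is monotone, so such a sum is at most (N+1)^r times the
    value at the far corner; these r powers of N are the r in d - r. The numbers Q_n(1) with n >= 1
    and |n| = d are recovered from the top coefficients of the Hilbert polynomial, which is unique.
    Hence whichever decomposition the definition of e_n selects, the value is the same, and the two
    kinds of multiplicities agree because both equal n! times one coefficient of that polynomial. *)

Lemma dependent_choice_in T (P : T -> Prop) (R : T -> T -> Prop) (x0 : T) :
  P x0 -> (forall x, P x -> exists2 y, P y & R x y) ->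
  exists f : nat -> T, [/\ f 0%N = x0, forall n, P (f n) & forall n, R (f n) (f n.+1)].
Proof.
move=> Px0 ex.
have /choice[g gP] : forall x, exists y, P x -> P y /\ R x y.
  move=> x; have [/ex[y Py Rxy]|nP] := pselect (P x); first by exists y.
  by exists x.
have Pf n : P (iter n g x0) by elim: n => //= n /gP[].
by exists (fun n => iter n g x0); split=> // n; have [] := gP _ (Pf n).
Qed.

Section Ideals.
Variable R : comNzRingType.
Implicit Types (I J K : set R) (a x y : R).

Lemma ideal0 I : is_ideal I -> I 0. Proof. by case. Qed.

Lemma idealD I x y : is_ideal I -> I x -> I y -> I (x + y).
Proof. by case=> _ IP Ix Iy; have := IP 1 x y Ix Iy; rewrite mul1r. Qed.

Lemma idealMl I a x : is_ideal I -> I x -> I (a * x).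
Proof. by case=> I0 IP Ix; have := IP a x 0 Ix I0; rewrite addr0. Qed.

Lemma idealMr I a x : is_ideal I -> I x -> I (x * a).
Proof. by rewrite mulrC; exact: idealMl. Qed.

Lemma idealN I x : is_ideal I -> I x -> I (- x).
Proof. by move=> iI Ix; rewrite -mulN1r; exact: idealMl. Qed.

Lemma idealB I x y : is_ideal I -> I x -> I y -> I (x - y).
Proof. by move=> iI Ix Iy; apply: idealD => //; exact: idealN. Qed.

Lemma ideal_sum I (T : Type) (s : seq T) (P : pred T) (F : T -> R) :
  is_ideal I -> (forall i, P i -> I (F i)) -> I (\sum_(i <- s | P i) F i).
Proof.
move=> iI IF; elim/big_ind: _ => //; first exact: ideal0.
by move=> *; exact: idealD.
Qed.

Lemma is_idealT : is_ideal [set: R]. Proof. by []. Qed.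

Lemma is_ideal0 : is_ideal [set 0 : R].
Proof. by split=> // a x y -> ->; rewrite mulr0 addr0. Qed.

Definition ideal_adj I x : set R := [set z | exists a, I (z - a * x)].

Lemma ideal_adj_ideal I x : is_ideal I -> is_ideal (ideal_adj I x).
Proof.
move=> iI; split; first by exists 0; rewrite mul0r subr0; exact: ideal0.
move=> a y z [b Iy] [c Iz]; exists (a * b + c).
rewrite mulrDl opprD addrACA -mulrA -mulrBr.
by apply: idealD => //; exact: idealMl.
Qed.

Lemma ideal_adj_sub I x : I `<=` ideal_adj I x.
Proof. by move=> z Iz; exists 0; rewrite mul0r subr0. Qed.

Lemma ideal_adj_mem I x : is_ideal I -> ideal_adj I x x.
Proof. by move=> iI; exists 1; rewrite mul1r subrr; exact: ideal0. Qed.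

Lemma ideal_adj_least I J x : is_ideal J -> I `<=` J -> J x -> ideal_adj I x `<=` J.
Proof.
move=> iJ IJ Jx z [a /IJ Jz]; rewrite -[z](subrK (a * x)).
by apply: idealD => //; exact: idealMl.
Qed.

Lemma ideal_avoid I V x : is_ideal I -> I `<=` V -> ~ I x ->
  exists W, [/\ is_ideal W, I `<=` W, W `<=` V, ~ W x &
    forall J, is_ideal J -> W `<=` J -> J `<=` V -> ~ J x -> J = W].
Proof.
move=> iI IV nIx.
(* Zorn's lemma also asks for the union of the empty chain. Asking that [I] together with [X] be an
   ideal, and not [X] itself, makes the empty set admissible. *)
pose P (X : set R) := [/\ is_ideal (I `|` X), X `<=` V & ~ X x].
have [F FP Ft|A [[iA AV nAx] Amax]] := @Zorn_bigcup R P.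
  have FX X : F X -> is_ideal (I `|` X) by move=> /FP[].
  split; last first.
  - by move=> [X /FP[_ _ nXx] Xx].
  - by move=> z [X /FP[_ XV _] /XV].
  split=> [|a y z]; first by left; case: iI.
  case=> [Iy|[Y FY Yy]] [Iz|[Z FZ Zz]].
  - by left; case: iI => _; apply.
  - have [_ /(_ a y z)] := FX _ FZ; case; [by left|by right|by left|].
    by right; exists Z.
  - have [_ /(_ a y z)] := FX _ FY; case; [by right|by left|by left|].
    by right; exists Y.
  - have [YZ|ZY] := Ft _ _ FY FZ.
    + have [_ /(_ a y z)] := FX _ FZ; case; [by right; apply: YZ|by right|by left|].
      by right; exists Z.
    + have [_ /(_ a y z)] := FX _ FY; case; [by right|by right; apply: ZY|by left|].
      by right; exists Y.
exists (I `|` A); split=> //.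
- by move=> z [/IV|/AV].
- by move=> [].
move=> J iJ WJ JV nJx; apply: contrapT => neq; apply: (Amax J).
  split; first by move=> z Az; apply: WJ; right.
  by move=> JA; apply: neq; apply/seteqP; split=> // z /JA; right.
split=> //; suff -> : I `|` J = J by [].
by apply/seteqP; split=> [z [Iz|//]|z]; [apply: WJ; left|right].
Qed.

Definition noetherian : Prop :=
  forall I : nat -> set R, (forall n, is_ideal (I n)) ->
    (forall n, I n `<=` I n.+1) ->
  exists k, forall n, (k <= n)%N -> I n = I k.

Lemma noetherian_ind (Phi : set R -> Prop) : noetherian ->
  (forall I, is_ideal I ->
     (forall J, is_ideal J -> I `<=` J -> J <> I -> Phi J) -> Phi I) ->
  forall I, is_ideal I -> Phi I.
Proof.
move=> nR ind I iI; apply: contrapT => nPhi.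
have [I0|f [_ fP fS]] := @dependent_choice_in (set R)
  (fun I => is_ideal I /\ ~ Phi I) (fun I J => I `<=` J /\ J <> I) I (conj iI nPhi).
  move=> [iI0 nI0]; apply: contrapT => nex; apply: nI0; apply: ind => // J iJ IJ JI.
  by apply: contrapT => nJ; apply: nex; exists J.
have [|k kP] := nR f (fun n => proj1 (fP n)); first by move=> n; case: (fS n).
by case: (fS k) => _ /(_ (kP _ _)); apply.
Qed.

Lemma artinian_min (S : set (set R)) I : artinian R -> is_ideal I -> S I ->
  exists J, [/\ is_ideal J, S J & forall K, is_ideal K -> S K -> K `<=` J -> K = J].
Proof.
move=> aR iI SI; apply: contrapT => nex.
have [I0 [iI0 SI0]|f [_ fP fS]] := @dependent_choice_in (set R)
  (fun I => is_ideal I /\ S I) (fun I J => J `<=` I /\ J <> I) I (conj iI SI).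
  apply: contrapT => nJ; apply: nex; exists I0; split=> // K iK SK KI.
  by apply: contrapT => nK; apply: nJ; exists K.
have [|k kP] := aR f (fun n => proj1 (fP n)); first by move=> n; case: (fS n).
by case: (fS k) => _ /(_ (kP _ _)); apply.
Qed.

End Ideals.

Section ArtinianLocal.
Variable A : comNzRingType.
Hypotheses (artA : artinian A) (locA : local_ring A).

(** If [a] is not a unit, some ideal containing [a] is maximal among those avoiding 1. It is a
    maximal ideal, hence equal to [m] by uniqueness, and so [a] lies in [m]. *)
Lemma local_unitP : exists m : set A, [/\ is_ideal m, ~ m 1 &
  forall a, ~ m a -> exists b, a * b = 1].
Proof.
have [m [[im neT _] mU]] := locA; exists m; split=> //.
  move=> m1; apply: neT; apply/seteqP; split=> // x _.
  by rewrite -[x]mulr1; exact: idealMl.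
move=> a nma; apply: contrapT => nb; apply: nma.
have i0 := @is_ideal0 A.
have [||] := @ideal_avoid A (ideal_adj [set 0] a) setT 1 (ideal_adj_ideal a i0) => //.
  by case=> b /eqP; rewrite subr_eq0 => /eqP e; apply: nb; exists b; rewrite mulrC.
move=> W [iW aW _ nW1 Wmax]; suff <- : W = m by apply: aW; exact: ideal_adj_mem.
apply/esym/mU; split=> //; first by move=> WT; apply: nW1; rewrite WT.
move=> J iJ WJ; have [J1|nJ1] := pselect (J 1); [right|left].
  by apply/seteqP; split=> // x _; rewrite -[x]mulr1; exact: idealMl.
exact: Wmax.
Qed.

Variable m : set A.
Hypotheses (im : is_ideal m) (m1 : ~ m 1).
Hypothesis (mU : forall a, ~ m a -> exists b, a * b = 1).

Lemma local_1B x : m x -> exists b, (1 - x) * b = 1.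
Proof.
by move=> mx; apply: mU => m1x; apply: m1; rewrite -(subrK x 1); exact: idealD.
Qed.

(** The powers of [x] generate a descending chain, so x^k = a x^(k+1) for some k and a, and 1 - ax
    is a unit. *)
Lemma local_nilpotent x : m x -> exists n, x ^+ n = 0.
Proof.
move=> mx; pose I n := ideal_adj [set 0] (x ^+ n).
have iI n : is_ideal (I n) by apply: ideal_adj_ideal; exact: is_ideal0.
have [n|k kP] := artA iI.
  apply: ideal_adj_least => //; first by move=> _ ->; exact: ideal0.
  by exists x; rewrite -exprS subrr.
have : I k.+1 (x ^+ k) by rewrite kP //; apply: ideal_adj_mem; exact: is_ideal0.
case=> a /eqP; rewrite subr_eq0 => /eqP e; exists k.
have [|b bP] := @local_1B (a * x); first exact: idealMl.
by rewrite -[LHS]mulr1 -bP mulrA mulrBr mulr1 (mulrC (x ^+ k)) -mulrA -exprS -e subrr mul0r.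
Qed.

(** The ascending chain condition for the ideals of A/J, expressed inside [A]. *)
Definition noetherian_above (J : set A) : Prop :=
  forall I : nat -> set A, (forall n, is_ideal (I n)) ->
    (forall n, I n `<=` I n.+1) -> (forall n, J `<=` I n) ->
  exists k, forall n, (k <= n)%N -> I n = I k.

Lemma set_chain_homo T (I : nat -> set T) : (forall n, I n `<=` I n.+1) ->
  forall k n, (k <= n)%N -> I k `<=` I n.
Proof.
move=> IS k n /subnK <-; elim: (n - k)%N => // j IH x /IH.
by rewrite addSn; exact: IS.
Qed.

(** The quotient (J + Ax)/J is killed by [m], so within a chain an ideal above [J] is determined by
    its sum with Ax and by whether it contains [x]. Both become constant along the chain. *)
Lemma noetherian_above_adj J x : is_ideal J -> (forall a, m a -> J (a * x)) ->
  noetherian_above (ideal_adj J x) -> noetherian_above J.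
Proof.
move=> iJ Jmx nJx I iI IS JI.
have mono := set_chain_homo IS.
have [k1 k1P] : exists k1, forall n, (k1 <= n)%N -> I n x -> I k1 x.
  have [[k1 Ik1]|nex] := pselect (exists k, I k x); first by exists k1.
  by exists 0%N => n _ Inx; case: nex; exists n.
have [n|n|n|k2 k2P] := nJx (fun n => ideal_adj (I n) x).
- exact: ideal_adj_ideal.
- by move=> z [a Iz]; exists a; apply: IS.
- by move=> z [a /JI Iz]; exists a.
exists (maxn k1 k2) => n; rewrite geq_max => /andP[n1 n2].
apply/seteqP; split; last by apply: mono; rewrite geq_max n1.
move=> z Iz; have : ideal_adj (I (maxn k1 k2)) x z.
  by rewrite k2P ?leq_maxr // -(k2P n) //; exists 0; rewrite mul0r subr0.
case=> a Iza; rewrite -(subrK (a * x) z); apply: idealD => //.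
have [ma|/mU[b ab]] := pselect (m a); first exact/JI/Jmx.
suff Ix : I n x by apply: idealMl => //; apply: (mono k1); [exact: leq_maxl|exact: k1P Ix].
have -> : x = b * (z - (z - a * x)) by rewrite opprB addrC subrK mulrA (mulrC b) ab mul1r.
apply: idealMl => //; apply: idealB => //; apply: mono Iza.
by rewrite geq_max n1.
Qed.

(* A minimal ideal J with A/J noetherian satisfies J = mJ, for otherwise J has a
   hyperplane containing mJ; and then J = 0, again by minimality. *)
Lemma artinian_local_noetherian : noetherian A.
Proof.
have [J [iJ nJ Jmin]] : exists J, [/\ is_ideal J, noetherian_above J &
    forall K, is_ideal K -> noetherian_above K -> K `<=` J -> K = J].
  apply: (artinian_min artA (@is_idealT A)) => I _ _ TI; exists 0%N => n _.
  by apply/seteqP; split=> x _; apply: TI.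
suff J0 : J = [set 0].
  by move=> I iI IS; apply: nJ => // n; rewrite J0 => _ ->; exact: ideal0.
pose mJ := [set z | forall K, is_ideal K ->
  (forall a x, m a -> J x -> K (a * x)) -> K z].
have imJ : is_ideal mJ.
  split=> [K iK _|a y z Ky Kz K iK KP]; first exact: ideal0.
  by case: (iK) => _; apply; [apply: Ky|apply: Kz].
have mJJ : mJ `<=` J by move=> z; apply=> // a x _; exact: idealMl.
have JmJ : J `<=` mJ.
  move=> x Jx; apply: contrapT => nx.
  have [W [iW mJW WJ nWx Wmax]] := ideal_avoid imJ mJJ nx.
  suff : noetherian_above W by move=> /(Jmin _ iW)/(_ WJ) e; apply: nWx; rewrite e.
  apply: (noetherian_above_adj iW (x := x)).
    by move=> a ma; apply: mJW => K iK; apply.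
  suff -> : ideal_adj W x = J by [].
  apply/seteqP; split; first by apply: ideal_adj_least.
  move=> y Jy; have [Wy|nWy] := pselect (W y); first exact: ideal_adj_sub.
  have : ideal_adj W y x.
    apply: contrapT => nyx; apply: nWy.
    rewrite -(Wmax (ideal_adj W y)); first exact: ideal_adj_mem.
    - exact: ideal_adj_ideal.
    - exact: ideal_adj_sub.
    - by apply: ideal_adj_least.
    - by [].
  case=> a Wxy; have [ma|/mU[b ab]] := pselect (m a).
    case: nWx; rewrite -(subrK (a * y) x); apply: idealD => //.
    by apply: mJW => K iK; apply.
  exists b; have -> : y - b * x = - b * (x - a * y).
    by rewrite mulrBr !mulNr opprK mulrA (mulrC b a) ab mul1r addrC.
  exact: idealMl.
apply: contrapT => nJ0.
(* [K] is minimal with KJ nonzero, and xJ is nonzero for some [x] in [K]. From J = mJ it follows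
   that (mx)J is nonzero, so mx = K contains [x]; then x = ax with [a] in [m] forces x = 0. *)
have [|K [iK [x [y [Kx Jy xy0]]] Kmin]] := @artinian_min A
    [set K | exists x y, [/\ K x, J y & x * y <> 0]] setT artA (@is_idealT A).
  have [y Jy y0] : exists2 y, J y & y <> 0.
    apply: contrapT => nex; apply: nJ0; apply/seteqP; split=> [y Jy|_ ->]; last exact: ideal0.
    by apply: contrapT => y0; apply: nex; exists y.
  by exists 1, y; split=> //; rewrite mul1r.
pose mx := [set z | exists2 a, m a & z = a * x].
have imx : is_ideal mx.
  split; first by exists 0; [exact: ideal0|rewrite mul0r].
  move=> c _ _ [a ma ->] [b mb ->]; exists (c * a + b); last by rewrite mulrDl mulrA.
  by case: im => _; apply.
have : mx = K.
  apply: Kmin => //; last by move=> _ [a _ ->]; exact: idealMl.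
  apply: contrapT => nex; apply: xy0.
  have ann : is_ideal [set z | x * z = 0].
    split=> [/=|a u v /= xu xv]; first by rewrite mulr0.
    by rewrite mulrDr mulrCA xu xv mulr0 addr0.
  apply: (JmJ y Jy _ ann) => a z ma Jz /=; apply: contrapT => ne; apply: nex.
  by exists (a * x), z; split=> //; [exists a|rewrite (mulrC a) -mulrA].
move=> e; have : mx x by rewrite e.
case=> a ma /eqP; rewrite -subr_eq0 -[X in X - _]mul1r -mulrBl => /eqP ax.
have [b bP] := local_1B ma.
by apply: xy0; rewrite -[x]mul1r -bP (mulrAC _ b x) ax !mul0r.
Qed.

End ArtinianLocal.

(** * The Hilbert basis theorem *)

Section HilbertBasis.
Variables (R S : comNzRingType) (phi : {rmorphism R -> S}) (s : S).
Hypotheses (nR : noetherian R).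
Hypothesis sS : forall x, exists p : {poly R}, x = (map_poly phi p).[s].

Let ev (p : {poly R}) := (map_poly phi p).[s].

Let evB p q : ev (p - q) = ev p - ev q.
Proof. by rewrite /ev rmorphB hornerD hornerN. Qed.

Let evD p q : ev (p + q) = ev p + ev q.
Proof. by rewrite /ev rmorphD hornerD. Qed.

Let evM p q : ev (p * q) = ev p * ev q.
Proof. by rewrite /ev rmorphM hornerM. Qed.

(** The coefficients are those of polynomial representatives, since elements of [S] have no degree
    of their own. The degree of [p] may be below [n], so that zero and sums are covered. *)
Definition lead_ideal (I : set S) (n : nat) : set R :=
  [set a | exists p : {poly R}, [/\ (size p <= n.+1)%N, p`_n = a & I (ev p)]].

Lemma lead_ideal_ideal I n : is_ideal I -> is_ideal (lead_ideal I n).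
Proof.
move=> iI; split.
  exists 0; rewrite size_poly0 coef0 /ev rmorph0 horner0; split=> //.
  exact: ideal0.
move=> a x y [p [sp <- Ip]] [q [sq <- Iq]]; exists (a%:P * p + q).
rewrite coefD coefCM evD evM; split=> //; last first.
  by apply: idealD => //; exact: idealMl.
rewrite (leq_trans (size_polyD _ _)) // geq_max sq andbT.
by rewrite mul_polyC (leq_trans (size_scale_leq _ _)).
Qed.

Lemma lead_idealS I n : is_ideal I -> lead_ideal I n `<=` lead_ideal I n.+1.
Proof.
move=> iI a [p [sp <- Ip]]; exists (p * 'X).
rewrite coefMX evM; split=> //; last exact: idealMr.
have [->|p0] := eqVneq p 0; first by rewrite mul0r size_poly0.
by rewrite size_mulX.
Qed.

Lemma lead_ideal_homo I J n : I `<=` J -> lead_ideal I n `<=` lead_ideal J n.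
Proof. by move=> IJ a [p [sp pa /IJ Jp]]; exists p. Qed.

(** A representative of an element of [J] is corrected by one of an element of [I] with the same top
    coefficient, which lowers its size. *)
Lemma lead_ideal_eq I J : is_ideal I -> is_ideal J -> I `<=` J ->
  (forall n, lead_ideal J n `<=` lead_ideal I n) -> J = I.
Proof.
move=> iI iJ IJ L; apply/seteqP; split=> // x; have [p ->] := sS x.
have [n] := ubnP (size p); elim: n p => // n IH p; rewrite ltnS => sp Jp.
case: n sp IH => [|n] sp IH.
  move: sp; rewrite leqn0 size_poly_eq0 => /eqP ->.
  by rewrite rmorph0 horner0; exact: ideal0.
have [q [sq qp Iq]] : lead_ideal I n p`_n by apply: L; exists p.
rewrite -[p](subrK q) -/(ev _) evD; apply: idealD => //.
apply: IH; last by rewrite -/(ev _) evB; apply: idealB => //; exact: IJ.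
apply/leq_sizeP => j; rewrite coefB leq_eqVlt => /orP[/eqP <-|nj].
  by rewrite qp subrr.
by rewrite !nth_default ?subr0 ?(leq_trans _ nj).
Qed.

Lemma hilbert_basis : noetherian S.
Proof.
move=> I iI IS; pose L := lead_ideal.
have iL n k : is_ideal (L (I k) n) by exact: lead_ideal_ideal.
have Lk n k l : (k <= l)%N -> L (I k) n `<=` L (I l) n.
  by move=> kl; apply: lead_ideal_homo; exact: set_chain_homo kl.
have Ln k n l : (n <= l)%N -> L (I k) n `<=` L (I k) l.
  move=> nl; apply: (set_chain_homo (I := L (I k))) nl => j.
  exact: lead_idealS.
(* The diagonal chain stabilizes at [k0] and settles all degrees n >= k0, because the ideals
   increase in both indices. The finitely many degrees below [k0] are treated one by one. *)
have [n|k0 k0P] := nR (I := fun k => L (I k) k) (fun k => iL k k).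
  by apply: subset_trans (Lk _ _ _ (leqnSn n)) _; exact: lead_idealS.
have [k1 k1P] : exists k1, forall n k, (n < k0)%N -> (k1 <= k)%N -> L (I k) n = L (I k1) n.
  elim: k0 {k0P} => [|k0 [k1 IH]]; first by exists 0%N.
  have [n|k2 k2P] := nR (I := fun k => L (I k) k0) (iL k0); first exact: Lk.
  exists (maxn k1 k2) => n k; rewrite ltnS leq_eqVlt geq_max => nk /andP[kk1 kk2].
  case/orP: nk => [/eqP ->|nk]; first by rewrite k2P // [in RHS]k2P ?leq_maxr.
  by rewrite IH // [in RHS]IH ?leq_maxl.
exists (maxn k0 k1) => k; rewrite geq_max => /andP[kk0 kk1].
apply: lead_ideal_eq => //.
  by apply: set_chain_homo => //; rewrite geq_max kk0.
move=> n; have [nk0|k0n] := ltnP n k0.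
  by rewrite -/L k1P // -(k1P n (maxn k0 k1)) ?leq_maxr.
apply: subset_trans (Ln k _ _ (leq_maxl n k)) _.
apply: subset_trans (Lk _ _ _ (leq_maxr n k)) _.
rewrite k0P ?leq_max ?k0n // -/L.
by apply: subset_trans (Ln k0 _ _ k0n) _; apply: Lk; exact: leq_maxl.
Qed.

End HilbertBasis.

Lemma noetherian_image (R S : comNzRingType) (phi : {rmorphism R -> S}) :
  noetherian R -> (forall x, exists a, x = phi a) -> noetherian S.
Proof.
move=> nR sur; apply: (hilbert_basis (phi := phi) (s := 0)) => // x.
by have [a ->] := sur x; exists a%:P; rewrite map_polyC hornerC.
Qed.

Lemma noetherian_poly (R : comNzRingType) : noetherian R -> noetherian {poly R}.
Proof.
move=> nR; apply: (hilbert_basis (phi := polyC) (s := 'X)) => // p; exists p.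
by rewrite -[LHS]comp_polyXr.
Qed.

Section StandardNoetherian.
Variables (A : comNzRingType) (B : comAlgType A) (s : seq B).
Hypothesis sB : forall b, exists p : {mpoly A[size s]},
  b = mmap (in_alg B) (fun i => s`_i) p.

Lemma generators_ind (K : set B) : (forall a, K (in_alg B a)) ->
  (forall x y, K x -> K y -> K (x + y)) -> (forall x y, K x -> K y -> K (x * y)) ->
  (forall x, x \in s -> K x) -> forall b, K b.
Proof.
move=> KA KD KM Ks b; have [p ->] := sB b; rewrite /mmap.
have K0 : K 0 by have := KA 0; rewrite rmorph0.
have K1 : K 1 by have := KA 1; rewrite rmorph1.
have K1m m : K (mmap1 (fun i : 'I_(size s) => s`_i) m).
  rewrite /mmap1; elim/big_rec: _ => // i x _ Kx; apply: (KM) => //.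
  by elim: (m i) => [|j IH]; rewrite ?expr0 // exprS; apply: (KM) => //; apply/Ks/mem_nth.
by elim/big_rec: _ => // m x _ Kx; apply: (KD) => //; apply: (KM).
Qed.

Lemma standard_noetherian : noetherian A -> noetherian B.
Proof.
move=> nA.
(* One polynomial variable is adjoined per generator, so that the basis theorem in one variable
   applies at each stage; [B] is a quotient of the final ring. *)
have [S [phi [nS pA ps]]] : exists (S : comNzRingType) (phi : {rmorphism S -> B}),
    [/\ noetherian S, forall a, exists x, in_alg B a = phi x &
        forall b, b \in s -> exists x, b = phi x].
  elim: (s) => [|b t [S [phi [nS pA pt]]]].
    by exists A, (in_alg B); split=> // a; exists a.
  have cb : commr_rmorph phi b by move=> x; exact: mulrC.
  exists {poly S}, (horner_morph cb); split=> [|a|x].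
  - exact: noetherian_poly.
  - by have [x ->] := pA a; exists x%:P; rewrite /= horner_morphC.
  - rewrite inE => /orP[/eqP ->|/pt[y ->]]; first by exists 'X; rewrite /= horner_morphX.
    by exists y%:P; rewrite /= horner_morphC.
apply: (noetherian_image nS (phi := phi)).
apply: generators_ind => // [_ _ [a ->] [b ->]|_ _ [a ->] [b ->]].
  by exists (a + b); rewrite rmorphD.
by exists (a * b); rewrite rmorphM.
Qed.

End StandardNoetherian.

(** * Relative length *)

Section Submodules.
Variables (A : comNzRingType) (B : comAlgType A) (M : lmodType B).
Implicit Types (U V W : set M) (a : A) (x y z : M).

Lemma Asub0 U : is_Asubmodule U -> U 0. Proof. by case. Qed.

Lemma AsubD U x y : is_Asubmodule U -> U x -> U y -> U (x + y).
Proof. by case=> _ UP Ux Uy; have := UP 1 x y Ux Uy; rewrite !scale1r. Qed.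

Lemma AsubZ U a x : is_Asubmodule U -> U x -> U ((a%:A : B) *: x).
Proof. by case=> U0 UP Ux; have := UP a x 0 Ux U0; rewrite addr0. Qed.

Lemma AsubN U x : is_Asubmodule U -> U x -> U (- x).
Proof. by move=> sU /(AsubZ (-1) sU); rewrite scaleN1r scaleN1r. Qed.

Lemma AsubB U x y : is_Asubmodule U -> U x -> U y -> U (x - y).
Proof. by move=> sU Ux Uy; apply: AsubD => //; exact: AsubN. Qed.

Lemma AsubI U V : is_Asubmodule U -> is_Asubmodule V -> is_Asubmodule (U `&` V).
Proof.
move=> sU sV; split; first by split; exact: Asub0.
by move=> a x y [Ux Vx] [Uy Vy]; split; [case: sU|case: sV] => _; apply.
Qed.

Lemma Asub_zero : is_Asubmodule [set 0 : M].
Proof. by split=> // a x y -> ->; rewrite scaler0 addr0. Qed.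

Definition sumset U V : set M := [set z | exists2 v, V v & U (z - v)].

Lemma sumset_subl U V : V 0 -> U `<=` sumset U V.
Proof. by move=> V0 z Uz; exists 0; rewrite ?subr0. Qed.

Lemma sumset_subr U V : U 0 -> V `<=` sumset U V.
Proof. by move=> U0 z Vz; exists z; rewrite ?subrr. Qed.

Lemma sumset_Asub U V : is_Asubmodule U -> is_Asubmodule V ->
  is_Asubmodule (sumset U V).
Proof.
move=> sU sV; split; first by exists 0; rewrite ?subr0; exact: Asub0.
move=> a x y [v Vv Uxv] [w Vw Uyw]; exists ((a%:A : B) *: v + w).
  by case: sV => _; apply.
by rewrite opprD addrACA -scalerBr; case: sU => _; apply.
Qed.

Lemma sumset_least U V W : is_Asubmodule W -> U `<=` W -> V `<=` W -> sumset U V `<=` W.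
Proof. by move=> sW UW VW z [v /VW Wv /UW Wzv]; rewrite -(subrK v z); exact: AsubD. Qed.

Definition adj U x : set M := [set z | exists a, U (z - (a%:A : B) *: x)].

Lemma adj_sub U x : U `<=` adj U x.
Proof. by move=> z Uz; exists 0; rewrite scale0r scale0r subr0. Qed.

Lemma adj_mem U x : is_Asubmodule U -> adj U x x.
Proof. by move=> sU; exists 1; rewrite scale1r scale1r subrr; exact: Asub0. Qed.

Lemma alg_scaleM a b x : ((a * b)%:A : B) *: x = (a%:A : B) *: ((b%:A : B) *: x).
Proof. by rewrite [in RHS]scalerA -scalerAl mul1r scalerA. Qed.

Lemma alg_scaleD a b x : ((a + b)%:A : B) *: x = (a%:A : B) *: x + (b%:A : B) *: x.
Proof. by rewrite !scalerDl. Qed.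

Lemma adj_Asub U x : is_Asubmodule U -> is_Asubmodule (adj U x).
Proof.
move=> sU; split; first by apply: adj_sub; exact: Asub0.
move=> a y z [b Uy] [c Uz]; exists (a * b + c).
rewrite alg_scaleD alg_scaleM opprD addrACA -scalerBr.
by case: sU => _; apply.
Qed.

Lemma adj_least U V x : is_Asubmodule V -> U `<=` V -> V x -> adj U x `<=` V.
Proof.
move=> sV UV Vx z [a /UV Vz]; rewrite -(subrK ((a%:A : B) *: x) z).
by apply: AsubD => //; exact: AsubZ.
Qed.

Lemma adj_homo U V x : U `<=` V -> adj U x `<=` adj V x.
Proof. by move=> UV z [a /UV Vz]; exists a. Qed.

End Submodules.

Section RelativeLength.
Variables (A : comNzRingType) (m : set A).
Hypothesis (mU : forall a, ~ m a -> exists b, a * b = 1).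
Variable B : comAlgType A.

(* [rlen U V n]: the A-module V/U has a composition series of length n. *)
Inductive rlen (M : lmodType B) (U : set M) : set M -> nat -> Prop :=
| rlen_nil : rlen U U 0
| rlen_cons V n x : rlen U V n -> ~ V x -> (forall a, m a -> V ((a%:A : B) *: x)) ->
    rlen U (adj V x) n.+1.

Section OneModule.
Variable M : lmodType B.
Implicit Types (U V W : set M).

Lemma rlen_Asub U V n : is_Asubmodule U -> rlen U V n -> is_Asubmodule V /\ U `<=` V.
Proof.
move=> sU; elim=> [|V' n' x _ [sV UV] _ _]; first by split.
by split; [exact: adj_Asub|apply: subset_trans UV _; exact: adj_sub].
Qed.

Lemma rlen_cat U V W n k : rlen U V n -> rlen V W k -> rlen U W (n + k).
Proof.
move=> UV; elim=> [|W' k' x _ IH nx mx]; first by rewrite addn0.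
by rewrite addnS; apply: rlen_cons.
Qed.

(** Exchange property of the simple module (V + Ax)/V: an element [z] outside [V] has a unit as
    coefficient of [x], so [x] lies in V + Az. *)
Lemma unit_coef (V W : set M) z x a : is_Asubmodule V -> ~ V z ->
  (forall a, m a -> V ((a%:A : B) *: x)) -> V (z - (a%:A : B) *: x) ->
  exists b, x - (b%:A : B) *: z = (b%:A : B) *: ((a%:A : B) *: x - z).
Proof.
move=> sV nz mx Vz; have [ma|/mU[b ab]] := pselect (m a).
  by case: nz; rewrite -(subrK ((a%:A : B) *: x) z); apply: AsubD => //; exact: mx.
exists b; rewrite scalerBr -alg_scaleM mulrC ab.
by rewrite !scale1r.
Qed.

(** A composition series of V/U is mapped to (W + V)/W, where each step remains simple or collapses.
    If [W] contains an element of [V] outside [U], the step at which this element enters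
    collapses. *)
Lemma rlen_sumset U V W n : is_Asubmodule U -> is_Asubmodule W -> U `<=` W -> rlen U V n ->
  exists n', [/\ rlen W (sumset W V) n', (n' <= n)%N &
    ((exists2 w, W w /\ V w & ~ U w) -> (n' < n)%N)].
Proof.
move=> sU sW UW; elim=> [|V' k x rUV [k' [rW kk kstr]] nx mx].
  exists 0%N; split=> //; last by case=> w [].
  suff -> : sumset W U = W by exact: rlen_nil.
  apply/seteqP; split; first exact: sumset_least.
  by apply: sumset_subl; exact: Asub0.
have [sV UV] := rlen_Asub sU rUV.
have sWV := sumset_Asub sW sV.
have VWV : V' `<=` sumset W V' by apply: sumset_subr; exact: Asub0.
have WWV : W `<=` sumset W V' by apply: sumset_subl; exact: Asub0.
have sxV := adj_Asub x sV.
have e : sumset W (adj V' x) = adj (sumset W V') x.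
  apply/seteqP; split.
    apply: sumset_least; first exact: adj_Asub.
    - by apply: subset_trans WWV _; exact: adj_sub.
    - exact: adj_homo.
  apply: adj_least; first exact: sumset_Asub.
    apply: sumset_least; first exact: sumset_Asub.
    - by apply: sumset_subl; exact: Asub0.
    - apply: subset_trans (@adj_sub _ _ _ V' x) _.
      by apply: sumset_subr; exact: Asub0.
  by apply: sumset_subr; [exact: Asub0|exact: adj_mem].
rewrite e; have [Wx|nWx] := pselect (sumset W V' x).
  exists k'; rewrite ltnS kk leqW //; split=> //.
  suff -> : adj (sumset W V') x = sumset W V' by [].
  by apply/seteqP; split; [apply: adj_least|exact: adj_sub].
exists k'.+1; split=> //; first by apply: rlen_cons => // a ma; exact/VWV/mx.
case=> w [Ww [a Va]] nw; rewrite ltnS; apply: kstr; exists w => //; split=> //.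
apply: contrapT => nVw; apply: nWx.
have [b eb] := unit_coef W sV nVw mx Va.
rewrite -(subrK ((b%:A : B) *: w) x) eb; apply: AsubD => //.
  by apply: AsubZ => //; rewrite -opprB; apply: AsubN => //; exact: VWV.
by apply: AsubZ => //; exact: WWV.
Qed.

Lemma rlen_sub U V W n : is_Asubmodule U -> is_Asubmodule W -> U `<=` W -> W `<=` V ->
  rlen U V n -> exists n', [/\ rlen W V n', (n' <= n)%N &
    ((exists2 w, W w & ~ U w) -> (n' < n)%N)].
Proof.
move=> sU sW UW WV rUV; have [n' [rW nn nstr]] := rlen_sumset sU sW UW rUV.
have [sV UV] := rlen_Asub sU rUV.
exists n'; split=> //.
  suff <- : sumset W V = V by [].
  apply/seteqP; split; first exact: sumset_least.
  by apply: sumset_subr; exact: Asub0.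
by case=> w Ww nw; apply: nstr; exists w => //; split=> //; exact: WV.
Qed.

Definition Achain U V n (N : nat -> set M) : Prop :=
  (forall i, (i <= n)%N -> [/\ is_Asubmodule (N i), U `<=` N i & N i `<=` V]) /\
  (forall i, (i < n)%N -> N i `<` N i.+1).

Lemma rlen_chain_le U V n k N : is_Asubmodule U -> rlen U V n ->
  Achain U V k N -> (k <= n)%N.
Proof.
move=> sU rUV [NP NS].
have: forall i, (i <= k)%N -> exists n', rlen (N i) V n' /\ (n' + i <= n)%N.
  elim=> [_|i IH ik].
    have [s0 U0 V0] := NP 0%N isT.
    by have [n' [r n'n _]] := rlen_sub sU s0 U0 V0 rUV; exists n'; rewrite addn0.
  have [n' [r n'n]] := IH (ltnW ik).
  have [s1 _ _] := NP i (ltnW ik); have [s2 _ V2] := NP i.+1 ik.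
  have [S12 nS12] := NS i ik.
  have [n'' [r' _ n''n']] := rlen_sub s1 s2 S12 V2 r.
  exists n''; split=> //; rewrite addnS (leq_trans _ n'n) // -addSn leq_add2r.
  apply: n''n'; apply: contrapT => nex; apply: nS12 => w Nw.
  by apply: contrapT => nw; apply: nex; exists w.
by case/(_ k (leqnn k)) => n' [_]; apply: leq_trans; exact: leq_addl.
Qed.

Lemma rlen_chain U V n : is_Asubmodule U -> rlen U V n -> exists N, Achain U V n N.
Proof.
move=> sU; elim=> [|V' k x rUV [N [NP NS]] nx mx].
  by exists (fun _ => U); split=> // i _; split.
have [sV UV] := rlen_Asub sU rUV.
exists (fun i => if (i <= k)%N then N i else adj V' x); split=> [i|i].
  rewrite leq_eqVlt => /predU1P[->|]; last first.
    rewrite ltnS => ik; rewrite ik; have [sN UN NV] := NP i ik; split=> //.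
    by apply: subset_trans NV _; exact: adj_sub.
  rewrite ltnn; split=> //; first exact: adj_Asub.
  by apply: subset_trans UV _; exact: adj_sub.
move=> ik1; have ik := ik1; rewrite ltnS leq_eqVlt in ik; rewrite (ik1 : (i <= k)%N).
case/predU1P: ik => ik.
  rewrite ik ltnn; have [sN UN NV] := NP k (leqnn k); split.
    by apply: subset_trans NV _; exact: adj_sub.
  by move=> sub; apply/nx/NV/sub; exact: adj_mem.
by rewrite ik; exact: NS.
Qed.

Lemma rlen_uniq U V n n' : is_Asubmodule U -> rlen U V n -> rlen U V n' -> n = n'.
Proof.
move=> sU r r'; apply/eqP; rewrite eqn_leq.
have [N NP] := rlen_chain sU r; have [N' NP'] := rlen_chain sU r'.
by rewrite (rlen_chain_le sU r' NP) (rlen_chain_le sU r NP').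
Qed.

Lemma sup_nat_max (S : set nat) n : S n -> (forall k, S k -> (k <= n)%N) ->
  sup_nat S = n%:Z%:E.
Proof.
move=> Sn le; rewrite /sup_nat /supremum.
have sup : supremums [set (k%:Z)%:E | k in S] n%:Z%:E.
  split; first by move=> _ [k /le kn <-]; rewrite lee_fin lez_nat.
  by move=> y; apply; exists n.
case: ifPn => [/eqP e0|_].
  suff : (set0 : set (\bar int)) n%:Z%:E by [].
  by rewrite -e0; exists n.
by case: xgetP => [y _ /is_subset1_supremums|/(_ _ sup)//]; exact.
Qed.

Lemma sup_nat0 (S : set nat) : (forall k, ~ S k) -> sup_nat S = -oo%E.
Proof.
move=> nS; rewrite /sup_nat.
have -> : S = set0 by apply/seteqP; split=> // k /nS.
by rewrite image_set0 supremum0.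
Qed.

Lemma Alength_rlen V n : rlen [set 0] V n -> Alength V = n%:Z%:E.
Proof.
move=> r; have s0 := @Asub_zero A B M.
apply: sup_nat_max.
  have [N [NP NS]] := rlen_chain s0 r; exists N; split=> // i /NP[sN _ NV].
  by split.
move=> k [N [NP NS]]; apply: (rlen_chain_le (N := N) s0 r); split=> // i /NP[sN NV].
by split=> // _ ->; exact: Asub0.
Qed.

(* Each element of the list lies outside the A-module generated by U and the
   previous ones. *)
Fixpoint chl U (s : seq M) : Prop :=
  if s is x :: s' then ~ U x /\ chl (adj U x) s' else True.

Lemma chl_size U V n (s : seq M) : is_Asubmodule U -> rlen U V n ->
  (forall x, x \in s -> V x) -> chl U s -> (size s <= n)%N.
Proof.
elim: s U n => //= x s IH U n sU rUV sV [nx cs].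
have [sV' UV] := rlen_Asub sU rUV.
have Vx : V x by apply: sV; rewrite mem_head.
have [n' [r _ n'n]] :=
  rlen_sub sU (adj_Asub x sU) (@adj_sub _ _ _ U x) (adj_least sV' UV Vx) rUV.
apply: leq_ltn_trans (n'n _); last by exists x => //; exact: adj_mem.
by apply: IH r _ cs => [|y ys]; [exact: adj_Asub|apply: sV; rewrite inE ys orbT].
Qed.

Lemma chl_sub U U' (s : seq M) : U' `<=` U -> chl U s -> chl U' s.
Proof.
elim: s U U' => //= x s IH U U' UU [nx cs]; split; first by move/UU.
by apply: IH cs; exact: adj_homo.
Qed.

Lemma chl_cat U Q (s1 s2 : seq M) : is_Asubmodule Q -> U `<=` Q ->
  (forall x, x \in s1 -> Q x) -> chl U s1 -> chl Q s2 -> chl U (s1 ++ s2).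
Proof.
move=> sQ; elim: s1 U => /= [|x s1 IH] U UQ s1Q; first by move=> _; exact: chl_sub.
case=> nx c1 c2; split=> //; apply: IH => //.
  by apply: adj_least => //; apply: s1Q; rewrite mem_head.
by move=> y ys; apply: s1Q; rewrite inE ys orbT.
Qed.

End OneModule.

Section Linear.
Variables (M M' : lmodType B) (f : M -> M').
Hypothesis fZD : forall (a : A) x y, f ((a%:A : B) *: x + y) = (a%:A : B) *: f x + f y.

Let fB x y : f (x - y) = f x - f y.
Proof.
have := fZD (-1) y x; rewrite !scaleN1r addrC => ->.
by rewrite addrC.
Qed.

(** [f] induces an injection of V/U into M'/U'. It will be multiplication of ring elements by a
    module element, the projection onto M/H^0, and the identity in the second isomorphism
    theorem. *)
Lemma rlen_map (U V : set M) (U' : set M') n :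
  is_Asubmodule U -> is_Asubmodule U' -> rlen U V n ->
  (forall z, V z -> (U' (f z) <-> U z)) ->
  rlen U' [set z' | exists2 v, V v & U' (z' - f v)] n.
Proof.
move=> sU sU'; elim=> [|W k x rUV IH nx mx] UU.
  set X := (X in rlen U' X 0); suff -> : X = U' by exact: rlen_nil.
  apply/seteqP; split=> z.
    by case=> v Uv Uz; rewrite -(subrK (f v) z); apply: AsubD => //; exact/UU.
  move=> Uz; exists 0; first exact: Asub0.
  by apply: AsubB => //; apply/UU; exact: Asub0.
have [sV UV] := rlen_Asub sU rUV.
set X := (X in rlen U' X _).
pose Y := [set z' | exists2 v, W v & U' (z' - f v)].
have -> : X = adj Y (f x).
  apply/seteqP; split=> z.
    case=> v [a Wv] Uz; exists a; exists (v - (a%:A : B) *: x) => //.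
    by rewrite -addrA -opprD -fZD [X in f X]addrC subrK.
  case=> a [v Wv Uz]; exists ((a%:A : B) *: x + v); last by rewrite fZD opprD addrA.
  by exists a; rewrite addrAC subrr add0r.
apply: rlen_cons.
- by apply: IH => z Wz; apply: UU; exact: adj_sub.
- case=> v Wv; rewrite -fB => /UU-Uxv; apply: nx.
  rewrite -(subrK v x); apply: AsubD => //; apply/UV/Uxv.
  by apply: AsubB; [exact: adj_Asub|exact: adj_mem|exact: adj_sub].
- move=> a /mx Wax; exists ((a%:A : B) *: x) => //.
  rewrite -[_ *: x]addr0 fZD opprD addrA subrr sub0r; apply: AsubN => //.
  by apply/UU; [by apply: adj_sub; exact: Asub0|exact: Asub0].
Qed.

Lemma chl_map (U : set M) (U' : set M') (s : seq M) :
  (forall z, U' (f z) -> U z) -> chl U s -> chl U' [seq f x | x <- s].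
Proof.
elim: s U U' => //= x s IH U U' UU [nx cs]; split; first by move/UU.
apply: IH cs => z [a Uz]; exists a; apply: UU.
by rewrite addrC -scaleNr -scaleNr fZD scaleNr scaleNr addrC.
Qed.

End Linear.

Lemma rlen_diamond (M : lmodType B) (U V : set M) n :
  is_Asubmodule U -> is_Asubmodule V -> rlen (U `&` V) V n -> rlen U (sumset U V) n.
Proof.
move=> sU sV r; have sUV := AsubI sU sV.
apply: (rlen_map (f := id) _ sUV sU r) => // z Vz.
by split=> [Uz|[]].
Qed.

End RelativeLength.

(** * Homogeneous components *)

Section Components.
Variables (I : eqType) (V : zmodType) (G : I -> set V).
Implicit Types (s t : seq I) (f g : I -> V) (i j : I) (v w : V).

(** Demanding that [f] vanish outside [s] makes [f] unique, although [s] is not. *)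
Definition decomposition v s f : Prop :=
  [/\ uniq s, forall i, G i (f i), forall i, i \notin s -> f i = 0 &
      v = \sum_(i <- s) f i].

Definition gcomp i v : V :=
  xget 0 [set x | exists s f, decomposition v s f /\ x = f i].

Hypothesis dG : direct_sum G.

Lemma dsum0 i : G i 0. Proof. by case: dG => /(_ i)[]. Qed.

Lemma dsumB i v w : G i v -> G i w -> G i (v - w).
Proof. by case: dG => /(_ i)[_ +] _ _; exact. Qed.

Lemma dsumN i v : G i v -> G i (- v).
Proof. by rewrite -sub0r; apply: dsumB; exact: dsum0. Qed.

Lemma dsumD i v w : G i v -> G i w -> G i (v + w).
Proof. by move=> Gv Gw; rewrite -[w]opprK; apply: dsumB => //; exact: dsumN. Qed.

Lemma sum_extend s t f : uniq s -> uniq t -> {subset s <= t} ->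
  (forall i, i \notin s -> f i = 0) -> \sum_(i <- t) f i = \sum_(i <- s) f i.
Proof.
move=> us ut st f0; rewrite (bigID (mem s)) /= [X in _ + X]big1; last by move=> i /f0.
rewrite addr0 -big_filter; apply: perm_big; apply: uniq_perm => //.
  exact: filter_uniq.
by move=> i; rewrite mem_filter; case: (boolP (i \in s)) => // /st.
Qed.

Lemma decompositionB v w s t f g : decomposition v s f -> decomposition w t g ->
  decomposition (v - w) (undup (s ++ t)) (fun i => f i - g i).
Proof.
move=> [us Gf f0 ->] [ut Gg g0 ->]; split.
- exact: undup_uniq.
- by move=> i; exact: dsumB.
- by move=> i; rewrite mem_undup mem_cat negb_or => /andP[/f0-> /g0->]; rewrite subr0.
rewrite sumrB; congr (_ - _); apply/esym/sum_extend => //; try exact: undup_uniq.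
  by move=> i si; rewrite mem_undup mem_cat si.
by move=> i si; rewrite mem_undup mem_cat si orbT.
Qed.

Lemma decomposition_uniq v s t f g i : decomposition v s f -> decomposition v t g ->
  f i = g i.
Proof.
move=> dv dv'; have [us Gh h0 /esym] := decompositionB dv dv'.
rewrite subrr => e; apply/eqP; rewrite -subr_eq0; apply/eqP.
have [si|/h0//] := boolP (i \in undup (s ++ t)).
by case: dG => _ _ /(_ _ _ us Gh e)/(_ i si).
Qed.

Lemma gcompE v s f i : decomposition v s f -> gcomp i v = f i.
Proof.
move=> dv; rewrite /gcomp; case: xgetP => [x _ [t [g [dv' ->]]]|/(_ (f i))[]].
  exact: decomposition_uniq dv' dv.
by exists s, f.
Qed.

Lemma gcompP v : exists s, decomposition v s (gcomp^~ v).
Proof.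
have [_ /(_ v)[s [f [us Gf vE]]] _] := dG.
have dv : decomposition v s (fun i => if i \in s then f i else 0).
  split=> //; first by move=> i; case: ifP => // _; exact: dsum0.
    by move=> i /negbTE->.
  by rewrite vE big_seq [RHS]big_seq; apply: eq_bigr => i ->.
exists s; have -> // : gcomp^~ v = (fun i => if i \in s then f i else 0).
by apply/funext => i; exact: gcompE dv.
Qed.

Lemma gcomp_in i v : G i (gcomp i v).
Proof. by have [s [_ Gv _ _]] := gcompP v; exact: Gv. Qed.

Lemma gcompB i v w : gcomp i (v - w) = gcomp i v - gcomp i w.
Proof.
have [s dv] := gcompP v; have [t dw] := gcompP w.
exact: gcompE (decompositionB dv dw).
Qed.

Lemma gcomp0 i : gcomp i 0 = 0.
Proof. by have := gcompB i 0 0; rewrite !subrr. Qed.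

Lemma gcompN i v : gcomp i (- v) = - gcomp i v.
Proof. by rewrite -[- v]sub0r gcompB gcomp0 sub0r. Qed.

Lemma gcompD i v w : gcomp i (v + w) = gcomp i v + gcomp i w.
Proof. by rewrite -{1}[w]opprK gcompB gcompN opprK. Qed.

Lemma gcomp_sum (T : Type) (s : seq T) (P : pred T) (F : T -> V) i :
  gcomp i (\sum_(j <- s | P j) F j) = \sum_(j <- s | P j) gcomp i (F j).
Proof. by apply: big_morph; [exact: gcompD|exact: gcomp0]. Qed.

Lemma gcomp_homog i j v : G i v -> gcomp j v = if j == i then v else 0.
Proof.
move=> Gv; rewrite (@gcompE v [:: i] (fun j => if j == i then v else 0)) //.
split=> //; last by rewrite big_seq1 eqxx.
  by move=> k; case: eqP => [->|_] //; exact: dsum0.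
by move=> k; rewrite inE => /negbTE->.
Qed.

Lemma gcomp_id i v : G i v -> gcomp i v = v.
Proof. by move/gcomp_homog->; rewrite eqxx. Qed.

Definition gclosed (U : set V) : Prop := forall i v, U v -> U (gcomp i v).

Lemma gclosed_zero : gclosed [set 0].
Proof. by move=> i _ ->; rewrite /= gcomp0. Qed.

Lemma gcomp_closed_mem (U : set V) v : U 0 -> (forall x y, U x -> U y -> U (x + y)) ->
  (forall i, U (gcomp i v)) -> U v.
Proof.
move=> U0 UD Uv; have [s [_ _ _ ->]] := gcompP v.
by elim/big_rec: _ => // i x _; apply: UD.
Qed.

End Components.

Lemma seq_max (d : Order.disp_t) (T : orderType d) (s : seq T) (P : T -> Prop) :
  (exists2 x, x \in s & P x) ->
  exists x, [/\ x \in s, P x & forall y, y \in s -> P y -> (y <= x)%O].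
Proof.
elim: s => [|a s IH] [x]; first by rewrite in_nil.
have [[y ys Py] _ _|nex] := pselect (exists2 y, y \in s & P y).
  have [z [zs Pz zmax]] := IH (ex_intro2 _ _ y ys Py).
  have [Pa|nPa] := pselect (P a); last first.
    exists z; split=> //; first by rewrite inE zs orbT.
    by move=> w; rewrite inE => /predU1P[-> //|]; exact: zmax.
  have [az|za] := leP a z; [exists z|exists a]; split=> //.
  - by rewrite inE zs orbT.
  - by move=> w; rewrite inE => /predU1P[-> //|]; exact: zmax.
  - exact: mem_head.
  - move=> w; rewrite inE => /predU1P[-> //|ws Pw].
    by apply: le_trans (ltW za); exact: zmax.
rewrite inE => /predU1P[-> Pa|xs Px]; last by case: nex; exists x.
exists a; split=> //; first exact: mem_head.
by move=> w; rewrite inE => /predU1P[-> //|ws Pw]; case: nex; exists w.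
Qed.

Section IntegerDegrees.
Variable r : nat.
Implicit Types (mu nu : grade r) (n : 'X_{1..r}).

Definition grade_abs nu : 'X_{1..r} := [multinom `|nu i|%N | i < r].

Lemma gradeNK n : grade_abs (gradeN n) = n.
Proof. by apply/mnmP => i; rewrite mnmE ffunE. Qed.

Lemma gradeN_inj : injective (@gradeN r).
Proof. exact: can_inj gradeNK. Qed.

Lemma gradeN0 : gradeN 0%MM = 0 :> grade r.
Proof. by apply/ffunP => i; rewrite !ffunE mnm0E. Qed.

Lemma gradeND m n : gradeN (m + n)%MM = gradeN m + gradeN n :> grade r.
Proof. by apply/ffunP => i; rewrite !ffunE mnmDE PoszD. Qed.

Lemma grade_absK nu : (forall i, 0 <= nu i) -> gradeN (grade_abs nu) = nu.
Proof. by move=> nu0; apply/ffunP => i; rewrite ffunE mnmE gez0_abs. Qed.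

Lemma grade_neq0 nu : nu != 0 -> exists i, nu i != 0.
Proof.
move=> nu0; apply/existsP; apply: contraT; rewrite negb_exists => /forallP h.
by case/eqP: nu0; apply/ffunP => i; rewrite ffunE; apply/eqP; have := h i; rewrite negbK.
Qed.

Lemma mdeg_ones : mdeg [multinom 1 | _ < r] = r.
Proof. by rewrite mdegE; under eq_bigr do rewrite mnmE; rewrite sum1_card card_ord. Qed.

(** Zero in the degrees with a negative entry puts the ring and the module over the same group of
    degrees, so that shifts can be subtracted freely. *)
Definition extend_grading (V : zmodType) (G : 'X_{1..r} -> set V) nu : set V :=
  [set v | v = 0 \/ exists2 n, nu = gradeN n & G n v].

Lemma extend_grading_pos (V : zmodType) (G : 'X_{1..r} -> set V) nu v :
  extend_grading G nu v -> v <> 0 -> forall i, 0 <= nu i.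
Proof. by case=> // -[n -> _] _ i; rewrite ffunE. Qed.

Lemma extend_gradingN (V : zmodType) (G : 'X_{1..r} -> set V) n : G n 0 ->
  extend_grading G (gradeN n) = G n.
Proof.
move=> G0; apply/seteqP; split=> v; first by case=> [->|[k /gradeN_inj<-]].
by move=> Gv; right; exists n.
Qed.

Lemma direct_sum_shift (V : zmodType) (G : 'X_{1..r} -> set V) :
  direct_sum G -> direct_sum (extend_grading G).
Proof.
move=> dG; have G0 := dsum0 dG; split.
- move=> nu; split=> [|x y]; first by left.
  case=> [->|[n nn Gx]] [->|[k nk Gy]].
  + by left; rewrite subrr.
  + by right; exists k => //; apply: dsumB.
  + by right; exists n => //; apply: dsumB.
  + right; exists n => //; apply: dsumB => //.
    by rewrite nn in nk; rewrite (gradeN_inj nk).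
- move=> v; have [_ /(_ v)[s [f [us Gf ->]]] _] := dG.
  pose g nu := if nu == gradeN (grade_abs nu) then f (grade_abs nu) else 0.
  exists (map (@gradeN r) s), g; split.
  + by rewrite map_inj_uniq //; exact: gradeN_inj.
  + move=> nu; rewrite /g; case: eqP => [nuE|_]; last by left.
    by right; exists (grade_abs nu).
  + by rewrite big_map; apply: eq_bigr => n _; rewrite /g gradeNK eqxx.
- move=> s f us Gf s0 nu nus.
  have [->//|f0] := eqVneq (f nu) 0.
  have pos mu : f mu != 0 -> mu = gradeN (grade_abs mu).
    by move=> /eqP fmu; rewrite grade_absK // => i; apply: extend_grading_pos (Gf mu) fmu i.
  have [_ _ ind] := dG.
  pose t := [seq grade_abs mu | mu <- s & f mu != 0].
  have ut : uniq t.
    rewrite map_inj_in_uniq ?filter_uniq // => x y.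
    rewrite !mem_filter => /andP[/pos xE _] /andP[/pos yE _] xy.
    by rewrite xE xy -yE.
  have Gt n : G n (f (gradeN n)) by rewrite -(extend_gradingN (G0 n)).
  have nut : grade_abs nu \in t by apply: map_f; rewrite mem_filter f0.
  have := ind t (fun n => f (gradeN n)) ut Gt _ _ nut.
  rewrite -pos //; apply; rewrite big_map big_filter -[RHS]s0 [RHS](bigID (fun mu => f mu != 0)) /=.
  rewrite [X in _ = _ + X]big1 ?addr0; last by move=> i; rewrite negbK => /eqP.
  by apply: eq_bigr => mu /pos <-.
Qed.

Lemma gcomp_shift (V : zmodType) (G : 'X_{1..r} -> set V) (dG : direct_sum G) n v :
  gcomp (extend_grading G) (gradeN n) v = gcomp G n v.
Proof.
have [s dv] := gcompP dG v; have [us Gv v0 vE] := dv.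
rewrite {1}vE gcomp_sum; last exact: direct_sum_shift.
have e k : gcomp (extend_grading G) (gradeN n) (gcomp G k v) = if k == n then gcomp G k v else 0.
  rewrite (@gcomp_homog _ _ _ (direct_sum_shift dG) (gradeN k)).
    by rewrite (inj_eq gradeN_inj) eq_sym.
  by rewrite extend_gradingN //; exact: dsum0.
rewrite (eq_bigr _ (fun k _ => e k)) -big_mkcond /=.
have [ns|/[dup] /v0 -> ns] := boolP (n \in s).
  rewrite (eq_bigl (pred1 n)) // -big_filter filter_pred1_uniq // big_seq1 //.
rewrite big_seq_cond big1 // => k /andP[ks /eqP kn].
by rewrite kn (negbTE ns) in ks.
Qed.

End IntegerDegrees.

(** * Prime filtrations *)

Record graded_alg (A : comNzRingType) (B : comAlgType A) (r : nat)
    (Bz : grade r -> set B) : Prop := GradedAlg {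
  galg_dsum : direct_sum Bz;
  galg_in : forall a, Bz 0 (in_alg B a);
  galg_0 : forall b, Bz 0 b -> exists a, b = in_alg B a;
  galg_mul : forall mu nu a b, Bz mu a -> Bz nu b -> Bz (mu + nu) (a * b);
  galg_pos : forall nu b, Bz nu b -> b <> 0 -> forall i, 0 <= nu i }.

Record graded_mod (A : comNzRingType) (B : comAlgType A) (r : nat)
    (Bz : grade r -> set B) (M : lmodType B) (Mg : grade r -> set M) : Prop := GradedMod {
  gmod_dsum : direct_sum Mg;
  gmod_act : forall mu nu b x, Bz mu b -> Mg nu x -> Mg (mu + nu) (b *: x) }.

Section BSubmodules.
Variables (B : comNzRingType) (M : lmodType B).
Implicit Types (U V W : set M) (b : B) (x y : M).

Definition is_Bsubmodule U : Prop := U 0 /\ forall b x y, U x -> U y -> U (b *: x + y).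

Lemma Bsub0 U : is_Bsubmodule U -> U 0. Proof. by case. Qed.

Lemma BsubD U x y : is_Bsubmodule U -> U x -> U y -> U (x + y).
Proof. by case=> _ UP Ux Uy; have := UP 1 x y Ux Uy; rewrite scale1r. Qed.

Lemma BsubZ U b x : is_Bsubmodule U -> U x -> U (b *: x).
Proof. by case=> U0 UP Ux; have := UP b x 0 Ux U0; rewrite addr0. Qed.

Lemma BsubN U x : is_Bsubmodule U -> U x -> U (- x).
Proof. by move=> sU /(BsubZ (-1) sU); rewrite scaleN1r. Qed.

Lemma Bsub_zero : is_Bsubmodule [set 0 : M].
Proof. by split=> // b x y -> ->; rewrite scaler0 addr0. Qed.

Definition Badj V y : set M := [set z | exists b, V (z - b *: y)].

Lemma Badj_sub V y : V `<=` Badj V y.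
Proof. by move=> z Vz; exists 0; rewrite scale0r subr0. Qed.

Lemma Badj_mem V y : is_Bsubmodule V -> Badj V y y.
Proof. by move=> sV; exists 1; rewrite scale1r subrr; exact: Bsub0. Qed.

Lemma Badj_Bsub V y : is_Bsubmodule V -> is_Bsubmodule (Badj V y).
Proof.
move=> sV; split; first by apply: Badj_sub; exact: Bsub0.
move=> b x z [c Vx] [d Vz]; exists (b * c + d).
rewrite scalerDl -scalerA opprD addrACA -scalerBr.
by case: sV => _; apply.
Qed.

Lemma Badj_least V W y : is_Bsubmodule W -> V `<=` W -> W y -> Badj V y `<=` W.
Proof.
move=> sW VW Wy z [b /VW Wz]; rewrite -(subrK (b *: y) z).
by apply: BsubD => //; exact: BsubZ.
Qed.

Definition colon V y : set B := [set b | V (b *: y)].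

Lemma colon_ideal V y : is_Bsubmodule V -> is_ideal (colon V y).
Proof.
move=> sV; split; first by rewrite /colon /= scale0r; exact: Bsub0.
move=> a b c Vb Vc; rewrite /colon /= scalerDl -scalerA.
by case: sV => _; apply.
Qed.

End BSubmodules.

Lemma Bsub_Asub (A : comNzRingType) (B : comAlgType A) (M : lmodType B) (U : set M) :
  is_Bsubmodule U -> is_Asubmodule U.
Proof. by case=> U0 UP; split=> // a x y; exact: UP. Qed.

Section GradedPrimes.
Variables (A : comNzRingType) (B : comAlgType A) (r : nat) (Bz : grade r -> set B).
Hypothesis gB : graded_alg Bz.
Let dB := galg_dsum gB.

Definition gprime (P : set B) : Prop :=
  [/\ is_ideal P, ~ P 1, forall a b, P (a * b) -> P a \/ P b & gclosed Bz P].

Section OneModule.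
Variables (M : lmodType B) (Mg : grade r -> set M).
Hypothesis gM : graded_mod Bz Mg.
Let dM := gmod_dsum gM.
Implicit Types (U V W : set M) (b : B) (x y : M) (mu nu : grade r).

Lemma gcompZl nu a b y : Mg a y -> gcomp Mg nu (b *: y) = gcomp Bz (nu - a) b *: y.
Proof.
move=> My; have [s [us Bs b0 {1}->]] := gcompP dB b.
rewrite scaler_suml (gcomp_sum dM).
have e i : gcomp Mg nu (gcomp Bz i b *: y) = if i == nu - a then gcomp Bz i b *: y else 0.
  rewrite (@gcomp_homog _ _ _ dM (i + a)); last exact: gmod_act (Bs i) My.
  by rewrite -subr_eq eq_sym.
rewrite (eq_bigr _ (fun i _ => e i)) -big_mkcond /=.
have [ns|/b0 e0] := boolP (nu - a \in s).
  by rewrite -big_filter filter_pred1_uniq // big_seq1.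
by rewrite e0 scale0r big1 // => i /eqP ->; rewrite e0 scale0r.
Qed.

Lemma gcompZr nu a b y : Bz a b -> gcomp Mg nu (b *: y) = b *: gcomp Mg (nu - a) y.
Proof.
move=> Bb; have [s [us Ms y0 {1}->]] := gcompP dM y.
rewrite scaler_sumr (gcomp_sum dM).
have e i : gcomp Mg nu (b *: gcomp Mg i y) = if i == nu - a then b *: gcomp Mg i y else 0.
  rewrite (@gcomp_homog _ _ _ dM (a + i)); last exact: gmod_act Bb (Ms i).
  by rewrite [a + i]addrC -subr_eq eq_sym.
rewrite (eq_bigr _ (fun i _ => e i)) -big_mkcond /=.
have [ns|/y0 e0] := boolP (nu - a \in s).
  by rewrite -big_filter filter_pred1_uniq // big_seq1.
by rewrite e0 scaler0 big1 // => i /eqP ->; rewrite e0 scaler0.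
Qed.

Lemma Badj_gclosed V y a : is_Bsubmodule V -> gclosed Mg V -> Mg a y ->
  gclosed Mg (Badj V y).
Proof.
move=> sV gV My nu z [b Vz]; exists (gcomp Bz (nu - a) b).
by rewrite -(gcompZl nu b My) -(gcompB dM); exact: gV.
Qed.

Lemma colon_gclosed V y a : gclosed Mg V -> Mg a y -> gclosed Bz (colon V y).
Proof.
move=> gV My nu b Vb; rewrite /colon /=.
by have := gV (nu + a) _ Vb; rewrite (gcompZl _ _ My) addrK.
Qed.

End OneModule.

Lemma graded_mod_regular : graded_mod Bz (Bz : grade r -> set B^o).
Proof. by split=> //; exact: galg_mul. Qed.

(* The leading components outside P of two elements outside P have their product
   outside P. *)
Lemma gprime_criterion (P : set B) : is_ideal P -> ~ P 1 -> gclosed Bz P ->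
  (forall mu nu a b, Bz mu a -> Bz nu b -> P (a * b) -> P a \/ P b) -> gprime P.
Proof.
move=> iP nP1 gP hP; split=> // a b Pab; apply: contrapT => /not_orP[nPa nPb].
(* Components outside [P] are nonzero, so their degrees lie in N^r, where the monomial order is
   total and compatible with addition. *)
have lead c : ~ P c -> exists n : 'X_{1..r}, ~ P (gcomp Bz (gradeN n) c) /\
    forall nu, ~ P (gcomp Bz nu c) ->
      nu = gradeN (grade_abs nu) /\ (grade_abs nu <= n)%O.
  move=> nPc; have [s [us Bs c0 cE]] := gcompP dB c.
  have pos nu : ~ P (gcomp Bz nu c) -> nu = gradeN (grade_abs nu).
    move=> nPn; rewrite grade_absK //; apply: galg_pos (Bs nu) _ => // e.
    by apply: nPn; rewrite e; exact: ideal0.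
  have [|n [ns nPn nmax]] := @seq_max _ _ (map (@grade_abs r) s)
      (fun n => ~ P (gcomp Bz (gradeN n) c)).
    apply: contrapT => nex; apply: nPc; apply: (gcomp_closed_mem dB).
    - exact: ideal0.
    - by move=> *; exact: idealD.
    - move=> nu; apply: contrapT => nPn; apply: nex; exists (grade_abs nu).
        by apply: map_f; apply: contraT => /c0 e; case: nPn; rewrite e; exact: ideal0.
      by rewrite -pos.
  exists n; split=> // nu nPnu; have nuE := pos _ nPnu; split=> //.
  apply: nmax; last by rewrite -nuE.
  by apply: map_f; apply: contraT => /c0 e; case: nPnu; rewrite e; exact: ideal0.
have [n [nPn nmax]] := lead _ nPa; have [k [nPk kmax]] := lead _ nPb.
have [s [us As a0 aE]] := gcompP dB a.
have ns : gradeN n \in s.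
  by apply: contraT => /a0 e; case: nPn; rewrite e; exact: ideal0.
have gR := graded_mod_regular.
suff : P (gcomp Bz (gradeN n) a * gcomp Bz (gradeN k) b).
  by move/(hP _ _ _ _ (gcomp_in dB _ _) (gcomp_in dB _ _)); case.
have := gP (gradeN n + gradeN k) _ Pab.
rewrite {1}aE mulr_suml (gcomp_sum dB) (bigD1_seq (gradeN n)) //=.
rewrite (gcompZr gR (gradeN n + gradeN k) b (As (gradeN n))) addrAC subrr add0r.
set X := \sum_(i <- s | _) _; move=> PX.
suff PX' : P X by rewrite -[_ * _](addrK X); exact: idealB.
apply: ideal_sum => // i ni.
rewrite (gcompZr gR (gradeN n + gradeN k) b (As i)).
have [Pi|nPi] := pselect (P (gcomp Bz i a)); first exact: idealMr.
have [Pj|nPj] := pselect (P (gcomp Bz (gradeN n + gradeN k - i) b)); first exact: idealMl.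
have [iE iln] := nmax _ nPi; have [jE jlk] := kmax _ nPj.
(* With both factors outside [P] and [i] different from the leading degree [n], one degree is below
   [n] and the other at most [k], although they add up to n + k. *)
have e : (n + k)%MM = (grade_abs i + grade_abs (gradeN n + gradeN k - i)%R)%MM.
  by apply: gradeN_inj; rewrite !gradeND -iE -jE [RHS]addrC subrK.
have lt : (grade_abs i < n)%O.
  rewrite lt_neqAle iln andbT; apply: contra ni => /eqP <-; rewrite -iE //.
by have := ltmc_le_add lt jlk; rewrite -e ltxx.
Qed.

Section Filtrations.
Variables (M : lmodType B) (Mg : grade r -> set M).
Hypothesis gM : graded_mod Bz Mg.
Let dM := gmod_dsum gM.
Implicit Types (U V W : set M) (b : B) (x y : M) (mu nu : grade r).

(* The list records the prime P and the shift a of each quotient B/P(-a). *)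
Inductive pfilt U : set M -> seq (set B * grade r) -> Prop :=
| pfilt_nil : pfilt U U [::]
| pfilt_cons V L y a : pfilt U V L -> Mg a y -> gprime (colon V y) ->
    pfilt U (Badj V y) ((colon V y, a) :: L).

Lemma pfilt_sub U V L : is_Bsubmodule U -> gclosed Mg U -> pfilt U V L ->
  [/\ is_Bsubmodule V, gclosed Mg V & U `<=` V].
Proof.
move=> sU gU; elim=> [|V' L' y a _ [sV gV UV] My pV]; first by split.
split; [exact: Badj_Bsub|exact: Badj_gclosed My|].
by apply: subset_trans UV _; exact: Badj_sub.
Qed.

Lemma pfilt_cat U V W L L' : pfilt U V L -> pfilt V W L' -> pfilt U W (L' ++ L).
Proof. by move=> UV; elim=> //= W' L'' y a _ IH My pV; exact: pfilt_cons. Qed.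

Lemma pfilt_prime U V L p : pfilt U V L -> List.In p L -> gprime p.1.
Proof. by elim=> [|V' L' y c _ IH My pV] //= [<-//|]. Qed.

Hypothesis nB : noetherian B.

(* Noetherian induction on the ideal (U : y): when it is not prime it contains a
   product ab of homogeneous elements not in it, and both (U : by) and
   (U + B by : y) are strictly larger. *)
Lemma pfilt_adj U y a : is_Bsubmodule U -> gclosed Mg U -> Mg a y ->
  exists L, pfilt U (Badj U y) L.
Proof.
(* The induction runs over the ideal alone, because [U], [y] and the degree of [y] change in the
   recursive calls. *)
suff H I : is_ideal I -> forall U y a, I = colon U y ->
    is_Bsubmodule U -> gclosed Mg U -> Mg a y -> exists L, pfilt U (Badj U y) L.
  by move=> sU gU My; exact: (H _ (colon_ideal y sU) U y a erefl sU gU My).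
move: I; apply: (noetherian_ind nB) => I iI IH {}U {}y {}a IE sU gU My.
have [Uy|nUy] := pselect (U y).
  exists [::]; suff -> : Badj U y = U by exact: pfilt_nil.
  by apply/seteqP; split; [exact: Badj_least|exact: Badj_sub].
have [pI|npI] := pselect (gprime (colon U y)).
  by exists [:: (colon U y, a)]; apply: pfilt_cons => //; exact: pfilt_nil.
have [mu [nu [b [c [Bb Bc [Ibc nIb nIc]]]]]] : exists mu nu b c, [/\ Bz mu b, Bz nu c &
    [/\ colon U y (b * c), ~ colon U y b & ~ colon U y c]].
  apply: contrapT => nex; apply: npI; apply: gprime_criterion.
  - exact: colon_ideal.
  - by rewrite /colon /= scale1r.
  - exact: colon_gclosed My.
  - move=> mu nu b c Bb Bc Ibc; apply: contrapT => /not_orP[nb nc]; apply: nex.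
    by exists mu, nu, b, c.
have Mcy : Mg (nu + a) (c *: y) by exact: (gmod_act gM).
have [||L1 fL1] := IH _ (colon_ideal (c *: y) sU) _ _ U (c *: y) (nu + a) erefl sU gU Mcy.
- by rewrite IE => d; rewrite /colon /= => Ud; rewrite scalerA mulrC -scalerA; exact: BsubZ.
- move=> e; apply: nIb; rewrite -IE -e /colon /= scalerA; exact: Ibc.
have sV := Badj_Bsub (c *: y) sU; have gV := Badj_gclosed gM sU gU Mcy.
have [||L2 fL2] := IH _ (colon_ideal y sV) _ _ (Badj U (c *: y)) y a erefl sV gV My.
- by rewrite IE => d Ud; exact: Badj_sub.
- by move=> e; apply: nIc; rewrite -IE -e; exact: Badj_mem.
exists (L2 ++ L1); apply: pfilt_cat fL1 _.
suff <- : Badj (Badj U (c *: y)) y = Badj U y by [].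
have sy := Badj_Bsub y sU.
apply/seteqP; split.
  apply: Badj_least => //; last exact: Badj_mem.
  apply: Badj_least => //; first exact: Badj_sub.
  by apply: BsubZ => //; exact: Badj_mem.
apply: Badj_least; [exact: Badj_Bsub| |exact: Badj_mem].
by apply: subset_trans (@Badj_sub _ _ _ (c *: y)) _; exact: Badj_sub.
Qed.

Lemma pfilt_seq U (s : seq M) : is_Bsubmodule U -> gclosed Mg U ->
  (forall y, y \in s -> exists a, Mg a y) ->
  exists V L, pfilt U V L /\ forall y, y \in s -> V y.
Proof.
move=> sU gU; elim: s => [|y s IH] sM; first by exists U, [::]; split=> //; exact: pfilt_nil.
have [V [L [fL Vs]]] : exists V L, pfilt U V L /\ forall y, y \in s -> V y.
  by apply: IH => z zs; apply: sM; rewrite inE zs orbT.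
have [a My] := sM y (mem_head _ _).
have [sV gV _] := pfilt_sub sU gU fL.
have [L' fL'] := pfilt_adj sV gV My.
exists (Badj V y), (L' ++ L); split; first exact: pfilt_cat fL'.
move=> z; rewrite inE => /predU1P[->|/Vs]; [exact: Badj_mem|exact: Badj_sub].
Qed.

Lemma pfilt_exists U : fin_gen M -> is_Bsubmodule U -> gclosed Mg U ->
  exists L, pfilt U setT L.
Proof.
move=> [s sP] sU gU.
have [t [tM tV]] : exists t : seq M, (forall y, y \in t -> exists a, Mg a y) /\
    forall V, is_Bsubmodule V -> (forall y, y \in t -> V y) -> forall y, y \in s -> V y.
  elim: (s) => [|y s' [t [tM tV]]]; first by exists [::].
  have [u [uu Mu _ yE]] := gcompP dM y.
  exists ([seq gcomp Mg i y | i <- u] ++ t); split.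
    move=> z; rewrite mem_cat => /orP[/mapP[i _ ->]|/tM//].
    by exists i; exact: Mu.
  move=> V sV Vt z; rewrite inE => /predU1P[->|zs]; last first.
    by apply: tV zs => // w wt; apply: Vt; rewrite mem_cat wt orbT.
  rewrite yE big_seq; elim/big_rec: _ => [|i x iu Vx]; first exact: Bsub0.
  by apply: BsubD => //; apply: Vt; rewrite mem_cat; apply/orP; left; exact: map_f.
have [V [L [fL Vt]]] := pfilt_seq sU gU tM.
have [sV _ _] := pfilt_sub sU gU fL.
exists L; suff <- : V = setT by [].
apply/seteqP; split=> // z _; have [c ->] := sP z.
elim/big_rec: _ => [|i x _ Vx]; first exact: Bsub0.
apply: BsubD => //; apply: BsubZ => //; apply: (tV V) => //; exact: mem_nth.
Qed.

End Filtrations.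

End GradedPrimes.

Section GradedLength.
Variables (A : comNzRingType) (m : set A).
Hypothesis (mU : forall a, ~ m a -> exists b, a * b = 1).
Variables (B : comAlgType A) (r : nat) (Bz : grade r -> set B).
Hypothesis gB : graded_alg Bz.
Let dB := galg_dsum gB.

Lemma graded_piece_Asub (M : lmodType B) (Mg : grade r -> set M) nu :
  graded_mod Bz Mg -> is_Asubmodule (Mg nu).
Proof.
move=> gM; have dM := gmod_dsum gM; split; first exact: (dsum0 dM).
move=> a x y Mx My; apply: (dsumD dM) => //.
by rewrite -[nu]add0r; apply: (gmod_act gM) => //; exact: galg_in.
Qed.

(* The length of (B/P)_nu; 0 if that length is infinite. *)
Definition Hf (P : set B) (nu : grade r) : nat :=
  xget 0%N [set n | rlen m (P `&` Bz nu : set B^o) (Bz nu) n].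

Definition has_length (P : set B) : Prop :=
  forall nu, exists n, rlen m (P `&` Bz nu : set B^o) (Bz nu) n.

Lemma HfP P nu : has_length P -> rlen m (P `&` Bz nu : set B^o) (Bz nu) (Hf P nu).
Proof.
by move=> /(_ nu)[n rn]; rewrite /Hf; case: xgetP => [k _ //|/(_ n)].
Qed.

Let gR := graded_mod_regular gB.

Lemma ideal_Asub (P : set B) : is_ideal P -> is_Asubmodule (P : set B^o).
Proof. by move=> iP; apply: Bsub_Asub. Qed.

Lemma ideal_piece_Asub (P : set B) nu : is_ideal P -> is_Asubmodule (P `&` Bz nu : set B^o).
Proof.
move=> iP; apply: AsubI; first exact: ideal_Asub.
exact: (graded_piece_Asub nu gR).
Qed.

Lemma HfE P nu n : is_ideal P -> rlen m (P `&` Bz nu : set B^o) (Bz nu) n -> Hf P nu = n.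
Proof.
move=> iP rn; rewrite /Hf; case: xgetP => [k _ /= rk|/(_ n)//].
exact: (rlen_uniq mU (ideal_piece_Asub nu iP) rk rn).
Qed.

Section OneModule.
Variables (M : lmodType B) (Mg : grade r -> set M).
Hypothesis gM : graded_mod Bz Mg.
Let dM := gmod_dsum gM.
Implicit Types (U V : set M) (nu : grade r).

(** Multiplication by [y] identifies B/(V : y), shifted by [a], with (V + By)/V; homogeneity allows
    passing to a single degree. *)
Lemma rlen_Badj V y a nu n : is_Bsubmodule V -> gclosed Mg V -> Mg a y ->
  rlen m (colon V y `&` Bz (nu - a) : set B^o) (Bz (nu - a)) n ->
  rlen m (V `&` Mg nu) (Badj V y `&` Mg nu) n.
Proof.
move=> sV gV My rn.
have sVnu : is_Asubmodule (V `&` Mg nu).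
  by apply: AsubI; [exact: Bsub_Asub|exact: graded_piece_Asub].
have act b : Bz (nu - a) b -> Mg nu (b *: y).
  by move=> Bb; rewrite -[nu](subrK a); exact: (gmod_act gM).
have lin (c : A) (x z : B^o) :
    ((c%:A : B) *: x + z) *: y = (c%:A : B) *: ((x : B) *: y) + (z : B) *: y.
  by rewrite scalerDl scalerA.
have := rlen_map (f := fun b : B^o => (b : B) *: y) lin
  (ideal_piece_Asub (nu - a) (colon_ideal y sV)) sVnu rn.
set X := [set z' | _]; have -> : X = Badj V y `&` Mg nu; last first.
  apply=> b Bb; split=> [[Vb _]|[Vb _]]; split=> //; exact: act.
apply/seteqP; split=> z.
  case=> b Bb [Vz Mz]; split; first by exists b.
  by rewrite -(subrK (b *: y) z); apply: (dsumD dM) => //; exact: act.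
case=> -[b Vz] Mz; exists (gcomp Bz (nu - a) b); first exact: (gcomp_in dB).
rewrite -(gcompZl gB gM nu b My) -{1}(gcomp_id dM Mz) -(gcompB dM).
by split; [exact: gV|exact: gcomp_in].
Qed.

Lemma pfilt_rlen U V L nu : is_Bsubmodule U -> gclosed Mg U -> pfilt Bz Mg U V L ->
  (forall p, List.In p L -> has_length p.1) ->
  rlen m (U `&` Mg nu) (V `&` Mg nu) (\sum_(p <- L) Hf p.1 (nu - p.2)%R).
Proof.
move=> sU gU; elim=> [|V' L' y a fL IH My pV] hL.
  by rewrite big_nil; exact: rlen_nil.
have [sV gV UV] := pfilt_sub gB gM sU gU fL.
rewrite big_cons addnC; apply: rlen_cat.
  by apply: IH => p pL; apply: hL; right.
apply: (rlen_Badj sV gV My); apply: HfP.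
by apply: (hL (colon V' y, a)); left.
Qed.

End OneModule.

Definition supported (s : seq (grade r)) : set B :=
  [set b | forall nu, nu \notin s -> gcomp Bz nu b = 0].

Lemma supported_Asub s : is_Asubmodule (supported s : set B^o).
Proof.
split; first by move=> nu _; exact: gcomp0.
move=> a x y sx sy nu ns; rewrite (gcompD dB) sy // addr0.
rewrite (gcompZr gR nu (x : B^o) (galg_in gB a)) subr0.
by have := sx nu ns; rewrite /gcomp => ->; rewrite scaler0.
Qed.

(** This is the length of a finite direct sum of graded pieces of B/P. A new degree is added in two
    steps, below and above [W], each an instance of the second isomorphism theorem. *)
Lemma rlen_supported P s : is_ideal P -> gclosed Bz P -> has_length P -> uniq s ->
  rlen m (P `&` supported s : set B^o) (supported s) (\sum_(nu <- s) Hf P nu).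
Proof.
move=> iP gP hP; elim: s => [_|nu s IH /= /andP[ns us]].
  rewrite big_nil; have -> : P `&` supported [::] = supported [::]; last exact: rlen_nil.
  apply/seteqP; split=> [b []//|b sb]; split=> //.
  have -> : b = 0; last exact: ideal0.
  have [t [_ _ _ ->]] := gcompP dB b.
  by rewrite big1 // => i _; apply: sb.
have sP : is_Asubmodule (P : set B^o) by exact: ideal_Asub.
have sPs t : is_Asubmodule (P `&` supported t : set B^o).
  by apply: AsubI => //; exact: supported_Asub.
have ss : supported s `<=` supported (nu :: s).
  by move=> b sb mu; rewrite inE negb_or => /andP[_]; exact: sb.
have Bs : Bz nu `<=` supported (nu :: s).
  move=> b Bb mu; rewrite inE negb_or => /andP[mn _].
  by rewrite (gcomp_homog dB _ Bb) (negbTE mn).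
pose W : set B^o := sumset (P `&` supported (nu :: s) : set B^o) (supported s).
have sW : is_Asubmodule W by apply: sumset_Asub => //; exact: supported_Asub.
rewrite big_cons addnC; apply: (rlen_cat (V := W)).
  apply: rlen_diamond => //; first exact: supported_Asub.
  have -> // : (P `&` supported (nu :: s)) `&` supported s = P `&` supported s.
    apply/seteqP; split=> b; first by case=> [[Pb _] sb].
    by case=> Pb sb; split=> //; split=> //; exact: ss.
  exact: IH.
have -> : supported (nu :: s) = sumset W (Bz nu) :> set B^o.
  apply/seteqP; split; last first.
    apply: sumset_least => //; first exact: supported_Asub.
    by apply: sumset_least; [exact: supported_Asub|move=> b []|exact: ss].
  move=> b sb; exists (gcomp Bz nu b); first exact: (gcomp_in dB).
  apply: sumset_subr; first exact: Asub0.
  move=> mu ms; rewrite (gcompB dB) (gcomp_homog dB _ (gcomp_in dB nu b)).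
  by case: eqP => [->|/eqP mn]; rewrite ?subrr // subr0 sb // inE negb_or mn.
apply: rlen_diamond => //; first exact: (graded_piece_Asub nu gR).
have -> : W `&` Bz nu = P `&` Bz nu; last exact: HfP.
apply/seteqP; split=> b; case.
  case=> c sc [Pbc _] Bb; split=> //.
  have := gP nu _ Pbc; rewrite (gcompB dB) (gcomp_id dB Bb).
  by have := sc nu ns => ->; rewrite subr0.
move=> Pb Bb; split=> //; apply: sumset_subl; first exact: (Asub0 (supported_Asub s)).
by split=> //; exact: Bs.
Qed.

End GradedLength.

(** * Decompositions of Hilbert series *)

Section Decompositions.
Variable r : nat.
Implicit Types (nu a : grade r) (n : 'X_{1..r}) (F G : grade r -> int) (D : nat).

(** In generating series: (1-t)^-(l+1) = t (1-t)^-(l+1) + (1-t)^-l. *)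
Lemma pole_coefS (l : nat) (k : int) :
  pole_coef l.+1 k = (pole_coef l.+1 (k - 1) + pole_coef l k)%N.
Proof.
case: k => [[|j]|j].
- by rewrite /= !bin0.
- have -> : Posz j.+1 - 1 = j by rewrite -addn1 PoszD addrK.
  by rewrite /= addnS /= binS addnC.
- by have -> : Negz j - 1 = Negz j.+1 by lia.
Qed.

Lemma pole_coef0 (k : int) : pole_coef 0 k = (k == 0).
Proof. by case: k => [[|j]|j] //=; rewrite bin_small. Qed.

Definition pole n nu : int := (\prod_(i < r) pole_coef (n i) (nu i))%:Z.

Lemma pole_addU n i nu :
  pole (n + U_(i))%MM nu = pole (n + U_(i))%MM (nu - gradeN U_(i)) + pole n nu.
Proof.
rewrite /pole -PoszD; congr Posz.
rewrite (bigD1 i) //= [in RHS](bigD1 i) //= [X in (_ + X)%N](bigD1 i) //=.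
set X := (\prod_(_ < _ | _) _)%N; set Y := (\prod_(_ < _ | _) _)%N.
set Z := (\prod_(_ < _ | _) _)%N.
have XZ : X = Z.
  by apply: eq_bigr => j ji; rewrite mnmDE mnm1E eq_sym (negbTE ji) addn0.
have YZ : Y = Z.
  apply: eq_bigr => j ji.
  by rewrite mnmDE mnm1E eq_sym (negbTE ji) addn0 !ffunE mnm1E eq_sym (negbTE ji) subr0.
rewrite XZ YZ mnmDE mnm1E eqxx addn1 pole_coefS !ffunE mnm1E eqxx.
by rewrite mulnDl.
Qed.

Definition term := (int * grade r * 'X_{1..r})%type.

Definition terms_val (ts : seq term) nu : int :=
  \sum_(t <- ts) t.1.1 * pole t.2 (nu - t.1.2).

(** This is Q_n(1): the exponents of t disappear at t = 1. *)
Definition terms_mult (ts : seq term) n : int := \sum_(t <- ts | t.2 == n) t.1.1.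

(* [dec F D]: the generating series of F is a sum of
   Q_n(t) / (1-t)^n with |n| = D and Q_n(1) >= 0; the term (c, a, n) stands for
   c t^a / (1-t)^n. *)
Definition dec F D : Prop := exists ts : seq term,
  [/\ forall t, t \in ts -> mdeg t.2 = D, forall n, 0 <= terms_mult ts n &
      forall nu, F nu = terms_val ts nu].

Lemma dec0 D : dec (fun=> 0) D.
Proof.
by exists [::]; split=> // [n|nu]; rewrite /terms_mult /terms_val big_nil.
Qed.

Lemma dec_delta : dec (fun nu => (nu == 0)%:Z) 0.
Proof.
exists [:: (1, 0, 0%MM)]; split=> [t|n|nu].
- by rewrite inE => /eqP ->; rewrite mdeg0.
- by rewrite /terms_mult big_cons big_nil /=; case: ifP.
rewrite /terms_val big_seq1 mul1r subr0 /pole; congr Posz.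
under eq_bigr do rewrite mnm0E pole_coef0.
case: eqP => [->|nu0].
  by rewrite big1 // => i _; rewrite ffunE eqxx.
have [i nui] := grade_neq0 (introN eqP nu0).
by rewrite (bigD1 i) //= (negbTE nui).
Qed.

Lemma eq_dec F G D : F =1 G -> dec F D -> dec G D.
Proof. by move=> FG [ts [tD t0 tF]]; exists ts; split=> // nu; rewrite -FG. Qed.

Lemma decD F G D : dec F D -> dec G D -> dec (fun nu => F nu + G nu) D.
Proof.
move=> [ts [tD t0 tF]] [us [uD u0 uG]]; exists (ts ++ us); split=> [t|n|nu].
- by rewrite mem_cat => /orP[/tD|/uD].
- by rewrite /terms_mult big_cat addr_ge0 //; [exact: t0|exact: u0].
- by rewrite /terms_val big_cat tF uG.
Qed.

Lemma dec_shift F D a : dec F D -> dec (fun nu => F (nu - a)) D.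
Proof.
move=> [ts [tD t0 tF]]; exists [seq (t.1.1, t.1.2 + a, t.2) | t <- ts].
split=> [_ /mapP[t tt ->]|n|nu].
- exact: (tD t).
- by rewrite /terms_mult big_map; exact: t0.
- by rewrite tF /terms_val big_map; apply: eq_bigr => t _ /=; rewrite opprD addrA addrAC.
Qed.

Lemma dec_sum (T : Type) (L : seq T) (F : T -> grade r -> int) D :
  (forall p, List.In p L -> dec (F p) D) -> dec (fun nu => \sum_(p <- L) F p nu) D.
Proof.
elim: L => [_|p L IH hL].
  by apply: eq_dec (dec0 D) => nu; rewrite big_nil.
apply: (@eq_dec (fun nu => F p nu + \sum_(q <- L) F q nu)).
  by move=> nu; rewrite big_cons.
by apply: decD; [apply: hL; left|apply: IH => q qL; apply: hL; right].
Qed.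

(** The series is multiplied by (1 - t_i)/(1 - t_i); every new numerator takes the value 0 at 1. *)
Lemma dec_raise1 (i : 'I_r) F D : dec F D -> dec F D.+1.
Proof.
move=> [ts [tD t0 tF]].
exists ([seq (t.1.1, t.1.2, t.2 + U_(i))%MM | t <- ts] ++
        [seq (- t.1.1, (t.1.2 + gradeN U_(i))%R, t.2 + U_(i))%MM | t <- ts]); split=> [t|n|nu].
- by rewrite mem_cat => /orP[] /mapP[u /tD uD ->] /=; rewrite mdegD mdeg1 uD addn1.
- by rewrite /terms_mult big_cat !big_map /= sumrN subrr.
rewrite tF /terms_val big_cat !big_map /= -big_split; apply: eq_bigr => t _ /=.
by rewrite (pole_addU t.2 i (nu - t.1.2)) opprD addrA; ring.
Qed.

Lemma dec_raise (i : 'I_r) F D E : (D <= E)%N -> dec F D -> dec F E.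
Proof.
move=> /subnK <-; elim: (E - D)%N => // k IH dF.
by rewrite addSn; apply: (dec_raise1 i); exact: IH.
Qed.

Lemma terms_val_far (ts : seq term) (i : 'I_r) : exists k0 : int,
  forall nu, nu i < k0 -> terms_val ts nu = 0.
Proof.
elim: ts => [|t ts [k0 IH]]; first by exists 0 => nu _; rewrite /terms_val big_nil.
exists (Num.min k0 (t.1.2 i)) => nu; rewrite lt_min => /andP[nk nt].
rewrite /terms_val big_cons [X in _ + X]IH // addr0 /pole (bigD1 i) //= !ffunE.
have : nu i - t.1.2 i < 0 by rewrite subr_lt0.
by case: (nu i - _) => // j _; rewrite mul0n mulr0.
Qed.

(** The recursion says that (1 - t_i) F = G as series. Dividing each term of [G] by 1 - t_i gives a
    solution, and it is [F] because both vanish when nu_i is very negative. *)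
Lemma dec_integrate (i : 'I_r) F G D :
  (forall nu, nu i < 0 -> F nu = 0) ->
  (forall nu, F nu = F (nu - gradeN U_(i)) + G nu) -> dec G D -> dec F D.+1.
Proof.
move=> F0 FG [ts [tD t0 tG]].
pose us : seq term := [seq (t.1.1, t.1.2, t.2 + U_(i))%MM | t <- ts].
have usG nu : terms_val us nu = terms_val us (nu - gradeN U_(i)) + G nu.
  rewrite tG /terms_val !big_map -big_split; apply: eq_bigr => t _ /=.
  by rewrite (pole_addU t.2 i) mulrDr addrAC.
have [k0 k0P] := terms_val_far us i.
(* Induction on the number of steps separating nu_i from a region where both sides vanish. *)
have eqF : forall (j : nat) nu, nu i - j%:Z < Num.min k0 0 -> F nu = terms_val us nu.
  elim=> [|j IH] nu nuj.
    by move: nuj; rewrite subr0 lt_min => /andP[? ?]; rewrite F0 // k0P.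
  rewrite FG usG IH // !ffunE mnm1E eqxx.
  by move: nuj; rewrite -addn1 PoszD opprD addrA addrAC.
exists us; split=> [_ /mapP[u /tD uD ->]|n|nu].
- by rewrite /= mdegD mdeg1 uD addn1.
- rewrite /terms_mult big_map /=.
  have [ni|ni] := posnP (n i).
    rewrite big1 // => t /eqP e; have := congr1 (fun n : 'X_{1..r} => n i) e.
    by rewrite /= mnmDE mnm1E eqxx ni addn1.
  have nE : n = (n - U_(i) + U_(i))%MM.
    by rewrite submK // lep1mP -lt0n.
  rewrite (eq_bigl (fun t => t.2 == (n - U_(i))%MM)); first exact: t0.
  by move=> t; rewrite {1}nE eqm_add2r.
apply: (eqF `|(nu i - Num.min k0 0 + 1)%R|%N).
by move: (Num.min k0 0) => x; lia.
Qed.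

Definition box (N : nat) : seq (grade r) :=
  [seq [ffun i => (f i : nat)%:Z] | f : {ffun 'I_r -> 'I_N.+1}].

Lemma box_uniq N : uniq (box N).
Proof.
rewrite map_inj_uniq ?enum_uniq // => f g fg; apply/ffunP => i.
by have /ffunP/(_ i) := fg; rewrite !ffunE => -[] /val_inj.
Qed.

Lemma mem_box N nu : (nu \in box N) = [forall i, 0 <= nu i <= N%:Z].
Proof.
apply/mapP/forallP => [[f _ ->] i|nuN].
  by rewrite ffunE /= lez_nat -ltnS ltn_ord.
exists [ffun i => inord `|nu i|]; first exact: mem_enum.
apply/ffunP => i; rewrite !ffunE; have /andP[nu0 nN] := nuN i.
by rewrite inordK ?gez0_abs // ltnS -lez_nat gez0_abs.
Qed.

Lemma size_box N : size (box N) = (N.+1 ^ r)%N.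
Proof. by rewrite size_map -cardE card_ffun !card_ord. Qed.

Lemma ffact_leq (k l : nat) : (k ^_ l <= k ^ l)%N.
Proof.
elim: l => [|l IH]; first by rewrite ffactn0 expn0.
by rewrite ffactnSr expnSr leq_mul // leq_subr.
Qed.

(** Partial sums of the coefficients of (1-t)^-n are coefficients of (1-t)^-(n+1), which are of
    order N^n. The sum starts at k = 0 and may omit earlier coefficients, hence an inequality. *)
Lemma pole_coef_sum (n : nat) (a : int) N :
  (\sum_(k < N.+1) pole_coef n (k%:Z - a) <= ((n + `|a|%N).+1 * N.+1) ^ n)%N.
Proof.
have le_pole j : (pole_coef n.+1 (j%:Z - a) <= ((n + `|a|%N).+1 * j.+1) ^ n)%N.
  case kE: (j%:Z - a) => [k|k] //=.
  rewrite -bin_sub ?leq_addl // addnK.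
  apply: (@leq_trans ((n + k) ^ n)).
    rewrite -(@leq_pmul2r n`!) ?fact_gt0 // bin_ffact.
    apply: (@leq_trans ((n + k) ^ n)); last by rewrite leq_pmulr ?fact_gt0.
    exact: ffact_leq.
  have nk : (n + k <= (n + `|a|).+1 * j.+1)%N.
    have : (n + k <= n + `|a| + j)%N by lia.
    by nia.
  by case: (n) nk => // e nk; rewrite leq_exp2r.
apply: leq_trans (le_pole N).
elim: N => [|N IH]; first by rewrite big_ord1 [X in (_ <= X)%N]pole_coefS leq_addl.
rewrite big_ord_recr [X in (_ <= X)%N]pole_coefS leq_add2r.
by have -> : Posz N.+1 - a - 1 = N%:Z - a by lia.
Qed.

Lemma pole_box_sum n a N :
  (\sum_(nu <- box N) pole n (nu - a) <=
    (\prod_(i < r) (n i + `|a i|%N).+1 ^ n i * N.+1 ^ mdeg n)%N%:Z)%R.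
Proof.
rewrite /box big_map big_enum /=.
have -> : \sum_(f : {ffun 'I_r -> 'I_N.+1}) pole n ([ffun i => (f i : nat)%:Z] - a) =
    (\sum_(f : {ffun 'I_r -> 'I_N.+1}) \prod_(i < r) pole_coef (n i) ((f i : nat)%:Z - a i))%N%:Z.
  rewrite -[RHS]/((_ : nat)%:Z) -natz natr_sum; apply: eq_bigr => f _.
  by rewrite /pole natz; congr Posz; apply: eq_bigr => i _; rewrite !ffunE.
rewrite -(bigA_distr_bigA (fun i (k : 'I_N.+1) => pole_coef (n i) ((k : nat)%:Z - a i))) /=.
rewrite lez_nat mdegE expn_sum -big_split /=; apply: leq_prod => i _.
by rewrite -expnMn; exact: pole_coef_sum.
Qed.

(** The terms have coefficients of unknown sign and are bounded in absolute value one by one; each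
    contributes at most a multiple of (N+1)^D. *)
Lemma dec_box_sum F D : dec F D -> exists K : nat, forall N,
  \sum_(nu <- box N) F nu <= (K * N.+1 ^ D)%N%:Z.
Proof.
move=> [ts [tD _ tF]].
have {tF} -> : F = terms_val ts by apply/funext.
elim: ts tD => [|t ts IH] tD.
  by exists 0%N => N; rewrite big1 // => nu _; rewrite /terms_val big_nil.
have [K KP] : exists K : nat, forall N,
    \sum_(nu <- box N) terms_val ts nu <= (K * N.+1 ^ D)%N%:Z.
  by apply: IH => u us; apply: tD; rewrite inE us orbT.
exists (`|t.1.1|%N * \prod_(i < r) (t.2 i + `|t.1.2 i|%N).+1 ^ t.2 i + K)%N => N.
under eq_bigr do rewrite /terms_val big_cons -/(terms_val ts _).
rewrite big_split mulnDl PoszD; apply: lerD => //.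
rewrite -mulr_sumr -mulnA PoszM -(tD t (mem_head _ _)).
have S0 : 0 <= \sum_(nu <- box N) pole t.2 (nu - t.1.2) by apply: sumr_ge0.
apply: le_trans (ler_wpM2r S0 (ler_norm _)) _.
by rewrite -abszE; apply: ler_wpM2l => //; exact: pole_box_sum.
Qed.

End Decompositions.

(** * Hilbert polynomials *)

Section ForLarge.
Variable r : nat.
Implicit Types (P Q : set (grade r)).

Lemma for_largeI P Q : for_large P -> for_large Q -> for_large (P `&` Q).
Proof.
move=> [p Pp] [q Qq]; exists [ffun i => Num.max (p i) (q i)] => nu nuP.
by split; [apply: Pp|apply: Qq] => i; have := nuP i; rewrite ffunE ge_max => /andP[].
Qed.

Lemma for_largeS P Q : P `<=` Q -> for_large P -> for_large Q.
Proof. by move=> PQ [p Pp]; exists p => nu /Pp /PQ. Qed.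

Lemma for_large_ge (a : grade r) : for_large [set nu | forall i, a i <= nu i].
Proof. by exists a. Qed.

Lemma for_large_all (T : Type) (L : seq T) (P : T -> set (grade r)) :
  (forall p, List.In p L -> for_large (P p)) ->
  for_large [set nu | forall p, List.In p L -> P p nu].
Proof.
elim: L => [_|p L IH hL]; first by exists 0 => nu _ p [].
have h1 : for_large (P p) by apply: hL; left.
have h2 : for_large [set nu | forall q, List.In q L -> P q nu].
  by apply: IH => q qL; apply: hL; right.
by apply: for_largeS (for_largeI h1 h2) => nu [Pp PL] q [<-|/PL].
Qed.

Lemma for_large_diag P : for_large P -> exists N0 : nat, forall N : nat, (N0 <= N)%N ->
  forall nu : grade r, (forall i, N%:Z <= nu i) -> P nu.
Proof.
move=> [p Pp]; exists (\sum_(i < r) `|p i|)%N => N NP nu nuN; apply: Pp => i.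
apply: le_trans (nuN i); have : (`|p i| <= N)%N; last by lia.
by apply: leq_trans NP; rewrite (bigD1 i) //= leq_addr.
Qed.

End ForLarge.

Section Polynomials.
Variable r : nat.
Implicit Types (P Q : {mpoly rat[r]}) (n k : 'X_{1..r}) (a nu : grade r).

(** As [msize] is the degree plus one, the remainder has degree less than |n|: c X^n is the only
    term of degree |n| or more. *)
Definition leading P n (c : rat) : Prop := (msize (P - c *: 'X_[n]) <= mdeg n)%N.

Lemma msize_coef_le P d : (forall k, (d <= mdeg k)%N -> P@_k = 0) -> (msize P <= d)%N.
Proof.
move=> P0; rewrite leqNgt; apply/negP; rewrite msizeE => lt.
have : exists2 k, k \in msupp P & (d <= mdeg k)%N.
  apply: contrapT => nex; move: lt; rewrite ltnNge => /negP; apply.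
  apply/bigmax_leqP_seq => k kP _; rewrite ltnNge; apply/negP => dk.
  by apply: nex; exists k.
by case=> k; rewrite mcoeff_msupp => /eqP nk /P0.
Qed.

Lemma leading_coef P n c k : leading P n c -> (mdeg n <= mdeg k)%N -> P@_k = c * (k == n)%:R.
Proof.
move=> lP nk; have /msize_mdeg_ge : (msize (P - c *: 'X_[n]) <= mdeg k)%N by exact: leq_trans nk.
rewrite mcoeff_msupp negbK mcoeffB mcoeffZ mcoeffX subr_eq0 => /eqP ->.
by rewrite eq_sym.
Qed.

Lemma msizeM_low P Q d e : (msize P <= d)%N -> (msize Q <= e.+1)%N -> (msize (P * Q) <= d + e)%N.
Proof.
move=> Pd Qe; have [->|P0] := eqVneq P 0; first by rewrite mul0r msize0.
have [->|Q0] := eqVneq Q 0; first by rewrite mulr0 msize0.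
by rewrite msizeM // -subn1 leq_subLR add1n -addnS; exact: leq_add.
Qed.

Lemma msizeD_low P Q d : (msize P <= d)%N -> (msize Q <= d)%N -> (msize (P + Q) <= d)%N.
Proof. by move=> Pd Qd; rewrite (leq_trans (msizeD_le _ _)) // geq_max Pd. Qed.

Lemma msizeZ_low P c d : (msize P <= d)%N -> (msize (c *: P) <= d)%N.
Proof. by move=> Pd; rewrite (leq_trans (msizeZ_le _ _)). Qed.

Lemma leadingM P Q n k c e : leading P n c -> leading Q k e -> leading (P * Q) (n + k)%MM (c * e).
Proof.
rewrite /leading mdegD => lP lQ.
have -> : P * Q - (c * e) *: 'X_[n + k] =
    (P - c *: 'X_[n]) * Q + c *: (Q - e *: 'X_[k]) * 'X_[n].
  rewrite mpolyXD -!mul_mpolyC mpolyCM; ring.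
have Qk : (msize Q <= (mdeg k).+1)%N.
  rewrite -[Q](subrK (e *: 'X_[k])); apply: msizeD_low; first exact: leqW.
  by apply: msizeZ_low; rewrite msizeX.
apply: msizeD_low; first exact: msizeM_low.
rewrite addnC; apply: msizeM_low; last by rewrite msizeX.
exact: msizeZ_low.
Qed.

Lemma leading_const (c : rat) : leading c%:MP 0%MM c.
Proof. by rewrite /leading mpolyX0 -mul_mpolyC mulr1 subrr msize0. Qed.

Lemma leadingXD i (c : rat) : leading ('X_i + c%:MP) U_(i)%MM 1.
Proof.
rewrite /leading scale1r addrAC subrr add0r mdeg1.
by rewrite msizeC; case: eqP.
Qed.

Lemma leading_prod (I : Type) (s : seq I) (F : I -> {mpoly rat[r]})
    (N : I -> 'X_{1..r}) (C : I -> rat) :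
  (forall i, leading (F i) (N i) (C i)) ->
  leading (\prod_(i <- s) F i) (\sum_(i <- s) N i)%MM (\prod_(i <- s) C i).
Proof.
move=> lF; elim: s => [|i s IH]; last by rewrite !big_cons; exact: leadingM.
by rewrite !big_nil -mpolyC1; exact: leading_const.
Qed.

(* prod_i binom(X_i - a_i + n_i, n_i) *)
Definition shifted_binom n a : {mpoly rat[r]} :=
  \prod_(i < r) (((n i)`!)%:R^-1 *: \prod_(j < n i) ('X_i + (j.+1%:R - (a i)%:~R)%:MP)).

Lemma binom_mpolyE n : binom_mpoly n = shifted_binom n 0.
Proof.
apply: eq_bigr => i _; congr (_ *: _); apply: eq_bigr => j _.
by rewrite ffunE subr0 -mpolyC_nat.
Qed.

Lemma shifted_binom_leading n a :
  leading (shifted_binom n a) n (\prod_(i < r) (n i)`!%:R)^-1.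
Proof.
have lF i : leading ((((n i)`!)%:R^-1 : rat) *: \prod_(j < n i) ('X_i + (j.+1%:R - (a i)%:~R)%:MP))
    (U_(i) *+ n i)%MM (((n i)`!)%:R^-1).
  rewrite -mul_mpolyC -[X in leading _ _ X]mulr1 -[X in leading _ X _]add0m.
  apply: leadingM; first exact: leading_const.
  have := @leading_prod _ (index_enum 'I_(n i)) _ (fun=> U_(i)%MM) (fun=> 1)
    (fun j : 'I_(n i) => leadingXD i (j.+1%:R - (a i)%:~R)).
  rewrite [X in leading _ _ X]big1 // => h.
  suff <- : (\sum_(j <- index_enum 'I_(n i)) U_(i))%MM = (U_(i) *+ n i)%MM by exact: h.
  by apply/mnmP => l; rewrite mnm_sumE sum_nat_const card_ord mulmnE mulnC.
have := leading_prod (index_enum 'I_r) lF.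
by rewrite -multinomUE_id prodfV.
Qed.

Lemma binR_prod (n k : nat) : ('C(n + k, k))%:R = n`!%:R^-1 * \prod_(j < n) (k%:R + j.+1%:R) :> rat.
Proof.
have f0 l : (l`!)%:R != 0 :> rat by rewrite pnatr_eq0 -lt0n fact_gt0.
have e : (n + k)`!%:R = k`!%:R * \prod_(j < n) (k%:R + j.+1%:R) :> rat.
  elim: n => [|n IH]; first by rewrite big_ord0 mulr1.
  by rewrite big_ord_recr /= mulrA -IH addSn factS natrM mulrC -natrD addnS [(k + n)%N]addnC.
apply: (mulIf (f0 k)); apply: (mulIf (f0 n)).
have b := bin_fact (leq_addl n k); rewrite addnK in b.
rewrite -mulrA -!natrM b e.
by field; exact: f0.
Qed.

(** binom(k + n, n) is the coefficient of t^k in (1-t)^-(n+1), whence the successor. For negative k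
    that coefficient is 0 while the polynomial need not vanish. *)
Lemma shifted_binom_eval n a nu : (forall i, a i <= nu i) ->
  (shifted_binom n a).@[fun i => (nu i)%:~R] =
  (\prod_(i < r) pole_coef (n i).+1 (nu i - a i))%:R.
Proof.
move=> anu; rewrite /shifted_binom rmorph_prod natr_prod; apply: eq_bigr => i _.
rewrite /= mevalZ rmorph_prod /=.
have : 0 <= nu i - a i by rewrite subr_ge0.
case kE : (nu i - a i) => [k|//] _; rewrite /= binR_prod; congr (_ * _).
apply: eq_bigr => j _; rewrite mevalD mevalXU mevalC.
have -> : k%:R = (nu i)%:~R - (a i)%:~R :> rat by rewrite pmulrn -rmorphB /= kE.
by ring.
Qed.

(** A zero entry n_i makes the coefficients vanish as soon as nu_i > a_i. Otherwise each exponent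
    drops by one, from pole order to degree. *)
Definition term_poly (t : term r) : {mpoly rat[r]} :=
  if [forall i, 0 < t.2 i]%N then
    (t.1.1)%:~R *: shifted_binom [multinom (t.2 i).-1 | i < r] t.1.2
  else 0.

Lemma term_poly_eval (t : term r) nu : (forall i, t.1.2 i + 1 <= nu i) ->
  (term_poly t).@[fun i => (nu i)%:~R] = (t.1.1 * pole t.2 (nu - t.1.2))%:~R.
Proof.
move=> tnu; rewrite /term_poly; case: ifPn => [/forallP n0|].
  rewrite mevalZ rmorphM /=; congr (_ * _).
  rewrite shifted_binom_eval; last by move=> i; have := tnu i; lia.
  rewrite /pole -pmulrn; congr (_%:R); apply: eq_bigr => i _.
  by rewrite mnmE prednK // !ffunE.
rewrite negb_forall => /existsP[i]; rewrite -leqNgt leqn0 => /eqP ni.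
rewrite meval0 /pole (bigD1 i) //= ni pole_coef0 !ffunE.
have -> : (nu i - t.1.2 i == 0) = false by apply/eqP; have := tnu i; lia.
by rewrite mul0n mulr0.
Qed.

Lemma term_poly_coef (t : term r) k : (mdeg t.2 <= mdeg k + r)%N ->
  (term_poly t)@_k =
    (t.1.1)%:~R * (t.2 == (k + [multinom 1 | _ < r])%MM)%:R / (\prod_(i < r) (k i)`!)%:R.
Proof.
move=> tk; rewrite /term_poly; case: ifPn => [/forallP n0|].
  set n' := [multinom _ | _ < _].
  have n'E : t.2 = (n' + [multinom 1 | _ < r])%MM.
    by apply/mnmP => i; rewrite mnmDE !mnmE addn1 prednK.
  have n'k : (mdeg n' <= mdeg k)%N.
    by move: tk; rewrite n'E mdegD mdeg_ones leq_add2r.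
  rewrite mcoeffZ (leading_coef (shifted_binom_leading n' _) n'k) n'E eqm_add2r eq_sym.
  rewrite natr_prod -mulrA; congr (_ * _).
  by case: eqP => [->|_]; rewrite ?mulr0 ?mul0r // mulr1 mul1r.
rewrite negb_forall => /existsP[i]; rewrite -leqNgt leqn0 => /eqP ni.
rewrite mcoeff0; case: eqP => [e|_]; last by rewrite mulr0 mul0r.
by have := congr1 (fun n : 'X_{1..r} => n i) e; rewrite /= ni mnmDE mnmE addn1.
Qed.

Definition agrees (F : grade r -> int) P : Prop :=
  for_large [set nu | (F nu)%:~R = P.@[fun i => (nu i)%:~R]].

(** The range D <= |k| + r covers the top degree D - r and all higher ones. In the latter the
    formula gives 0, since no term has pole order |k| + r. *)
Lemma terms_poly (ts : seq (term r)) D : (forall t, t \in ts -> mdeg t.2 = D) ->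
  exists P, agrees (terms_val ts) P /\ forall k, (D <= mdeg k + r)%N ->
    P@_k = (terms_mult ts (k + [multinom 1 | _ < r])%MM)%:~R / (\prod_(i < r) (k i)`!)%:R.
Proof.
elim: ts => [_|t ts IH tD].
  exists 0; split=> [|k _]; last by rewrite /terms_mult big_nil mcoeff0 mul0r.
  by exists 0 => nu _; rewrite /= /terms_val big_nil meval0.
have [P [aP cP]] : exists P, agrees (terms_val ts) P /\ forall k, (D <= mdeg k + r)%N ->
    P@_k = (terms_mult ts (k + [multinom 1 | _ < r])%MM)%:~R / (\prod_(i < r) (k i)`!)%:R.
  by apply: IH => u us; apply: tD; rewrite inE us orbT.
exists (term_poly t + P); split=> [|k Dk].
  apply: for_largeS (for_largeI (for_large_ge (t.1.2 + [ffun=> 1])) aP) => nu [tnu e] /=.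
  rewrite /terms_val big_cons rmorphD /= e mevalD term_poly_eval // => i.
  by have := tnu i; rewrite !ffunE.
rewrite mcoeffD cP // term_poly_coef ?(tD t (mem_head _ _)) //.
rewrite /terms_mult big_cons; case: eqP => _; last by rewrite mulr0 mul0r add0r.
by rewrite mulr1 rmorphD /= mulrDl.
Qed.

Lemma digits_inj (K n : nat) (a b : 'I_n -> nat) :
  (forall i, a i < K)%N -> (forall i, b i < K)%N ->
  (\sum_(i < n) a i * K ^ i = \sum_(i < n) b i * K ^ i)%N -> forall i, a i = b i.
Proof.
elim: n a b => [|n IH] a b aK bK; first by move=> _ [].
have K0 : (0 < K)%N by apply: leq_ltn_trans (aK ord0).
have e c : (\sum_(i < n.+1) c i * K ^ i =
    (\sum_(i < n) c (lift ord0 i) * K ^ i) * K + c ord0)%N.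
  rewrite big_ord_recl expn0 muln1 addnC; congr (_ + _)%N.
  by rewrite big_distrl; apply: eq_bigr => i _; rewrite /= expnSr mulnA.
rewrite !e => ab.
have ab0 : a ord0 = b ord0.
  by have := congr1 (modn^~ K) ab; rewrite !modnMDl !modn_small.
have abS := IH (fun i => a (lift ord0 i)) (fun i => b (lift ord0 i)).
have abS' := abS (fun i => aK _) (fun i => bK _).
move=> i; case: (unliftP ord0 i) => [j ->|-> //]; apply: abS'.
by apply/eqP; rewrite -(eqn_pmul2r K0) -(eqn_add2r (b ord0)) -{1}ab0 ab.
Qed.

(* Kronecker's substitution X_i := N^(K^i), injective on the monomials of P. *)
Lemma mpoly_large0 P : for_large [set nu | P.@[fun i => (nu i)%:~R] = 0] -> P = 0.
Proof.
move=> /for_large_diag[N0 N0P]; pose K := msize P.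
have [K0|K0] := posnP K; first by apply/eqP; rewrite -msize_poly_eq0 -/K K0.
pose kd k := (\sum_(i < r) k i * K ^ i)%N.
pose q : {poly rat} := \sum_(k <- msupp P) P@_k *: 'X^(kd k).
have qE (N : nat) : q.[N%:R] = P.@[fun i => N%:R ^+ (K ^ i)].
  rewrite /q horner_sum mevalE; apply: eq_bigr => k _; rewrite hornerZ hornerXn; congr (_ * _).
  by rewrite /kd -prodrXr; apply: eq_bigr => i _; rewrite mulnC exprM.
(* For N > N0 every coordinate N^(K^i) is at least N, so the substituted point lies where [P]
   vanishes. *)
have q0 N : (N0 < N)%N -> q.[N%:R] = 0.
  move=> N0N; rewrite qE -[RHS](N0P N (ltnW N0N) [ffun i : 'I_r => (N ^ (K ^ i))%N%:Z]).
    by apply: meval_eq => i; rewrite ffunE -pmulrn natrX.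
  move=> i; rewrite ffunE lez_nat -[X in (X <= _)%N]expn1.
  by rewrite leq_pexp2l ?expn_gt0 ?K0 // (leq_ltn_trans _ N0N).
have qz : q = 0.
  apply/eqP; apply: contraT => qn0.
  pose s := [seq (N0.+1 + j)%:R : rat | j <- iota 0 (size q)].
  have : (size s < size q)%N.
    apply: max_poly_roots qn0 _ _.
      by apply/allP => _ /mapP[j _ ->]; apply/rootP; rewrite q0 // addSn ltnS leq_addr.
    rewrite map_inj_uniq ?iota_uniq // => i j /eqP.
    by rewrite eqr_nat eqn_add2l => /eqP.
  by rewrite size_map size_iota ltnn.
apply/mpolyP => k; rewrite mcoeff0; apply/eqP; apply: contraT => kP.
have kin : k \in msupp P by rewrite mcoeff_msupp.
have := congr1 (fun q : {poly rat} => q`_(kd k)) qz.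
rewrite /= coef0 /q coef_sum (bigD1_seq k) ?msupp_uniq //=.
rewrite coefZ coefXn eqxx mulr1 big_seq_cond big1.
  by rewrite addr0 => e; rewrite e eqxx in kP.
move=> l /andP[lP lk]; rewrite coefZ coefXn; case: eqP => [e|_]; last by rewrite mulr0.
case/negP: lk; apply/eqP/esym/mnmP; apply: (@digits_inj K) => // i.
  by apply: leq_ltn_trans (msize_mdeg_lt kin); rewrite mdegE (bigD1 i) //= leq_addr.
by apply: leq_ltn_trans (msize_mdeg_lt lP); rewrite mdegE (bigD1 i) //= leq_addr.
Qed.

Lemma agrees_uniq F P Q : agrees F P -> agrees F Q -> P = Q.
Proof.
move=> aP aQ; apply/eqP; rewrite -subr_eq0; apply/eqP/mpoly_large0.
by apply: for_largeS (for_largeI aP aQ) => nu [/= eP eQ]; rewrite mevalB -eP -eQ subrr.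
Qed.

(** In terms of degrees the bound on |P| is of order N^(t-1); the extra factor N keeps the case t =
    0, where P = 0, uniform. *)
Lemma mpoly_bound P t : (msize P <= t)%N -> exists2 C : rat, 0 <= C &
  forall (N : nat) nu, (0 < N)%N -> (forall i, 0 <= nu i <= N%:Z) ->
    N%:R * `|P.@[fun i => (nu i)%:~R]| <= C * N%:R ^+ t.
Proof.
move=> Pt; exists (\sum_(k <- msupp P) `|P@_k|) => [|N nu N0 nuN]; first exact: sumr_ge0.
rewrite mevalE mulr_suml; apply: le_trans (ler_wpM2l (ler0n _ N) (ler_norm_sum _ _ _)) _.
rewrite mulr_sumr big_seq [X in _ <= X]big_seq; apply: ler_sum => k kP.
rewrite normrM mulrCA; apply: ler_wpM2l => //.
apply: (@le_trans _ _ (N%:R * N%:R ^+ mdeg k)).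
  apply: ler_wpM2l => //; rewrite normr_prod mdegE -prodrXr; apply: ler_prod => i _.
  rewrite normr_ge0 normrX; apply: lerXn2r; rewrite ?nnegrE //.
  have /andP[n0 nN] := nuN i; rewrite ger0_norm ?ler0z //.
  by rewrite pmulrn ler_int.
rewrite -exprS; apply: ler_weXn2l; first by rewrite ler1n.
by apply: leq_trans Pt; exact: msize_mdeg_lt.
Qed.

End Polynomials.

Section FiniteSupport.
Variables (R : nzRingType) (K : choiceType).
Local Open Scope fset_scope.

Definition collect (L : seq (R * K)) : {fsfun K -> R with 0} :=
  [fsfun k in [fset k in [seq t.2 | t <- L]] => (\sum_(t <- L | t.2 == k) t.1)%R | 0].

Lemma collectE L k : collect L k = \sum_(t <- L | t.2 == k) t.1.
Proof.
rewrite fsfunE in_fset /=; case: ifPn => // /mapP nk.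
rewrite big_seq_cond big1 // => t /andP[tL /eqP tk].
by case: nk; exists t.
Qed.

Lemma collect_sum (V : lmodType R) (g : K -> V) L :
  \sum_(k <- finsupp (collect L)) collect L k *: g k = \sum_(t <- L) t.1 *: g t.2.
Proof.
have sub : {subset finsupp (collect L) <= [fset k in [seq t.2 | t <- L]]}.
  move=> k; rewrite mem_finsupp collectE in_fset /=; apply: contraR => nk.
  rewrite big_seq_cond big1 // => t /andP[tL /eqP tk].
  by case/negP: nk; rewrite -tk map_f.
rewrite -(@sum_extend _ _ _ _ (fun k => collect L k *: g k) _ _ sub) ?fset_uniq //; last first.
  by move=> k; rewrite memNfinsupp => /eqP ->; rewrite scale0r.
under eq_bigr do rewrite collectE scaler_suml.
rewrite (exchange_big_dep predT) //= big_seq [RHS]big_seq; apply: eq_bigr => t tL.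
rewrite (eq_bigl (pred1 t.2)); last by move=> k; rewrite /= eq_sym.
rewrite -big_filter filter_pred1_uniq ?fset_uniq ?big_seq1 //.
by rewrite in_fset /=; exact: map_f.
Qed.

End FiniteSupport.

(** * Expansions in products of binomial polynomials *)

Section BinomialBasis.
Variable r : nat.
Implicit Types (P : {mpoly rat[r]}) (n k : 'X_{1..r}).

Lemma binom_leading n : leading (binom_mpoly n) n (\prod_(i < r) (n i)`!%:R)^-1.
Proof. by rewrite binom_mpolyE; exact: shifted_binom_leading. Qed.

Lemma prod_fact_neq0 n : \prod_(i < r) (n i)`!%:R != 0 :> rat.
Proof. by apply/prodf_neq0 => i _; rewrite pnatr_eq0 -lt0n fact_gt0. Qed.

(** The binomial products are triangular with respect to the monomials. Subtracting [top], which
    agrees with [P] in the highest degree, lowers the degree; its factor k! compensates for the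
    leading coefficient 1/k!. *)
Lemma binom_basis P : exists e : {fsfun 'X_{1..r} -> rat with 0},
  P = \sum_(m <- finsupp e) e m *: binom_mpoly m.
Proof.
suff [L ->] : exists L : seq (rat * 'X_{1..r}), P = \sum_(t <- L) t.1 *: binom_mpoly t.2.
  by exists (collect L); rewrite collect_sum.
have [d] := ubnP (msize P); elim: d P => // d IH P; rewrite ltnS => Pd.
case: d IH Pd => [|d] IH Pd.
  by exists [::]; rewrite big_nil; apply/eqP; rewrite -msize_poly_eq0 -leqn0.
pose top := \sum_(k <- msupp P) (P@_k * \prod_(i < r) (k i)`!%:R) *: binom_mpoly k.
have [|L LE] := IH (P - top).
  rewrite ltnS; apply: msize_coef_le => k dk.
  rewrite mcoeffB /top raddf_sum /=.
  have -> : \sum_(l <- msupp P) ((P@_l * \prod_(i < r) (l i)`!%:R) *: binom_mpoly l)@_k =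
      \sum_(l <- msupp P) P@_l * (l == k)%:R.
    rewrite big_seq [RHS]big_seq; apply: eq_bigr => l lP.
    have lk : (mdeg l <= mdeg k)%N.
      by apply: leq_trans dk; rewrite -ltnS; apply: leq_trans Pd; exact: msize_mdeg_lt.
    rewrite mcoeffZ (leading_coef (binom_leading l) lk) mulrA mulfK ?prod_fact_neq0 //.
    by rewrite eq_sym.
  rewrite {1}[P]mpolyE raddf_sum /= -sumrB big1 // => l _.
  by rewrite mcoeffZ mcoeffX subrr.
exists ([seq (P@_k * \prod_(i < r) (k i)`!%:R, k) | k <- msupp P] ++ L).
by rewrite big_cat big_map /= -LE addrC subrK.
Qed.

(** An expansion could a priori contain terms of degree above |n| that cancel. At an index of
    maximal degree nothing cancels, so none occurs; hence every choice in [mixed_mult_poly] gives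
    the same coefficient. *)
Lemma binom_basis_coef (e : {fsfun 'X_{1..r} -> rat with 0}) n :
  (msize (\sum_(m <- finsupp e) e m *: binom_mpoly m) <= (mdeg n).+1)%N ->
  e n = \prod_(i < r) (n i)`!%:R * (\sum_(m <- finsupp e) e m *: binom_mpoly m)@_n.
Proof.
set P := \sum_(m <- _) _ => Pn.
have coefP k : (forall l, l \in finsupp e -> (mdeg l <= mdeg k)%N) ->
    P@_k = e k / \prod_(i < r) (k i)`!%:R.
  move=> kmax; rewrite /P raddf_sum /=.
  have -> : \sum_(l <- finsupp e) (e l *: binom_mpoly l)@_k =
      \sum_(l <- finsupp e) (if l == k then e k / \prod_(i < r) (k i)`!%:R else 0).
    rewrite big_seq [RHS]big_seq; apply: eq_bigr => l le.
    rewrite mcoeffZ (leading_coef (binom_leading l) (kmax _ le)) eq_sym.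
    by case: eqP => [->|_]; rewrite ?mulr1 ?mulr0.
  rewrite -big_mkcond /=; have [ke|] := boolP (k \in finsupp e).
    by rewrite -big_filter filter_pred1_uniq ?fset_uniq // big_seq1.
  by rewrite memNfinsupp => /eqP ->; rewrite mul0r big1_eq.
suff nmax : forall l, l \in finsupp e -> (mdeg l <= mdeg n)%N.
  by rewrite coefP // mulrC divfK // prod_fact_neq0.
move=> l0 l0e; rewrite leqNgt; apply/negP => nl0.
have [|d [dl _ dmax]] := @seq_max _ nat [seq mdeg l | l <- finsupp e] (fun=> True).
  by exists (mdeg l0) => //; exact: map_f.
case/mapP: dl => l le dE.
have lmax k : k \in finsupp e -> (mdeg k <= mdeg l)%N.
  by move=> ke; rewrite -dE; have := dmax _ (map_f mdeg ke) I; rewrite leEnat.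
have : P@_l = 0.
  apply/eqP; rewrite mcoeff_eq0; apply: msize_mdeg_ge; apply: leq_trans Pn _.
  exact: leq_trans (lmax _ l0e).
move/eqP; rewrite coefP // mulf_eq0 invr_eq0 (negbTE (prod_fact_neq0 _)) orbF.
by move: le; rewrite mem_finsupp => /negbTE->.
Qed.

End BinomialBasis.

(** * Dimension of graded primes *)

Section Chains.
Variable T : Type.
Implicit Types (K : set T -> Prop) (P Q : set T).

Definition chain_from K P (k : nat) : Prop := exists Q : nat -> set T,
  [/\ Q 0%N = P, forall i, (i <= k)%N -> K (Q i) & forall i, (i < k)%N -> Q i `<` Q i.+1].

Lemma chain_from0 K P : K P -> chain_from K P 0.
Proof. by move=> KP; exists (fun=> P); split. Qed.

Lemma chain_from_cons K P Q k : K P -> P `<` Q -> chain_from K Q k -> chain_from K P k.+1.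
Proof.
move=> KP PQ [S [S0 SK SS]]; exists (fun i => if i is j.+1 then S j else P).
by split=> // -[|i] //=; [exact: SK|move=> _; rewrite S0|exact: SS].
Qed.

Lemma chain_from_homo K K' P k : (forall Q, K Q -> K' Q) -> chain_from K P k -> chain_from K' P k.
Proof. by move=> KK [S [S0 SK SS]]; exists S; split=> // i /SK /KK. Qed.

Lemma chain_fromS K P k : chain_from K P k.+1 ->
  exists2 Q, K P /\ P `<` Q & chain_from K Q k.
Proof.
move=> [S [S0 SK SS]]; exists (S 1%N); first by rewrite -S0; split; [exact: SK|exact: SS].
by exists (fun i => S i.+1); split=> // i ik; [exact: SK|exact: SS].
Qed.

Lemma chain_from_le K P k j : (j <= k)%N -> chain_from K P k -> chain_from K P j.
Proof.
move=> jk [S [S0 SK SS]]; exists S; split=> // i ij; first by apply: SK; exact: leq_trans jk.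
by apply: SS; exact: leq_trans jk.
Qed.

Lemma chain_from_head K P k : chain_from K P k -> K P.
Proof. by move=> [S [<- SK _]]; exact: SK. Qed.

End Chains.

Lemma bigmax_attained (T : Type) (L : seq T) (F : T -> nat) : L <> [::] ->
  exists2 p, List.In p L & \max_(q <- L) F q = F p.
Proof.
elim: L => // p [|q L] IH _; first by exists p; [left|rewrite big_seq1].
have [x xL xE] := IH (fun e => ltac:(discriminate e)).
rewrite big_cons xE; have [px|xp] := leqP (F p) (F x).
  by exists x; [right|].
by exists p; [left|].
Qed.

Lemma leq_bigmax_In (T : Type) (L : seq T) (F : T -> nat) p : List.In p L ->
  (F p <= \max_(q <- L) F q)%N.
Proof.
elim: L => // q L IH /= [->|/IH pL]; rewrite big_cons leq_max ?leqnn //.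
by rewrite pL orbT.
Qed.

Lemma sum_In (T : Type) (L : seq T) (F : T -> nat) p : List.In p L ->
  (F p <= \sum_(q <- L) F q)%N.
Proof.
elim: L => // q L IH /= [->|/IH pL]; rewrite big_cons ?leq_addr //.
exact: leq_trans (leq_addl _ _).
Qed.

Lemma expn_growth (k d K : nat) : (forall n, (0 < n)%N -> (n ^ k <= K * n ^ d)%N) -> (k <= d)%N.
Proof.
move=> h; rewrite leqNgt; apply/negP => dk.
have := h K.+1 isT; apply/negP; rewrite -ltnNge.
apply: (@leq_trans (K.+1 ^ d.+1)); last by rewrite leq_pexp2l.
by rewrite expnS ltn_pmul2r // expn_gt0.
Qed.

Lemma expn_leq_bin n k : (n ^ k <= k`! * 'C(n + k, k))%N.
Proof.
rewrite mulnC bin_ffact; elim: k => [|k IH]; first by rewrite ffactn0 expn0.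
by rewrite addnS ffactSS expnS leq_mul // leqW // leq_addr.
Qed.

Section PrimeIdeals.
Variables (A : comNzRingType) (m : set A).
Hypothesis mU : forall a, ~ m a -> exists b, a * b = 1.
Hypothesis mnil : forall a, m a -> exists n, a ^+ n = 0.
Variables (B : comAlgType A) (r : nat) (Bz : grade r -> set B).
Hypothesis gB : graded_alg Bz.
Hypothesis nB : noetherian B.
Variable s : seq B.
Hypothesis s_deg : forall b, b \in s -> exists i : 'I_r, Bz (gradeN U_(i)%MM) b.
Hypothesis s_ind : forall K : set B, (forall a, K (in_alg B a)) ->
  (forall x y, K x -> K y -> K (x + y)) -> (forall x y, K x -> K y -> K (x * y)) ->
  (forall x, x \in s -> K x) -> forall b, K b.

Let dB := galg_dsum gB.
Let gR := graded_mod_regular gB.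
Implicit Types (P Q : set B) (nu mu : grade r).

Definition iprime P : Prop :=
  [/\ is_ideal P, ~ P 1 & forall a b, P (a * b) -> P a \/ P b].

Lemma gprime_iprime P : gprime Bz P -> iprime P.
Proof. by case. Qed.

Lemma iprime_expr P a n : iprime P -> P (a ^+ n) -> P a.
Proof.
move=> [iP P1 PM]; elim: n => [|n IH]; first by rewrite expr0.
by rewrite exprS => /PM[//|/IH].
Qed.

Lemma iprime_max P a : iprime P -> m a -> P (in_alg B a).
Proof.
move=> pP ma; have [n an] := mnil ma; apply: (iprime_expr pP (n := n)).
by rewrite -rmorphXn an rmorph0; case: pP => iP _ _; exact: ideal0.
Qed.

Lemma galg1 : Bz 0 1.
Proof. by have := galg_in gB 1; rewrite rmorph1. Qed.

Lemma galg_comp_neg nu b : (exists i, nu i < 0) -> gcomp Bz nu b = 0.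
Proof.
move=> [i nui]; apply: contrapT => nb.
by have := galg_pos gB (gcomp_in dB nu b) nb i; rewrite leNgt nui.
Qed.

Lemma gcompM nu mu a b : Bz mu a -> gcomp Bz nu (a * b) = a * gcomp Bz (nu - mu) b.
Proof. by move=> Ba; exact: (gcompZr gR nu (b : B^o) Ba). Qed.

Lemma gcompMr nu mu a b : Bz mu a -> gcomp Bz nu (b * a) = gcomp Bz (nu - mu) b * a.
Proof. by move=> Ba; rewrite mulrC (gcompM _ _ Ba) mulrC. Qed.

(** Modulo [P] every element is represented by one without components of positive degree in
    direction [i]: this holds for scalars and generators, and passes to sums and products. *)
Lemma galg_gens P i : is_ideal P -> gclosed Bz P ->
  (forall x, x \in s -> Bz (gradeN U_(i)%MM) x -> P x) ->
  forall nu, 0 < nu i -> Bz nu `<=` P.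
Proof.
move=> iP gP Ps nu nui b Bb.
have /(_ b)[q [Pbq q0]] : forall b, exists q, P (b - q) /\ forall nu, 0 < nu i -> gcomp Bz nu q = 0.
  apply: s_ind => [a|x y [q [Pq q0]] [p [Pp p0]]|x y [q [Pq q0]] [p [Pp p0]]|x xs].
  - exists (in_alg B a); rewrite subrr; split; first exact: ideal0.
    move=> mu mui; rewrite (gcomp_homog dB _ (galg_in gB a)).
    by case: eqP => // e; rewrite e ffunE ltxx in mui.
  - exists (q + p); split; first by rewrite opprD addrACA; exact: idealD.
    by move=> mu mui; rewrite (gcompD dB) q0 // p0 // addr0.
  - exists (q * p); split.
      have -> : x * y - q * p = x * (y - p) + p * (x - q) by ring.
      by apply: idealD => //; exact: idealMl.
    move=> mu mui; have [t [_ _ _ ->]] := gcompP dB q.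
    rewrite mulr_suml (gcomp_sum dB) big1 // => j _.
    rewrite (gcompM _ _ (gcomp_in dB j q)).
    have [ji|ji] := ltP 0 (j i); first by rewrite q0 // mul0r.
    by rewrite p0 ?mulr0 // !ffunE subr_gt0; exact: le_lt_trans mui.
  - have [j Bx] := s_deg xs; have [ji|ji] := eqVneq j i.
      exists 0; rewrite subr0; split; first by apply: Ps => //; rewrite -ji.
      by move=> mu _; exact: gcomp0.
    exists x; rewrite subrr; split; first exact: ideal0.
    move=> mu mui; rewrite (gcomp_homog dB _ Bx); case: eqP => // e.
    by move: mui; rewrite e ffunE mnm1E (negbTE ji).
by have := gP nu _ Pbq; rewrite (gcompB dB) (gcomp_id dB Bb) q0 // subr0.
Qed.

(** For a graded prime this amounts to not containing the irrelevant ideal ([relevant_elt],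
    [irrelevant_sub]), but it can be checked one direction at a time. *)
Definition relevant P : Prop := forall i : 'I_r, exists2 x, Bz (gradeN U_(i)%MM) x & ~ P x.

Lemma irrelevantP P : is_ideal P -> gclosed Bz P -> ~ relevant P ->
  exists i, forall nu, 0 < nu i -> Bz nu `<=` P.
Proof.
move=> iP gP /existsNP[i nx]; exists i; apply: galg_gens => // x _ Bx.
by apply: contrapT => nPx; apply: nx; exists x.
Qed.

Lemma relevant_monomial P (n : 'X_{1..r}) : iprime P -> relevant P ->
  exists2 z, Bz (gradeN n) z & ~ P z.
Proof.
move=> pP rP; have [iP P1 PM] := pP; rewrite [n]multinomUE_id.
elim/big_rec: _ => [|i k _ [z Bz_z nPz]].
  by exists 1 => //; rewrite gradeN0; exact: galg1.
elim: (n i) => [|e [y By nPy]].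
  by exists z => //; rewrite mulm0n add0m.
have [x Bx nPx] := rP i; exists (x * y).
  by rewrite mulmS -addmA gradeND; apply: galg_mul.
by move/PM => [].
Qed.

Lemma iprime_colon P z : iprime P -> ~ P z -> colon (P : set B^o) z = P.
Proof.
move=> [iP _ PM] nz; apply/seteqP; split=> b; first by move/PM => [].
by move=> Pb; exact: idealMr.
Qed.

(** Since [z] is not a zero divisor modulo [P], multiplication by it gives an exact sequence of B/P
    shifted by [d], B/P and B/(P + zB). *)
Lemma Hf_section P d z nu n : gprime Bz P -> Bz d z -> ~ P z ->
  has_length m Bz P ->
  rlen m (Badj (P : set B^o) z `&` Bz nu : set B^o) (Bz nu) n ->
  Hf m Bz P nu = (Hf m Bz P (nu - d)%R + n)%N.
Proof.
move=> pP Bd nz hP rn; have [iP P1 PM gP] := pP.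
apply: (HfE mU gB iP); apply: rlen_cat rn.
apply: (rlen_Badj gB gR iP gP Bd).
rewrite (iprime_colon (gprime_iprime pP) nz); exact: HfP.
Qed.

Lemma Hf_mono P d z nu : gprime Bz P -> Bz d z -> ~ P z -> has_length m Bz P ->
  (Hf m Bz P (nu - d)%R <= Hf m Bz P nu)%N.
Proof.
move=> pP Bd nz hP; have [iP P1 PM gP] := pP.
have sBz : is_Asubmodule (Bz nu : set B^o) by exact: (graded_piece_Asub gB nu gR).
have [||||n [rn _ _]] := rlen_sub mU _ _ _ _ (HfP nu hP) (W := Badj (P : set B^o) z `&` Bz nu).
- exact: (ideal_piece_Asub gB nu iP).
- by apply: AsubI => //; apply: Bsub_Asub; exact: Badj_Bsub.
- by move=> b [Pb Bb]; split=> //; exact: Badj_sub.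
- by move=> b [].
by rewrite (Hf_section pP Bd nz hP rn) leq_addr.
Qed.

Lemma Hf_gt0 P nu : gprime Bz P -> relevant P -> has_length m Bz P ->
  (forall i, 0 <= nu i) -> (0 < Hf m Bz P nu)%N.
Proof.
move=> pP rP hP nu0; have [iP P1 PM gP] := pP.
have [z Bnz nz] := relevant_monomial (grade_abs nu) (gprime_iprime pP) rP.
rewrite grade_absK // in Bnz.
have := chl_size mU (s := [:: z : B^o]) (ideal_piece_Asub gB nu iP) (HfP nu hP).
apply; first by move=> x; rewrite inE => /eqP ->.
by split=> // -[].
Qed.

Lemma Hf_irrelevant P nu : is_ideal P -> gclosed Bz P -> ~ relevant P ->
  (forall i, 0 < nu i) -> Hf m Bz P nu = 0%N.
Proof.
move=> iP gP nr nu0; have [i iPB] := irrelevantP iP gP nr.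
apply: (HfE mU gB iP); have -> : P `&` Bz nu = Bz nu; last exact: rlen_nil.
by apply/seteqP; split=> b; [case|move=> Bb; split=> //; exact: iPB Bb].
Qed.

Lemma supported_boxP b : exists2 c, (0 < c)%N & supported Bz (box r c) b.
Proof.
have [t [_ Bt b0 _]] := gcompP dB b.
exists (\max_(nu <- t) \max_(i < r) `|nu i|%N).+1 => // nu nub.
apply: contrapT => nb; case/negP: nub; rewrite mem_box; apply/forallP => i.
have pos := galg_pos gB (Bt nu) nb i; rewrite pos /=.
have nt : nu \in t by apply: contraT => /b0.
have le : (`|nu i| <= \max_(nu <- t) \max_(i < r) `|nu i|%N)%N.
  by apply: leq_trans (leq_bigmax_seq _ nt isT); exact: (leq_bigmax i).
by rewrite -(gez0_abs pos) lez_nat leqW.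
Qed.

Lemma supported_box_homo c d : (c <= d)%N -> supported Bz (box r c) `<=` supported Bz (box r d).
Proof.
move=> cd b bc nu; rewrite mem_box => nb; apply: bc; rewrite mem_box; apply: contra nb.
by move=> /forallP h; apply/forallP => i; have := h i; lia.
Qed.

Lemma supported_boxM c d a b : supported Bz (box r c) a -> supported Bz (box r d) b ->
  supported Bz (box r (c + d)) (a * b).
Proof.
move=> ac bd nu nub; have [t [_ _ _ ->]] := gcompP dB a.
rewrite mulr_suml (gcomp_sum dB) big1 // => mu _.
rewrite (gcompM _ _ (gcomp_in dB mu a)).
have [mc|/ac->] := boolP (mu \in box r c); last by rewrite mul0r.
rewrite bd ?mulr0 //; apply: contra nub; rewrite mem_box in mc; rewrite !mem_box.
move=> /forallP h; apply/forallP => i.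
move: (h i) (forallP mc i); rewrite !ffunE; move: (nu i) (mu i) => x y.
by lia.
Qed.

Lemma supported_box1 c : supported Bz (box r c) 1.
Proof.
move=> nu nub; rewrite (gcomp_homog dB _ galg1); case: eqP => // e.
by case/negP: nub; rewrite mem_box e; apply/forallP => i; rewrite ffunE.
Qed.

(* Multiplication by an element of Q1 outside Q identifies B/Q with a subquotient of
   Q1/Q, so that each step of a chain of primes raises the order of growth by one. *)
Lemma chain_growth Q k : chain_from iprime Q k -> exists2 c, (0 < c)%N & forall n,
  exists t : seq B^o, [/\ forall x, x \in t -> supported Bz (box r (c * n)) x,
    chl (Q : set B^o) t & ('C(n + k, k) <= size t)%N].
Proof.
elim: k Q => [|k IH] Q.
  move=> /chain_from_head[iQ Q1 _]; exists 1%N => // n; exists [:: 1]; split=> //.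
    by move=> x; rewrite inE => /eqP ->; exact: supported_box1.
  by rewrite bin0.
move=> /chain_fromS[Q1 [pQ [QQ1 nQ1Q]]] cQ1.
have [iQ nQ1 QM] := pQ; have [iQ1 _ _] := chain_from_head cQ1.
have [c' c'0 c'P] := IH _ cQ1.
have [x Q1x nQx] : exists2 x, Q1 x & ~ Q x.
  by apply: contrapT => nx; apply: nQ1Q => x Q1x; apply: contrapT => nQx; apply: nx; exists x.
have [c0 c00 xc0] := supported_boxP x.
(* Multiplication by [x] raises degrees by at most [c0], and each enlargement of the box by
   [c' * c0] leaves room for it. *)
exists (c' * c0)%N; first by rewrite muln_gt0 c'0.
elim=> [|n [t1 [t1s t1c t1n]]].
  exists [:: 1]; split; [|by []|by rewrite add0n binn].
  by move=> y; rewrite inE => /eqP ->; exact: supported_box1.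
have [t2 [t2s t2c t2n]] := c'P (c0 * n.+1)%N.
(* The multiples of [x] lie in [Q1] and stay independent modulo the prime [Q], as [x] is outside it;
   [t2] is independent modulo [Q1]. The sizes add up by Pascal's rule. *)
exists ([seq (x * y : B^o) | y <- t1] ++ t2); split.
- move=> y; rewrite mem_cat => /orP[/mapP[z zt ->]|/t2s]; last by rewrite mulnA.
  rewrite mulnS; apply: supported_boxM; last exact: t1s.
  by apply: supported_box_homo xc0; exact: leq_pmull.
- apply: (chl_cat (Q := Q1 : set B^o)) => //; first exact: ideal_Asub.
    by move=> y /mapP[z _ ->]; exact: idealMr.
  have lin (a : A) (y z : B^o) :
      x * ((a%:A : B) *: y + z : B) = (a%:A : B) *: (x * y : B^o) + (x * z : B^o).
    by rewrite mulrDr; congr (_ + _); exact: mulrCA.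
  by apply: (@chl_map _ _ B^o B^o (fun y => x * y : B^o) lin Q Q t1 _ t1c) => z /QM [].
- rewrite size_cat size_map addSn binS; apply: leq_add => //.
  rewrite addnS -addSn; apply: leq_trans t2n; apply: leq_bin2l.
  by rewrite leq_add2r leq_pmull.
Qed.

Lemma chain_box_sum P k : gprime Bz P -> has_length m Bz P -> chain_from iprime P k ->
  exists2 c, (0 < c)%N & forall n,
    ('C(n + k, k) <= \sum_(nu <- box r (c * n)) Hf m Bz P nu)%N.
Proof.
move=> pP hP cP; have [iP P1 PM gP] := pP.
have [c c0 cgrow] := chain_growth cP; exists c => // n.
have [t [ts tc tn]] := cgrow n; apply: leq_trans tn _.
have sPb : is_Asubmodule (P `&` supported Bz (box r (c * n)) : set B^o).
  by apply: AsubI; [exact: ideal_Asub|exact: supported_Asub].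
have := chl_size mU sPb (rlen_supported gB iP gP hP (box_uniq r (c * n))) ts.
by apply; apply: chl_sub tc => b [].
Qed.

(** A chain of length k makes the cube sums grow at least like n^k, and a pole order d lets them
    grow at most like n^d. *)
Lemma growth_le P k d : gprime Bz P -> has_length m Bz P ->
  dec (fun nu => (Hf m Bz P nu)%:Z) d -> chain_from iprime P k -> (k <= d)%N.
Proof.
move=> pP hP dP cP; have [c c0 cgrow] := chain_box_sum pP hP cP.
have [K KP] := dec_box_sum dP.
apply: (@expn_growth _ _ (k`! * (K * c.+1 ^ d))%N) => n n0.
apply: leq_trans (expn_leq_bin n k) _; rewrite -!mulnA leq_pmul2l ?fact_gt0 //.
apply: leq_trans (cgrow n) _.
have := KP (c * n)%N; rewrite -(big_morph Posz PoszD (erefl _)) lez_nat => tle.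
apply: leq_trans tle _; rewrite leq_mul2l -expnMn; apply/orP; right.
by case: (d) => // e; rewrite leq_exp2r //; nia.
Qed.

Definition diag (N : nat) : grade r := [ffun=> N%:Z].

Lemma Hf_homo P mu nu : gprime Bz P -> relevant P -> has_length m Bz P ->
  (forall i, mu i <= nu i) -> (Hf m Bz P mu <= Hf m Bz P nu)%N.
Proof.
move=> pP rP hP munu.
have [z Bnz nz] := relevant_monomial (grade_abs (nu - mu)) (gprime_iprime pP) rP.
rewrite grade_absK in Bnz; last by move=> i; rewrite !ffunE subr_ge0.
by have := Hf_mono nu pP Bnz nz hP; rewrite opprB addrC subrK.
Qed.

(** By monotonicity a cube sum is at most the number of degrees, of order N^r, times the value at
    the far corner; dividing N^k by N^r leaves k - r. *)
Lemma relevant_diag_growth P k : gprime Bz P -> relevant P -> has_length m Bz P ->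
  (r <= k)%N -> chain_from iprime P k ->
  exists c K, (0 < c)%N /\ forall N, (0 < N)%N -> (N ^ (k - r) <= K * Hf m Bz P (diag (c * N)))%N.
Proof.
move=> pP rP hP rk cP; have [c c0 cgrow] := chain_box_sum pP hP cP.
exists c, (k`! * c.+1 ^ r)%N; split=> // N N0.
have Nr0 : (0 < N ^ r)%N by rewrite expn_gt0 N0.
rewrite -(leq_pmul2r Nr0) -expnD subnK //.
apply: leq_trans (expn_leq_bin N k) _; rewrite -!mulnA leq_pmul2l ?fact_gt0 //.
apply: leq_trans (cgrow N) _.
apply: (@leq_trans (\sum_(nu <- box r (c * N)) Hf m Bz P (diag (c * N)))).
  rewrite big_seq [X in (_ <= X)%N]big_seq; apply: leq_sum => nu.
  rewrite mem_box => /forallP nuN; apply: Hf_homo => // i.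
  by rewrite ffunE; have /andP[] := nuN i.
rewrite big_const_seq count_predT size_box iter_addn_0.
rewrite [X in (_ <= X)%N]mulnCA leq_mul2l; apply/orP; right.
by rewrite -expnMn; case: (posnP r) => [->//|r0]; rewrite leq_exp2r //; nia.
Qed.

(** The Hilbert function of a relevant prime is at least 1 in every degree of N^r, so its cube sums
    are at least (N+1)^r. *)
Lemma relevant_dec_ge P d : gprime Bz P -> relevant P -> has_length m Bz P ->
  dec (fun nu => (Hf m Bz P nu)%:Z) d -> (r <= d)%N.
Proof.
move=> pP rP hP dP; have [K KP] := dec_box_sum dP.
apply: (@expn_growth _ _ K) => -[//|N] _; rewrite -size_box.
have := KP N; rewrite -(big_morph Posz PoszD (erefl _)) lez_nat; apply: leq_trans.
rewrite -sum1_size big_seq [X in (_ <= X)%N]big_seq; apply: leq_sum => nu.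
rewrite mem_box => /forallP nuN; apply: Hf_gt0 => // i.
by have /andP[] := nuN i.
Qed.

Lemma pfilt_ann (M : lmodType B) (Mg : grade r -> set M) (U V : set M) L p b :
  graded_mod Bz Mg -> is_Bsubmodule U -> gclosed Mg U -> pfilt Bz Mg U V L -> List.In p L ->
  (forall v, V v -> U (b *: v)) -> p.1 b.
Proof.
move=> gM sU gU; elim=> [//|V' L' y a fL IH My pV] /= + bV.
have [sV gV UV] := pfilt_sub gB gM sU gU fL.
case=> [<-|pL]; last by apply: IH => // v Vv; apply: bV; exact: Badj_sub.
by apply: UV; apply: bV; exact: Badj_mem.
Qed.

Lemma section_filtration P d z : gprime Bz P -> Bz d z -> ~ P z ->
  exists2 L : seq (set B * grade r),
    pfilt Bz (Bz : grade r -> set B^o) (Badj (P : set B^o) z) setT L &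
    forall p, List.In p L -> gprime Bz p.1 /\ P `<` p.1.
Proof.
move=> pP Bd nz; have [iP P1 PM gP] := pP.
have sU : is_Bsubmodule (Badj (P : set B^o) z) by exact: Badj_Bsub.
have gU := Badj_gclosed gB gR (iP : is_Bsubmodule (P : set B^o)) gP
  (Bd : (Bz : grade r -> set B^o) d z).
have fB : fin_gen (B^o : lmodType B).
  by exists [:: 1] => b; exists (fun=> b); rewrite big_ord1 /= -[LHS]mulr1.
have [L fL] := pfilt_exists gB gR nB fB sU gU.
exists L => // p pL; split; first exact: pfilt_prime fL pL.
have ann b : Badj (P : set B^o) z b -> p.1 b.
  move=> Ub; apply: (pfilt_ann gR sU gU fL pL) => v _.
  by rewrite [_ *: _]mulrC; exact: (BsubZ _ sU).
split; first by move=> b Pb; apply: ann; exact: Badj_sub.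
by move=> sub; apply: nz; apply: sub; apply: ann; exact: Badj_mem.
Qed.

Definition relevant_gprime P : Prop := gprime Bz P /\ relevant P.

(** Pole order and chain pin [d] down: the former bounds all chains of primes from [P], graded or
    not, and the latter attains the bound. The last clause prepares d_{++} and is carried along in
    the same induction. *)
Definition is_dimension P (d : nat) : Prop :=
  [/\ has_length m Bz P, dec (fun nu => (Hf m Bz P nu)%:Z) d, chain_from (gprime Bz) P d &
      relevant P -> (r <= d)%N /\ chain_from relevant_gprime P (d - r)].

Lemma is_dimension_growth P k d : gprime Bz P -> is_dimension P d ->
  chain_from iprime P k -> (k <= d)%N.
Proof. by move=> pP [hP dP _ _]; exact: growth_le. Qed.

Hypothesis r0 : (0 < r)%N.

(** Here B/P is A/m concentrated in degree 0, with Hilbert series 1 and dimension 0. *)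
Lemma dimension_base P : gprime Bz P -> (forall x, x \in s -> P x) -> is_dimension P 0.
Proof.
move=> pP sP; have [iP P1 PM gP] := pP; pose i0 := Ordinal r0.
have pos i nu : 0 < nu i -> Bz nu `<=` P by apply: galg_gens => // x /sP.
have PB nu : nu != 0 -> Bz nu `<=` P.
  move=> nu0 b Bb; apply: contrapT => nPb.
  have b0 : b <> 0 by move=> e; apply: nPb; rewrite e; exact: ideal0.
  have [i nui] := grade_neq0 nu0.
  apply: nPb; apply: (pos i _ _ _ Bb).
  by rewrite lt_neqAle eq_sym nui; exact: (galg_pos gB Bb b0 i).
have e1 a : (a%:A : B) *: (1 : B^o) = in_alg B a by exact: mulr1.
have r0len : rlen m (P `&` Bz 0 : set B^o) (Bz 0) 1.
  have eB : adj (P `&` Bz 0 : set B^o) 1 = Bz 0 :> set B^o.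
    apply/seteqP; split=> b; last first.
      move=> /(galg_0 gB)[a ->]; exists a; rewrite e1 subrr.
      by split; [exact: ideal0|exact: (dsum0 dB)].
    case=> a [_ Bba]; rewrite -(subrK (in_alg B a) b); apply: (dsumD dB); last exact: galg_in.
    by move: Bba; rewrite e1.
  rewrite -[X in rlen m _ X _]eB.
  apply: rlen_cons; [exact: rlen_nil|by case|move=> a ma].
  rewrite e1; split; last exact: (galg_in gB).
  exact: (iprime_max (gprime_iprime pP)).
have rlenN nu : nu != 0 -> rlen m (P `&` Bz nu : set B^o) (Bz nu) 0.
  move=> nu0; have -> : P `&` Bz nu = Bz nu; last exact: rlen_nil.
  by apply/seteqP; split=> b; [case|move=> Bb; split=> //; exact: PB Bb].
split.
- by move=> nu; have [->|/rlenN] := eqVneq nu 0; [exists 1%N|exists 0%N].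
- apply: eq_dec (dec_delta r) => nu; have [->|nu0] := eqVneq nu 0.
    by rewrite (HfE mU gB iP r0len).
  by rewrite (HfE mU gB iP (rlenN _ nu0)).
- exact: chain_from0.
- move=> /(_ i0)[x Bx nPx]; case: nPx; apply: (pos i0 _ _ _ Bx).
  by rewrite ffunE mnm1E eqxx.
Qed.

(** * Cutting a graded prime by a homogeneous element *)

Section HyperplaneSection.
Variables (P : set B) (d : grade r) (z : B) (L : seq (set B * grade r)).
Hypotheses (pP : gprime Bz P) (Bd : Bz d z) (nz : ~ P z).
Hypothesis fL : pfilt Bz (Bz : grade r -> set B^o) (Badj (P : set B^o) z) setT L.
Hypothesis hL : forall p, List.In p L -> has_length m Bz p.1.

Lemma section_rlen nu :
  rlen m (Badj (P : set B^o) z `&` Bz nu : set B^o) (Bz nu)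
    (\sum_(p <- L) Hf m Bz p.1 (nu - p.2)%R).
Proof.
have [iP P1 PM gP] := pP.
have sU : is_Bsubmodule (Badj (P : set B^o) z) by exact: Badj_Bsub.
have gU := Badj_gclosed gB gR (iP : is_Bsubmodule (P : set B^o)) gP
  (Bd : (Bz : grade r -> set B^o) d z).
by have := pfilt_rlen gB gR nu sU gU fL hL; rewrite setTI.
Qed.

Lemma section_Hf nu : has_length m Bz P ->
  Hf m Bz P nu = (Hf m Bz P (nu - d)%R + \sum_(p <- L) Hf m Bz p.1 (nu - p.2)%R)%N.
Proof. by move=> hP; exact: (Hf_section pP Bd nz hP (section_rlen nu)). Qed.

Lemma section_has_length (i : 'I_r) : 0 < d i -> has_length m Bz P.
Proof.
move=> di; have [iP P1 PM gP] := pP.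
suff H : forall (k : nat) nu, nu i < k%:Z -> exists n, rlen m (P `&` Bz nu : set B^o) (Bz nu) n.
  by move=> nu; apply: (H `|nu i|%N.+1); lia.
elim=> [|k IH] nu nuk.
  exists 0%N; have -> : P `&` Bz nu = Bz nu; last exact: rlen_nil.
  apply/seteqP; split=> b; [by case|move=> Bb; split=> //].
  have -> : b = 0; last exact: ideal0.
  by rewrite -(gcomp_id dB Bb) galg_comp_neg //; exists i.
have [|n rn] := IH (nu - d); first by move: nuk di; rewrite !ffunE; move: (nu i) (d i) => x y; lia.
exists (n + \sum_(p <- L) Hf m Bz p.1 (nu - p.2)%R)%N.
apply: rlen_cat (section_rlen nu); apply: (rlen_Badj gB gR iP gP Bd).
by rewrite (iprime_colon (gprime_iprime pP) nz).
Qed.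

End HyperplaneSection.

(** A multiple of [z] has no component in degree 0, so 1 cannot lie in P + zB. *)
Lemma section_nonempty P d z L : gprime Bz P -> Bz d z -> d != 0 -> (forall i, 0 <= d i) ->
  pfilt Bz (Bz : grade r -> set B^o) (Badj (P : set B^o) z) setT L -> L <> [::].
Proof.
move=> pP Bd d0 dpos fL L0; have [iP P1 PM gP] := pP.
have [i di] := grade_neq0 d0.
have TU : Badj (P : set B^o) z = setT.
  by move: fL; rewrite L0 => f; inversion f.
have : Badj (P : set B^o) z 1 by rewrite TU.
case=> b Pb; apply: P1; have := gP 0 _ Pb.
rewrite (gcompB dB) (gcomp_id dB galg1) [_ *: _]/(b * z).
rewrite (gcompMr _ _ Bd) galg_comp_neg ?mul0r ?subr0 //.
exists i; rewrite !ffunE sub0r oppr_lt0 lt_neqAle eq_sym di; exact: dpos.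
Qed.

Lemma dec_agrees F D : (r <= D)%N -> dec F D ->
  exists2 H : {mpoly rat[r]}, agrees F H & (msize H <= (D - r).+1)%N.
Proof.
move=> rD [ts [tD _ tF]]; have [H [aH cH]] := terms_poly tD.
exists H; first by apply: for_largeS aH => nu /=; rewrite tF.
apply: msize_coef_le => k Dk; rewrite cH; last by lia.
rewrite /terms_mult big_seq_cond big1 ?mul0r // => t /andP[tt /eqP tk].
by have := tD t tt; rewrite tk mdegD mdeg_ones; lia.
Qed.

Lemma agrees_sum (T : Type) (L : seq T) (F : T -> grade r -> int) (d : nat) :
  (forall p, List.In p L -> exists2 H : {mpoly rat[r]}, agrees (F p) H & (msize H <= d)%N) ->
  exists2 H : {mpoly rat[r]}, agrees (fun nu => \sum_(p <- L) F p nu) H & (msize H <= d)%N.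
Proof.
elim: L => [_|p L IH hL].
  by exists 0; [exists 0 => nu _; rewrite /= big_nil meval0|rewrite msize0].
have [H aH Hd] := hL p (or_introl erefl).
have [H' aH' H'd] := IH (fun q qL => hL q (or_intror qL)).
exists (H + H'); last exact: msizeD_low.
apply: for_largeS (for_largeI aH aH') => nu [/= e e'].
by rewrite big_cons rmorphD /= e e' mevalD.
Qed.

Lemma linear_growth_contra (X : rat) (t N0 : nat) :
  ~ (forall N : nat, (N0 <= N)%N -> (0 < N)%N -> N%:R ^+ t.+1 <= X * N%:R ^+ t).
Proof.
move=> h; pose N := (maxn N0 (Num.bound X)).+1.
have := h N; rewrite exprS ler_pM2r ?exprn_gt0 ?ltr0n // => /(_ _ isT).
rewrite (leq_trans (leq_maxl _ _) (leqnSn _)) => /(_ isT); apply/negP; rewrite -ltNge.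
have [X0|X0] := leP 0 X; last by apply: lt_le_trans X0 _; exact: ler0n.
apply: lt_le_trans (archi_boundP X0) _; rewrite ler_nat.
by rewrite (leq_trans (leq_maxr N0 _)).
Qed.

(* When no relevant prime of the filtration has dimension d - 1, the increments of
   N |-> Hf P (N, ..., N) grow with order at most d - r - 2, contradicting the lower
   bound on the growth of Hf P. *)
Lemma relevant_section P d z L (dim : set B -> nat) : gprime Bz P -> relevant P ->
  has_length m Bz P -> chain_from iprime P d -> (r < d)%N ->
  Bz (diag 1) z -> ~ P z ->
  pfilt Bz (Bz : grade r -> set B^o) (Badj (P : set B^o) z) setT L ->
  (forall p, List.In p L -> gprime Bz p.1 /\ is_dimension p.1 (dim p.1)) ->
  exists p, [/\ List.In p L, relevant p.1 & (d <= (dim p.1).+1)%N].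
Proof.
move=> pP rP hP cP rd Bz1 nz fL hL; apply: contrapT => nex.
pose D nu := \sum_(p <- L) (Hf m Bz p.1 (nu - p.2))%:Z.
(* A relevant prime of dimension at most d - 2 contributes a polynomial of degree at most d - 2 - r;
   an irrelevant one contributes 0 in large degrees. *)
have [R aR Rt] : exists2 R : {mpoly rat[r]}, agrees D R & (msize R <= d - r.+1)%N.
  apply: agrees_sum => p pL; have [pp [hp dp cp relp]] := hL p pL.
  have [rel|nrel] := pselect (relevant p.1).
    have [rdim _] := relp rel.
    have [||H aH Hs] := @dec_agrees (fun nu => (Hf m Bz p.1 (nu - p.2))%:Z) (dim p.1).
    - exact: rdim.
    - exact: (dec_shift p.2 dp).
    exists H => //; apply: leq_trans Hs _.
    have : ~~ (d <= (dim p.1).+1)%N by apply/negP => le; apply: nex; exists p.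
    by lia.
  exists 0; last by rewrite msize0.
  have [ip _ _ gp] := pp.
  apply: for_largeS (for_large_ge (p.2 + [ffun=> 1])) => nu /= nup.
  rewrite meval0 Hf_irrelevant // => i.
  by have := nup i; rewrite !ffunE; move: (nu i) (p.2 i) => x y; lia.
have [C C0 CP] := mpoly_bound Rt.
have [N0 N0P] := for_large_diag aR.
have [c [K [c0 KP]]] := relevant_diag_growth pP rP hP (ltnW rd) cP.
pose H N := (Hf m Bz P (diag N))%:R : rat.
have step N : (N0 <= N)%N -> H N.+1 = H N + R.@[fun i => (diag N.+1 i)%:~R].
  move=> N0N; have <- := N0P N.+1 (leqW N0N) (diag N.+1); last by move=> i; rewrite ffunE.
  rewrite /H (section_Hf pP Bz1 nz fL _ (diag N.+1) hP); last by move=> p /hL[_ []].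
  have -> : diag N.+1 - diag 1 = diag N by apply/ffunP => i; rewrite !ffunE; lia.
  by rewrite natrD /D /= -(big_morph Posz PoszD (erefl _)) -pmulrn.
(* Sum of [j] increments along the diagonal, each bounded, after multiplication by N, by C
   N^(d-r-1). *)
have bound N j : (0 < N)%N -> (j + N0 <= N)%N ->
    N%:R * H (j + N0)%N <= N%:R * H N0 + j%:R * (C * N%:R ^+ (d - r.+1)).
  move=> Npos; elim: j => [|j IH] jN; first by rewrite add0n mul0r addr0.
  rewrite addSn step ?leq_addl // mulrDr -natr1 mulrDl mul1r addrA.
  apply: lerD; first by apply: IH; exact: ltnW.
  apply: le_trans (CP N (diag (j + N0).+1) Npos _).
    by apply: ler_wpM2l => //; exact: ler_norm.
  by move=> i; rewrite ffunE /= lez_nat.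
have Hle N : (0 < N)%N -> (N0 <= N)%N -> H N <= H N0 + C * N%:R ^+ (d - r.+1).
  move=> Npos N0N; have Nr : 0 < N%:R :> rat by rewrite ltr0n.
  rewrite -(ler_pM2l Nr) mulrDr; have := bound N (N - N0)%N Npos.
  rewrite subnK // => /(_ (leqnn _)).
  move/le_trans; apply; rewrite lerD2l; apply: ler_wpM2r; last by rewrite ler_nat leq_subr.
  by rewrite mulr_ge0 // exprn_ge0.
apply: (@linear_growth_contra (K%:R * (H N0 + C * c%:R ^+ (d - r.+1))) (d - r.+1) N0) => N N0N Npos.
have e : (d - r.+1).+1 = (d - r)%N by rewrite subnSK.
rewrite e; have := KP N Npos; rewrite -(ler_nat rat) natrX natrM => /le_trans; apply.
rewrite -mulrA; apply: ler_wpM2l => //.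
apply: le_trans (Hle _ _ _) _.
- by rewrite muln_gt0 c0.
- by apply: leq_trans N0N _; rewrite leq_pmull.
rewrite mulrDl natrM exprMn mulrA lerD2r ler_peMr ?ler0n //.
by rewrite exprn_ege1 // ler1n.
Qed.

Lemma gprime_dimension P : gprime Bz P -> exists d, is_dimension P d.
Proof.
move=> pP0; have [iP0 _ _ _] := pP0; move: P iP0 pP0.
apply: (noetherian_ind nB) => P iP IH pP.
have [sP|/existsNP[x /not_implyP[xs nPx]]] := pselect (forall x, x \in s -> P x).
  by exists 0%N; exact: dimension_base.
pose dim Q := xget 0%N [set d | is_dimension Q d].
have dimP Q : gprime Bz Q -> P `<` Q -> is_dimension Q (dim Q).
  move=> pQ [PQ nQP]; have [iQ _ _ _] := pQ.
  have [|d dQ] := IH Q iQ PQ _ pQ; first by move=> e; apply: nQP; rewrite e.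
  by rewrite /dim; case: xgetP => [e _ //|/(_ d)].
have [i Bx] := s_deg xs.
have [L fL LP] := section_filtration pP Bx nPx.
have L0 : L <> [::].
  apply: (section_nonempty pP Bx _ _ fL) => [|j]; last by rewrite ffunE.
  by apply/eqP => /ffunP/(_ i); rewrite !ffunE mnm1E eqxx.
have hL p : List.In p L -> has_length m Bz p.1.
  by case/LP => pp Pp; have [] := dimP _ pp Pp.
have hP : has_length m Bz P.
  by apply: (section_has_length pP Bx nPx fL hL (i := i)); rewrite ffunE mnm1E eqxx.
(* Dividing the series of the section by 1 - t_i and putting [P] below a longest chain of the
   section both add one to [D]. *)
pose D := \max_(p <- L) dim p.1.
have dP : dec (fun nu => (Hf m Bz P nu)%:Z) D.+1.
  apply: (dec_integrate (i := i) (G := fun nu => \sum_(p <- L) (Hf m Bz p.1 (nu - p.2))%:Z)).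
  - move=> nu nui; apply/eqP; rewrite eqz_nat; apply/eqP; apply: (HfE mU gB iP).
    have -> : P `&` Bz nu = Bz nu; last exact: rlen_nil.
    apply/seteqP; split=> b; [by case|move=> Bb; split=> //].
    have -> : b = 0; last exact: ideal0.
    by rewrite -(gcomp_id dB Bb) galg_comp_neg //; exists i.
  - move=> nu; rewrite (section_Hf pP Bx nPx fL hL nu hP) PoszD; congr (_ + _).
    exact: (big_morph Posz PoszD (erefl _)).
  - apply: (dec_sum (F := fun p nu => (Hf m Bz p.1 (nu - p.2))%:Z)) => p pL.
    have [pp Pp] := LP p pL; have [_ dp _ _] := dimP _ pp Pp.
    apply: (dec_raise i (leq_bigmax_In (fun p => dim p.1) pL)).
    exact: (dec_shift p.2 dp).
have cP : chain_from (gprime Bz) P D.+1.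
  have [p pL pE] := bigmax_attained (fun p => dim p.1) L0; rewrite /D pE.
  have [pp Pp] := LP p pL; have [_ _ cp _] := dimP _ pp Pp.
  exact: chain_from_cons cp.
exists D.+1; split=> // rP.
have rD := relevant_dec_ge pP rP hP dP.
(* In the case of equality the chain of length 0 suffices; [relevant_section] asks for a strict
   inequality. *)
have [rD1|rD1] := eqVneq r D.+1.
  by split=> //; rewrite -rD1 subnn; apply: chain_from0.
have {}rD : (r < D.+1)%N by rewrite ltn_neqAle rD1.
split; first exact: ltnW.
(* Cutting by [x] may leave only irrelevant primes in the top dimension. An element of degree (1,
   ..., 1) relates consecutive points of the diagonal. *)
have [z Bz1 nz] := relevant_monomial [multinom 1 | _ < r] (gprime_iprime pP) rP.
have {}Bz1 : Bz (diag 1) z.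
  by have -> : diag 1 = gradeN [multinom 1 | _ < r]; [apply/ffunP => j; rewrite !ffunE mnmE|].
have [L' fL' L'P] := section_filtration pP Bz1 nz.
have ciP : chain_from iprime P D.+1 by apply: chain_from_homo cP; exact: gprime_iprime.
have [|p [pL rp Dp]] := @relevant_section P D.+1 z L' dim pP rP hP ciP rD Bz1 nz fL'.
  by move=> p /L'P[pp Pp]; split=> //; exact: dimP.
have [pp Pp] := L'P p pL; have [hp dp cp relp] := dimP _ pp Pp.
have [rdim crel] := relp rp.
have -> : (D.+1 - r)%N = (D - r).+1 by rewrite subSn.
apply: (chain_from_cons (Q := p.1)) => //.
by apply: chain_from_le crel; apply: leq_sub2r.
Qed.

End PrimeIdeals.

(** * Torsion *)

Lemma iprimeP (A : comNzRingType) (B : comAlgType A) (P : set B) : is_prime P <-> iprime P.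
Proof.
split=> [[[P0 P1 PD] PM]|[[P0 PD] P1 PM]].
  split; first split.
  - exact/set_mem.
  - by move=> a x y Px Py; apply: set_mem; apply: PD; exact: mem_set.
  - by move=> /mem_set; exact/negP.
  - by move=> a b /mem_set /PM /orP[] /set_mem; [left|right].
split; first split.
- exact/mem_set.
- by apply/negP => /set_mem.
- by move=> a u v /set_mem Pu /set_mem Pv; apply/mem_set; exact: PD.
- by move=> u v /set_mem /PM[] Pu; apply/orP; [left|right]; exact/mem_set.
Qed.

Section ShiftedGrading.
Variables (A : comNzRingType) (B : comAlgType A) (r : nat) (Bg : 'X_{1..r} -> set B).
Hypothesis gBg : graded_ring Bg.
Hypothesis Bg0 : Bg 0%MM = range (in_alg B).
Let Bz := extend_grading Bg.
Let dBg : direct_sum Bg. Proof. by case: gBg. Qed.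
Let Bg_0 n : Bg n 0. Proof. exact: (dsum0 dBg). Qed.

Lemma shift_graded_alg : graded_alg Bz.
Proof.
have [_ Bg1 BgM] := gBg; split.
- exact: direct_sum_shift.
- by move=> a; right; exists 0%MM; [rewrite gradeN0|rewrite Bg0; exists a].
- move=> b [->|[n n0 Bb]]; first by exists 0; rewrite rmorph0.
  have {n0} n0 : n = 0%MM by apply: gradeN_inj; rewrite -n0 gradeN0.
  by move: Bb; rewrite n0 Bg0 => -[a _ <-]; exists a.
- move=> mu nu a b [->|[k -> Ba]] => [_|[->|[l -> Bb]]].
  + by left; rewrite mul0r.
  + by left; rewrite mulr0.
  + by right; exists (k + l)%MM; [rewrite gradeND|exact: BgM].
- exact: extend_grading_pos.
Qed.

Lemma shift_graded_mod (M : lmodType B) (Mg : grade r -> set M) :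
  graded_module Bg Mg -> graded_mod Bz Mg.
Proof.
move=> [dM act]; split=> // mu nu b x [->|[n -> Bb]] Mx.
  by rewrite scale0r; exact: (dsum0 dM).
exact: act.
Qed.

Lemma homogeneousP (P : set B) : P 0 -> homogeneous Bg P <-> gclosed Bz P.
Proof.
move=> P0; split=> [hP nu b Pb|gP s f us Bf Ps n ns].
  have [nu0|/existsNP[i nui]] := pselect (forall i, 0 <= nu i); last first.
    rewrite (galg_comp_neg shift_graded_alg) //; exists i.
    by rewrite ltNge; exact/negP.
  rewrite -(grade_absK nu0) gcomp_shift //.
  have [s [us Bs b0 bE]] := gcompP dBg b.
  have [ns|/b0->//] := boolP (grade_abs nu \in s).
  by apply: (hP s (fun n => gcomp Bg n b)) => //; rewrite -bE.
have := gP (gradeN n) _ Ps; rewrite gcomp_shift // (gcomp_sum dBg).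
rewrite (bigD1_seq n) //= (gcomp_id dBg (Bf n)) big1 ?addr0 // => k kn.
by rewrite (gcomp_homog dBg _ (Bf k)) eq_sym (negbTE kn).
Qed.

Lemma irrelevant_homog (nu : grade r) b : Bz nu b -> (forall i, 0 < nu i) -> irrelevant Bg b.
Proof.
case=> [-> _|[n -> Bb] n0].
  by exists [::], (fun=> 0); split=> //; rewrite big_nil.
exists [:: n], (fun k => if k == n then b else 0); split.
- by move=> k; rewrite inE => /eqP -> i; have := n0 i; rewrite ffunE.
- by move=> k; case: eqP => [->|].
- by rewrite big_seq1 eqxx.
Qed.

Lemma irrelevant_sum b : irrelevant Bg b -> exists (s : seq 'X_{1..r}) (f : 'X_{1..r} -> B),
  (forall n, n \in s -> forall i, (0 < gradeN n i)%R) /\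
  ((forall n, Bz (gradeN n) (f n)) /\ b = \sum_(n <- s) f n).
Proof.
move=> [s [f [s0 Bf ->]]]; exists s, f; split; last split=> //.
  by move=> n /s0 n0 i; rewrite ffunE; exact: n0.
by move=> n; right; exists n.
Qed.

Lemma irrelevant_ind (K : set B) b : irrelevant Bg b -> K 0 ->
  (forall x y, K x -> K y -> K (x + y)) ->
  (forall nu x, Bz nu x -> (forall i, 0 < nu i) -> K x) -> K b.
Proof.
move=> /irrelevant_sum[s [f [s0 [Bf ->]]]] K0 KD Kh.
rewrite big_seq; elim/big_rec: _ => // n x ns Kx; apply: KD => //.
by apply: (Kh (gradeN n)) => //; exact: s0.
Qed.

End ShiftedGrading.

Section Torsion.
Variables (A : comNzRingType) (B : comAlgType A) (r : nat) (Bg : 'X_{1..r} -> set B).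
Hypothesis gBg : graded_ring Bg.
Hypothesis Bg0 : Bg 0%MM = range (in_alg B).
Let Bz := extend_grading Bg.
Let gB : graded_alg Bz := shift_graded_alg gBg Bg0.
Let dB := galg_dsum gB.
Hypothesis nB : noetherian B.
Variable s : seq B.
Hypothesis s_deg : forall b, b \in s -> exists i : 'I_r, Bz (gradeN U_(i)%MM) b.
Hypothesis s_ind : forall K : set B, (forall a, K (in_alg B a)) ->
  (forall x y, K x -> K y -> K (x + y)) -> (forall x y, K x -> K y -> K (x * y)) ->
  (forall x, x \in s -> K x) -> forall b, K b.
Variables (M : lmodType B) (Mg : grade r -> set M).
Hypothesis gM : graded_mod Bz Mg.
Hypothesis fgM : fin_gen M.
Let dM := gmod_dsum gM.
Implicit Types (x y z : M) (nu mu : grade r).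

(** Killing by products of [k] elements of N, imposed one factor at a time so that inductions on [k]
    go through. *)
Fixpoint annihilated (k : nat) x : Prop :=
  if k is k'.+1 then forall c, irrelevant Bg c -> annihilated k' (c *: x) else x = 0.

Lemma kills_powE k x : kills_pow Bg k x <-> annihilated k x.
Proof.
elim: k x => [|k IH] x.
  split=> [/(_ [tuple])|/= -> t _]; rewrite ?big_ord0 ?scale1r ?scaler0 //.
  by apply => -[].
split=> [kx c Nc|nx t Nt].
  apply/IH => t Nt; rewrite scalerA mulrC.
  have := kx [tuple of c :: t]; rewrite big_ord_recl.
  under eq_bigr do rewrite tnthS.
  by apply => i; case: (unliftP ord0 i) => [j ->|->]; rewrite ?tnthS ?tnth0.
rewrite big_ord_recl mulrC -scalerA.
have /IH := nx _ (Nt ord0) => /(_ (behead_tuple t)) h.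
have e (i : 'I_k) : tnth (behead_tuple t) i = tnth t (lift ord0 i).
  by rewrite tnth_behead; congr tnth; apply/val_inj; rewrite /= inordK // ltnS.
rewrite (eq_bigr (fun i => tnth (behead_tuple t) i)); last by move=> i _; rewrite e.
by apply: h => i; rewrite e.
Qed.

Lemma annihilatedD k x y : annihilated k x -> annihilated k y -> annihilated k (x + y).
Proof.
elim: k x y => [|k IH] x y /=; first by move=> -> ->; rewrite addr0.
by move=> nx ny c Nc; rewrite scalerDr; apply: IH; [exact: nx|exact: ny].
Qed.

Lemma annihilated0 k : annihilated k (0 : M).
Proof. by elim: k => //= k IH c _; rewrite scaler0. Qed.

(** It suffices to test homogeneous elements of N, and multiplication by these commutes with taking
    components, up to a shift. *)
Lemma annihilated_comp k x nu : annihilated k x -> annihilated k (gcomp Mg nu x).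
Proof.
elim: k x nu => [|k IH] x nu /=; first by move=> ->; rewrite (gcomp0 dM).
move=> nx c Nc.
apply: (irrelevant_ind (K := [set c | annihilated k (c *: gcomp Mg nu x)]) Nc) => /=.
- by rewrite scale0r; exact: annihilated0.
- by move=> a b na nb; rewrite scalerDl; exact: annihilatedD.
- move=> mu b Bb mu0; rewrite -[nu](addrK mu) -(gcompZr gM _ x Bb).
  by apply: IH; apply: nx; exact: (irrelevant_homog gBg Bb mu0).
Qed.

Definition torsion : set M := [set x : M | H0 Bg x].

Lemma torsionP x : torsion x <-> exists k, annihilated k x.
Proof.
by split=> [/asboolP[k /kills_powE]|[k /kills_powE kx]]; [exists k|apply/asboolP; exists k].
Qed.

Lemma torsion_Bsub : is_Bsubmodule torsion.
Proof. by have [t0 tD] := H0_submod_closed Bg M; split=> // b x y; exact: tD. Qed.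

Lemma torsion_gclosed : gclosed Mg torsion.
Proof.
by move=> nu x /torsionP[k nx]; apply/torsionP; exists k; exact: annihilated_comp.
Qed.

Lemma annihilated_expr k x c : irrelevant Bg c -> annihilated k x -> c ^+ k *: x = 0.
Proof.
move=> Nc; elim: k x => [|k IH] x /=; first by move=> ->; rewrite scaler0.
by move=> nx; rewrite exprSr -scalerA; apply: IH; exact: nx.
Qed.

Lemma relevant_elt P : iprime P -> relevant Bz P -> exists2 c, irrelevant Bg c & ~ P c.
Proof.
move=> pP rP; have [z Bzz nz] := relevant_monomial gB [multinom 1 | _ < r] pP rP.
by exists z => //; apply: (irrelevant_homog gBg Bzz ) => i; rewrite ffunE mnmE.
Qed.

Lemma irrelevant_sub P : is_ideal P -> gclosed Bz P -> ~ relevant Bz P -> irrelevant Bg `<=` P.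
Proof.
move=> iP gP nr c Nc; have [i Pi] := irrelevantP gB s_deg s_ind iP gP nr.
apply: (irrelevant_ind Nc); first exact: ideal0.
  by move=> *; exact: idealD.
by move=> nu b Bb nu0; exact: Pi Bb.
Qed.

(** In a quotient B/P with [P] relevant, a torsion element is killed by a power of some [c] outside
    [P], hence is zero. If [P] is irrelevant, B/P vanishes in degrees with positive entries, such as
    nu minus the shift. *)
Lemma pfilt_torsion (U V : set M) L nu : is_Bsubmodule U -> gclosed Mg U ->
  pfilt Bz Mg U V L -> (forall p, List.In p L -> forall i, p.2 i < nu i) ->
  forall x, V x -> Mg nu x -> torsion x -> U x.
Proof.
move=> sU gU; elim=> [//|V' L' y a fL IH My pV] hnu x [b Vx] Mx tx.
have [sV gV UV] := pfilt_sub gB gM sU gU fL.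
apply: IH => //; first by move=> p pL; apply: hnu; right.
have [iP P1 PM gP] := pV.
pose b' := gcomp Bz (nu - a) b.
have Vx' : V' (x - b' *: y).
  by rewrite -(gcompZl gB gM nu b My) -{1}(gcomp_id dM Mx) -(gcompB dM); exact: gV.
suff Pb' : colon V' y b' by rewrite -(subrK (b' *: y) x); exact: BsubD.
have [rP|nrP] := pselect (relevant Bz (colon V' y)); last first.
  apply: (irrelevant_sub iP gP nrP); apply: (irrelevant_homog gBg (gcomp_in dB _ _)) => i.
  by have := hnu _ (or_introl erefl) i; rewrite !ffunE subr_gt0.
have pP := gprime_iprime pV.
have [c Nc nPc] := relevant_elt pP rP.
have /torsionP[k kx] := tx.
suff : colon V' y (c ^+ k * b') by move=> /PM[/(iprime_expr pP)|].
rewrite /colon /= -scalerA -[b' *: y](subKr x) scalerBr (annihilated_expr Nc kx) sub0r.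
by apply: BsubN => //; exact: BsubZ.
Qed.

Lemma torsion_large : exists nu0 : grade r, forall nu, (forall i, nu0 i <= nu i) ->
  forall x, Mg nu x -> torsion x -> x = 0.
Proof.
have s0 := @Bsub_zero B M; have g0 : gclosed Mg [set 0] by exact: gclosed_zero.
have [L fL] := pfilt_exists gB gM nB fgM s0 g0.
have [nu0 h] : for_large [set nu : grade r | forall p, List.In p L -> forall i, p.2 i < nu i].
  apply: (for_large_all (P := fun (p : set B * grade r) nu => forall i, p.2 i < nu i)) => p _.
  exists (p.2 + [ffun=> 1]) => nu h i; have := h i; rewrite !ffunE.
  by move: (p.2 i) (nu i) => u v; lia.
by exists nu0 => nu /h hnu x Mx tx; exact: (pfilt_torsion s0 g0 fL hnu).
Qed.

(** The exponent killing c x has to be uniform in [c]. It depends only on the degree: [k]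
    homogeneous factors from N raise it by at least [k] in every direction, and torsion vanishes in
    large degrees. *)
Lemma torsion_saturated x : (forall c, irrelevant Bg c -> torsion (c *: x)) -> torsion x.
Proof.
move=> tx; have [nu0 nu0P] := torsion_large; have sT := torsion_Bsub.
have deep (k : nat) z mu : Mg mu z -> torsion z -> (forall i, nu0 i <= mu i + k%:Z) ->
    annihilated k z.
  elim: k z mu => [|k IH] z mu Mz tz le /=.
    by apply: (nu0P mu) => // i; have := le i; rewrite addr0.
  move=> c Nc; apply: (irrelevant_ind (K := [set c | annihilated k (c *: z)]) Nc) => /=.
  - by rewrite scale0r; exact: annihilated0.
  - by move=> a b na nb; rewrite scalerDl; exact: annihilatedD.
  - move=> nu b Bb nupos; apply: (IH _ (nu + mu)); first exact: (gmod_act gM).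
      exact: BsubZ.
    move=> i; have := le i; have := nupos i; rewrite !ffunE.
    by move: (nu i) (mu i) (nu0 i) => u v w; lia.
apply: (gcomp_closed_mem dM (U := torsion)); first exact: Bsub0.
  by move=> *; exact: BsubD.
move=> mu; set y := gcomp Mg mu x.
have ty c nu : Bz nu c -> (forall i, 0 < nu i) -> torsion (c *: y).
  move=> Bc nupos; rewrite /y -[mu](addrK nu) -(gcompZr gM _ x Bc).
  by apply: torsion_gclosed; apply: tx; exact: (irrelevant_homog gBg Bc nupos).
(* This [k] is at least nu0_i - mu_i for every i; the extra factor in [k.+1] brings [y] into the
   torsion. *)
pose k := (\sum_(i < r) `|nu0 i - mu i|)%N.
apply/torsionP; exists k.+1 => c Nc.
apply: (irrelevant_ind (K := [set c | annihilated k (c *: y)]) Nc) => /=.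
- by rewrite scale0r; exact: annihilated0.
- by move=> a b na nb; rewrite scalerDl; exact: annihilatedD.
- move=> nu b Bb nupos; apply: (deep _ _ (nu + mu)).
  + by apply: (gmod_act gM) => //; exact: (gcomp_in dM).
  + exact: ty Bb nupos.
  move=> i; have le : (`|nu0 i - mu i| <= k)%N by rewrite /k (bigD1 i) //= leq_addr.
  move: le (nupos i); rewrite !ffunE; move: (k) (nu i) (mu i) (nu0 i) => k' u v w.
  by lia.
Qed.

End Torsion.

(** * Dimensions and multiplicities *)

Section LaurentNumerators.
Variable r : nat.
Implicit Types (n : 'X_{1..r}) (nu : grade r) (ts : seq (term r)).

Lemma mem_mnm_of_deg (D : nat) n : (n \in mnm_of_deg r D%:Z%:E) = (mdeg n == D).
Proof.
apply/mapP/eqP => [[k]|nD]; first by rewrite mem_filter => /andP[/eqP[kD] _] ->.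
have nlt : (mdeg n < `|fine (D%:Z%:E : \bar int)|.+1)%N by rewrite /= nD.
by exists (BMultinom nlt) => //; rewrite mem_filter mem_enum /= nD eqxx.
Qed.

Lemma mnm_of_deg_uniq d : uniq (mnm_of_deg r d).
Proof.
rewrite map_inj_uniq; last by move=> x y /val_inj.
by apply: filter_uniq; exact: enum_uniq.
Qed.

Lemma mnm_of_degNy : mnm_of_deg r -oo%E = [::].
Proof. by rewrite /mnm_of_deg (eq_filter (a2 := pred0)) ?filter_pred0. Qed.

Lemma big_fibers (V : nmodType) (T : eqType) (K : eqType) (N : seq K) (ts : seq T)
    (key : T -> K) (F : T -> V) : uniq N -> (forall t, t \in ts -> key t \in N) ->
  \sum_(n <- N) \sum_(t <- ts | key t == n) F t = \sum_(t <- ts) F t.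
Proof.
move=> uN tN; rewrite (exchange_big_dep predT) //= big_seq [RHS]big_seq.
apply: eq_bigr => t tt; rewrite (eq_bigl (pred1 (key t))); last by move=> k; rewrite /= eq_sym.
by rewrite -big_filter filter_pred1_uniq ?tN // big_seq1.
Qed.

Definition laurent_of ts n : laurent r :=
  collect [seq (t.1.1, t.1.2) | t <- ts & t.2 == n].

Lemma laurent_of_at1 ts n : laurent_at1 (laurent_of ts n) = terms_mult ts n.
Proof.
have := collect_sum (V := int^o) (fun=> 1) [seq (t.1.1, t.1.2) | t <- ts & t.2 == n].
rewrite big_map big_filter /laurent_at1 /terms_mult => e.
rewrite -[RHS](eq_bigr _ (fun t _ => mulr1 t.1.1)) -[RHS]e.
by apply: eq_bigr => a _; rewrite -[LHS]mulr1.
Qed.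

Lemma laurent_of_val ts D nu : (forall t, t \in ts -> mdeg t.2 = D) ->
  terms_val ts nu = \sum_(n <- mnm_of_deg r D%:Z%:E) \sum_(a <- finsupp (laurent_of ts n))
    laurent_of ts n a * (\prod_(i < r) pole_coef (n i) (nu i - a i))%:Z.
Proof.
move=> tD; rewrite /terms_val.
rewrite -(big_fibers (key := snd) _ (mnm_of_deg_uniq D%:Z%:E)); last first.
  by move=> t /tD tDt; rewrite mem_mnm_of_deg tDt.
apply: eq_bigr => n _.
have := @collect_sum int (grade r) int^o
  (fun a : grade r => (\prod_(i < r) pole_coef (n i) (nu i - a i))%:Z)
  [seq (t.1.1, t.1.2) | t <- ts & t.2 == n].
rewrite big_map big_filter => e; rewrite [RHS]e; apply: eq_bigr => t /eqP <-.
by congr (_ * _); rewrite /pole; congr Posz; apply: eq_bigr => i _; rewrite !ffunE.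
Qed.

Definition terms_of (N : seq 'X_{1..r}) (Q : 'X_{1..r} -> laurent r) : seq (term r) :=
  [seq (Q n a, a, n) | n <- N, a <- (finsupp (Q n) : seq (grade r))].

Lemma terms_of_val N Q nu : terms_val (terms_of N Q) nu =
  \sum_(n <- N) \sum_(a <- finsupp (Q n))
    Q n a * (\prod_(i < r) pole_coef (n i) (nu i - a i))%:Z.
Proof.
rewrite /terms_val big_allpairs_dep; apply: eq_bigr => n _; apply: eq_bigr => a _ /=.
by congr (_ * _); rewrite /pole; congr Posz; apply: eq_bigr => i _; rewrite !ffunE.
Qed.

Lemma terms_of_mult N Q n : uniq N -> n \in N -> terms_mult (terms_of N Q) n = laurent_at1 (Q n).
Proof.
move=> uN nN; rewrite /terms_mult big_mkcond big_allpairs_dep /=.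
rewrite (bigD1_seq n) //= eqxx [X in _ + X]big1 ?addr0 // => k /negbTE kn.
by rewrite big1 // => a _; rewrite kn.
Qed.

Lemma terms_of_deg N Q D : (forall n, n \in N -> mdeg n = D) ->
  forall t, t \in terms_of N Q -> mdeg t.2 = D.
Proof. by move=> ND t /allpairsPdep[n [a [nN _ ->]]]; exact: ND. Qed.

End LaurentNumerators.

Section Dimensions.
Variables (A : comNzRingType) (m : set A).
Hypothesis mU : forall a, ~ m a -> exists b, a * b = 1.
Hypothesis mnil : forall a, m a -> exists n, a ^+ n = 0.
Variables (B : comAlgType A) (r : nat) (Bg : 'X_{1..r} -> set B).
Hypothesis r0 : (0 < r)%N.
Hypothesis gBg : graded_ring Bg.
Hypothesis Bg0 : Bg 0%MM = range (in_alg B).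
Let Bz := extend_grading Bg.
Let gB : graded_alg Bz := shift_graded_alg gBg Bg0.
Let dB := galg_dsum gB.
Hypothesis nB : noetherian B.
Variable s : seq B.
Hypothesis s_deg : forall b, b \in s -> exists i : 'I_r, Bz (gradeN U_(i)%MM) b.
Hypothesis s_ind : forall K : set B, (forall a, K (in_alg B a)) ->
  (forall x y, K x -> K y -> K (x + y)) -> (forall x y, K x -> K y -> K (x * y)) ->
  (forall x, x \in s -> K x) -> forall b, K b.
Variables (M : lmodType B) (Mg : grade r -> set M).
Hypothesis gM : graded_mod Bz Mg.
Hypothesis fgM : fin_gen M.
Let dM := gmod_dsum gM.
Local Notation tors := (@torsion A B r Bg M).
Local Notation E := (modH0 Bg M).
Local Notation Eg := (modH0_grading Bg Mg).

Definition ann (N : lmodType B) : set B := [set b | forall x : N, b *: x = 0].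

Definition torsion_pi (x : M) : E := @quotmod_pi _ _ (@H0 A B r Bg M) x.

Lemma torsion_pi0 x : torsion_pi x = 0 <-> tors x.
Proof.
have -> : 0 = torsion_pi 0 by rewrite /torsion_pi /quotmod_pi raddf0.
by split=> [/quotmod_piE|tx]; [|apply/quotmod_piE]; rewrite subr0.
Qed.

Lemma torsion_piZD b x y : torsion_pi (b *: x + y) = b *: torsion_pi x + torsion_pi y.
Proof. by rewrite /torsion_pi quotmod_piD -quotmod_piZ. Qed.

Lemma torsion_piZ b x : torsion_pi (b *: x) = b *: torsion_pi x.
Proof. by rewrite /torsion_pi -quotmod_piZ. Qed.

Lemma torsion_pi_surj (e : E) : exists x, e = torsion_pi x.
Proof. by exists (repr (e : Quotient.quot _)); rewrite /torsion_pi quotmod_reprK. Qed.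

Lemma ann_modH0 b : ann E b <-> forall x, tors (b *: x).
Proof.
split=> [bE x|bt e]; first by apply/torsion_pi0; rewrite torsion_piZ.
by have [x ->] := torsion_pi_surj e; rewrite -torsion_piZ; apply/torsion_pi0.
Qed.

Variable L : seq (set B * grade r).
Hypothesis fL : pfilt Bz Mg tors setT L.

Let sT := torsion_Bsub Bg M.
Let gT : gclosed Mg tors := torsion_gclosed gBg gM.

Lemma pfilt_ann_sub p : List.In p L -> ann E `<=` p.1.
Proof.
move=> pL b /ann_modH0 bt; apply: (pfilt_ann gB gM sT gT fL pL) => v _.
exact: bt.
Qed.

Lemma pfilt_gprime p : List.In p L -> gprime Bz p.1.
Proof. exact: pfilt_prime fL. Qed.

(* A product of elements of the relevant primes of the filtration kills M/H^0
   because H^0 is saturated, which takes care of the irrelevant ones. *)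
Lemma prime_over_relevant (Q : set B) : iprime Q -> ann E `<=` Q ->
  exists p, [/\ List.In p L, relevant Bz p.1 & p.1 `<=` Q].
Proof.
move=> [iQ Q1 QM] annQ; apply: contrapT => nex.
have sub p : List.In p L -> relevant Bz p.1 -> exists2 c, p.1 c & ~ Q c.
  move=> pL rp; apply: contrapT => nc; apply: nex; exists p; split=> // c pc.
  by apply: contrapT => nQc; apply: nc; exists c.
have [b nQb bt] : exists2 b, ~ Q b & forall v, [set: M] v -> tors (b *: v).
  elim: fL sub => [|V L' y a fL' IH My pV] sub.
    exists 1; first exact: Q1.
    by move=> v tv; rewrite scale1r.
  have [sV gV UV] := pfilt_sub gB gM sT gT fL'.
  have [b nQb bt] : exists2 b, ~ Q b & forall v, V v -> tors (b *: v).
    by apply: IH => p pL; apply: sub; right.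
  have [iP P1 PM gP] := pV.
  have [rP|nrP] := pselect (relevant Bz (colon V y)).
    have [c Pc nQc] := sub _ (or_introl erefl) rP.
    exists (b * c); first by move=> /QM [].
    move=> v [d Vv]; rewrite -scalerA; apply: bt.
    rewrite -(subrK (d *: y) v) scalerDr; apply: BsubD => //; first exact: BsubZ.
    by rewrite scalerA mulrC -scalerA; exact: BsubZ.
  (* For an irrelevant prime, N carries [v] into [V]; hence N b v is torsion, and by saturation so
     is b v. *)
  exists b => // v [d Vv]; apply: (torsion_saturated gBg Bg0 nB s_deg s_ind gM fgM) => c Nc.
  rewrite scalerA mulrC -scalerA; apply: bt.
  rewrite -(subrK (d *: y) v) scalerDr; apply: BsubD => //; first exact: BsubZ.
  rewrite scalerA mulrC -scalerA; apply: BsubZ => //.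
  exact: (irrelevant_sub gBg Bg0 s_deg s_ind iP gP nrP Nc).
by apply: nQb; apply: annQ; apply/ann_modH0 => x; exact: bt.
Qed.

(** If every generator of [M] is killed by some element outside [Q], the product of these elements
    kills [M] and is still outside [Q]. *)
Lemma support_ann (Q : set B) : iprime Q -> Defs.support M Q <-> ann M `<=` Q.
Proof.
move=> pQ; have [iQ Q1 QM] := pQ; split=> [[_ [x xQ]] b bM|aQ].
  by apply: contrapT => /xQ; apply; exact: bM.
split; first exact/iprimeP.
apply: contrapT => nx; have [g gP] := fgM.
have ex (x : M) : exists2 b, ~ Q b & b *: x = 0.
  apply: contrapT => nb; apply: nx; exists x => b nQb bx; apply: nb; by exists b.
have [b nQb bg] : exists2 b, ~ Q b & forall x, x \in g -> b *: x = 0.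
  elim: (g) => [|x g' [b nQb bg]]; first by exists 1.
  have [c nQc cx] := ex x; exists (b * c); first by move=> /QM [].
  move=> y; rewrite inE => /predU1P[->|/bg e]; first by rewrite -scalerA cx scaler0.
  by rewrite mulrC -scalerA e scaler0.
apply: nQb; apply: aQ => x; have [c ->] := gP x.
rewrite scaler_sumr big1 // => i _; rewrite scalerA mulrC -scalerA bg ?scaler0 //.
exact: mem_nth.
Qed.

(** If [b] kills M/H^0 and [c] in N lies outside [Q], some c^k b kills the generators of [M]; and
    [Q] contains [b] as soon as it contains c^k b. *)
Lemma relevant_ann (Q : set B) : iprime Q -> relevant Bz Q -> ann M `<=` Q <-> ann E `<=` Q.
Proof.
move=> pQ rQ; have [iQ Q1 QM] := pQ; split=> [aM b|aE b bM]; last first.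
  by apply: aE; apply/ann_modH0 => x; rewrite bM; exact: Bsub0.
move/ann_modH0 => bt; have [c Nc nQc] := relevant_elt gBg Bg0 pQ rQ.
have [g gP] := fgM.
have [k kg] : exists k, forall x, x \in g -> c ^+ k *: (b *: x) = 0.
  elim: (g) => [|x g' [k kg]]; first by exists 0%N.
  have /torsionP[l lx] := bt x; exists (k + l)%N => y; rewrite exprD.
  rewrite inE => /predU1P[->|/kg e]; first by rewrite -scalerA (annihilated_expr Nc lx) scaler0.
  by rewrite mulrC -scalerA e scaler0.
have : Q (c ^+ k * b); last by move/QM => [/(iprime_expr pQ)|].
apply: aM => x; have [d ->] := gP x.
rewrite scaler_sumr big1 // => i _.
by rewrite scalerA mulrC -scalerA -[X in _ *: X]scalerA kg ?scaler0 //; exact: mem_nth.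
Qed.

Lemma MultiProjP (Q : set B) : MultiProj Bg Q <-> relevant_gprime Bz Q.
Proof.
split=> [[/iprimeP pQ hQ nN]|[pQ rQ]].
  have [iQ Q1 QM] := pQ; have gQ : gclosed Bz Q.
    by apply/(homogeneousP gBg Bg0) => //; exact: ideal0.
  split; first by split.
  apply: contrapT => nr; apply: nN.
  exact: (irrelevant_sub gBg Bg0 s_deg s_ind iQ gQ nr).
have [iQ Q1 QM gQ] := pQ; have piQ := gprime_iprime pQ; split.
- exact/iprimeP.
- by apply/(homogeneousP gBg Bg0) => //; exact: ideal0.
- by move=> sub; have [c /sub Qc nQc] := relevant_elt gBg Bg0 piQ rQ.
Qed.

Lemma support_ppP (Q : set B) : support_pp M Bg Q <-> relevant_gprime Bz Q /\ ann E `<=` Q.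
Proof.
split=> [[sQ /MultiProjP[pQ rQ]]|[[pQ rQ] aQ]].
  have piQ := gprime_iprime pQ; split; first by split.
  by apply/(relevant_ann piQ rQ)/support_ann.
have piQ := gprime_iprime pQ; split; last exact/MultiProjP.
by apply/(support_ann piQ)/(relevant_ann piQ rQ).
Qed.

Definition pdim (P : set B) : nat := xget 0%N [set d | is_dimension m Bz P d].

Lemma pdimP P : gprime Bz P -> is_dimension m Bz P (pdim P).
Proof.
move=> pP; have [d dP] := gprime_dimension mU mnil gB nB s_deg s_ind r0 pP.
by rewrite /pdim; case: xgetP => [e _ //|/(_ d)].
Qed.

Lemma chain_from_sub (T : Type) (K : set T -> Prop) P Q k :
  K P -> P `<=` Q -> chain_from K Q k -> chain_from K P k.
Proof.
move=> KP PQ [S [S0 SK SS]]; exists (fun i => if i is j.+1 then S j.+1 else P).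
split=> // -[|i] //= ik; [exact: SK|split|exact: SS].
  apply: subset_trans PQ _; rewrite -S0; exact: (SS 0%N ik).1.
move=> sub; apply: (SS 0%N ik).2; apply: subset_trans sub _; by rewrite S0.
Qed.

Lemma iprime_chain_le P k : gprime Bz P -> chain_from (@iprime A B) P k -> (k <= pdim P)%N.
Proof. by move=> pP; apply: (is_dimension_growth mU gB pP); exact: pdimP. Qed.

(** The last prime of the chain has dimension at least [r], and each step down raises the dimension
    by at least one. *)
Lemma relevant_chain_le P k : chain_from (relevant_gprime Bz) P k -> (k + r <= pdim P)%N.
Proof.
elim: k P => [|k IH] P.
  move=> /chain_from_head[pP rP]; have [_ _ _ rel] := pdimP pP.
  by have [] := rel rP.
move=> /chain_fromS[Q [[pP rP] PQ] cQ]; have [pQ rQ] := chain_from_head cQ.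
apply: leq_ltn_trans (IH _ cQ) _; have [_ _ cdQ _] := pdimP pQ.
apply: iprime_chain_le => //; apply: (chain_from_cons (gprime_iprime pP) PQ).
by apply: chain_from_homo cdQ; exact: gprime_iprime.
Qed.

Lemma pdim_le P Q : gprime Bz P -> gprime Bz Q -> P `<=` Q -> (pdim Q <= pdim P)%N.
Proof.
move=> pP pQ PQ; have [_ _ cQ _] := pdimP pQ; apply: iprime_chain_le => //.
apply: (chain_from_sub (gprime_iprime pP) PQ).
by apply: chain_from_homo cQ; exact: gprime_iprime.
Qed.

(** The maximum over the relevant primes bounds the others too, because each prime of the filtration
    contains a relevant one, by [prime_over_relevant] applied to that prime itself. *)
Lemma relevant_maximal : (exists2 p, List.In p L & relevant Bz p.1) ->
  exists p0, [/\ List.In p0 L, relevant Bz p0.1 &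
    forall p, List.In p L -> (pdim p.1 <= pdim p0.1)%N].
Proof.
move=> [p1 p1L rp1].
have [p0 [p0L rp0 p0max]] : exists p0, [/\ List.In p0 L, relevant Bz p0.1 &
    forall p, List.In p L -> relevant Bz p.1 -> (pdim p.1 <= pdim p0.1)%N].
  elim: (L) p1 p1L rp1 => [//|q L' IH] p1 p1L rp1.
  have [[p pL rp]|nex] := pselect (exists2 p, List.In p L' & relevant Bz p.1); last first.
    have qp1 : q = p1 by case: p1L => // p1L; case: nex; exists p1.
    exists p1; split=> //; move=> p [<-|pL rp]; first by rewrite qp1.
    by case: nex; exists p.
  have [p0 [p0L rp0 p0max]] := IH p pL rp.
  have [[rq lt]|nq] := pselect (relevant Bz q.1 /\ (pdim p0.1 <= pdim q.1)%N).
    exists q; split=> //; first by left.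
    by move=> u [<-//|uL ru]; apply: leq_trans lt; exact: p0max.
  exists p0; split=> //; first by right.
  move=> u [<- ru|//]; last exact: p0max.
  by apply: ltnW; rewrite ltnNge; apply/negP => le; apply: nq.
exists p0; split=> // p pL; have pp := pfilt_gprime pL.
have [q [qL rq qp]] := prime_over_relevant (gprime_iprime pp) (pfilt_ann_sub pL).
by apply: leq_trans (p0max q qL rq); apply: pdim_le => //; exact: pfilt_gprime.
Qed.

(** A longest graded chain above [p0] attains the value. The lowest prime of any competing chain
    contains a prime of the filtration, which can replace it. *)
Lemma krull_dimE p0 : List.In p0 L -> (forall p, List.In p L -> (pdim p.1 <= pdim p0.1)%N) ->
  krull_dim E = (pdim p0.1)%:Z%:E.
Proof.
move=> p0L p0max; have pp0 := pfilt_gprime p0L; apply: sup_nat_max.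
  have [_ _ [S [S0 SK SS]] _] := pdimP pp0; exists S; split=> // i ip.
  have pS := SK i ip; split; first by apply/iprimeP; exact: (gprime_iprime pS).
  apply: subset_trans (pfilt_ann_sub p0L) _; rewrite -S0.
  elim: i ip {pS} => [|i IH] ip //. apply: subset_trans (IH (ltnW ip)) _.
  by case: (SS i ip).
move=> n [S [SK SS]]; have [/iprimeP pS aS] := SK 0%N isT.
have [p [pL rp pS0]] := prime_over_relevant pS aS.
apply: leq_trans (p0max p pL); apply: iprime_chain_le; first exact: pfilt_gprime.
apply: (chain_from_sub (gprime_iprime (pfilt_gprime pL)) pS0).
by exists S; split=> // i /SK[/iprimeP].
Qed.

(** The intersection of the members of [Z] is its generic point: if it contains ab, then [Z] is
    covered by the closed sets defined by a and by b, hence lies in one of them. *)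
Lemma irreducible_generic (X : set (set B)) (Z : set (set B)) :
  (forall P, X P -> relevant_gprime Bz P /\ ann E `<=` P) ->
  zariski X Z -> irreducible (zariski X) Z ->
  relevant_gprime Bz [set b | forall P, Z P -> P b] /\
  (ann E `<=` [set b | forall P, Z P -> P b]).
Proof.
move=> XP [S _ ZE] [[P0 ZP0] Zirr].
have ZX P : Z P -> X P by rewrite -ZE => -[].
have [[pP0 rP0] aP0] := XP _ (ZX _ ZP0).
split; last by move=> b bE P /ZX /XP[_]; apply.
split; last first.
  by move=> i; have [x Bx nx] := rP0 i; exists x => //; move=> /(_ _ ZP0).
split.
- split; first by move=> P /ZX /XP[[[iP _ _ _] _] _]; exact: ideal0.
  move=> a x y hx hy P ZP; have [[[iP _ _ _] _] _] := XP _ (ZX _ ZP).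
  by case: iP => _; apply; [exact: hx|exact: hy].
- by move=> /(_ _ ZP0); case: pP0.
- move=> a b hab.
  pose V c := X `&` [set P | [set c] `<=` P].
  have [|||Za|Zb] := Zirr (V a) (V b).
  + by exists [set a].
  + by exists [set b].
  + move=> P ZP; have [[[_ _ PM _] _] _] := XP _ (ZX _ ZP).
    by case: (PM _ _ (hab P ZP)) => Pc; [left|right]; split; try exact: ZX; move=> _ ->.
  + by left=> P /Za[_]; apply.
  + by right=> P /Zb[_]; apply.
- move=> nu b hb P ZP; have [[[_ _ _ gP] _] _] := XP _ (ZX _ ZP).
  by apply: gP; exact: hb.
Qed.

Lemma dim_ppE p0 : List.In p0 L -> relevant Bz p0.1 ->
  (forall p, List.In p L -> (pdim p.1 <= pdim p0.1)%N) ->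
  dim_pp M Bg = (pdim p0.1 - r)%N%:Z%:E.
Proof.
move=> p0L rp0 p0max; have pp0 := pfilt_gprime p0L.
set X := support_pp M Bg.
have XP P : X P -> relevant_gprime Bz P /\ ann E `<=` P by move/support_ppP.
apply: sup_nat_max.
  have [_ _ _ /(_ rp0)[rd [S [S0 SK SS]]]] := pdimP pp0.
  set k := (pdim p0.1 - r)%N in SK SS *.
  have Smono i j : (i <= j)%N -> (j <= k)%N -> S i `<=` S j.
    move=> /subnK <-; elim: (j - i)%N => [|l IH] ij; [by rewrite add0n|rewrite addSn].
    by apply: subset_trans (IH (ltnW ij)) _; case: (SS _ ij).
  have XS i : (i <= k)%N -> X (S i).
    move=> ik; apply/support_ppP; split; first exact: SK.
    by apply: subset_trans (pfilt_ann_sub p0L) _; rewrite -S0; exact: Smono.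
  (* Passing from primes to closed sets reverses inclusions, whence the index k - i. *)
  exists (fun i => X `&` [set P | S (k - i)%N `<=` P]); split=> i ik.
    have XSi : X (S (k - i)%N) by apply: XS; exact: leq_subr.
    split; first by exists (S (k - i)%N).
    split; first by exists (S (k - i)%N); split.
    move=> Z1 Z2 [T1 _ <-] [T2 _ <-] Z12.
    by case: (Z12 (S (k - i)%N)) => [|[_ TS]|[_ TS]]; [split|left|right] => // P [XPP SP];
      split=> //; exact: subset_trans SP.
  have e : (k - i)%N = (k - i.+1).+1 by rewrite subnSK.
  have le : (k - i.+1 < k)%N by rewrite -e leq_subr.
  have [Ss nSs] := SS _ le; split.
    by move=> P [XPP SP]; split=> //; apply: subset_trans SP; rewrite e.
  move=> sub; apply: nSs; rewrite -e.
  by have [] := sub (S (k - i.+1)%N) (conj (XS _ (ltnW le)) (fun b h => h)).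
move=> n [Z [Zc Zs]]; pose J i : set B := [set b | forall P, Z i P -> P b].
have JP i : (i <= n)%N -> relevant_gprime Bz (J i) /\ ann E `<=` J i.
  by move=> /Zc[Zi Zirr]; exact: irreducible_generic Zi Zirr.
(* The closed set [Z i] consists of the members of [X] above [J i], so strict inclusions of closed
   sets give strict inclusions of primes. *)
have JX i P : (i <= n)%N -> J i `<=` P -> X P -> Z i P.
  move=> /Zc[[T _ ZE] _] JiP XPP; rewrite -ZE; split=> // b Tb; apply: JiP => Q.
  by rewrite -ZE => -[_]; exact.
have [pn an] := JP n (leqnn n).
have [p [pL rp pJ]] := prime_over_relevant (gprime_iprime pn.1) an.
have pp := pfilt_gprime pL.
have : chain_from (relevant_gprime Bz) (J n) n.
  exists (fun i => J (n - i)%N); split=> [|i _|i ilt]; first by rewrite subn0.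
    by have [] := JP (n - i)%N (leq_subr _ _).
  have e : (n - i)%N = (n - i.+1).+1 by rewrite subnSK.
  have le : (n - i.+1 < n)%N by rewrite -e leq_subr.
  have [Ss nSs] := Zs _ le; rewrite e; split.
    by move=> b Jb P /Ss; exact: Jb.
  move=> sub; apply: nSs => P ZP.
  have [[T _ ZE] _] := Zc _ le; apply: JX => //; first exact: ltnW.
    by move=> b /sub /(_ _ ZP).
  by move: ZP; rewrite -ZE => -[].
move=> cJ; have := relevant_chain_le (chain_from_sub (conj pp rp) pJ cJ).
by move=> h; have := leq_trans h (p0max p pL); lia.
Qed.

Definition length_modH0 (nu : grade r) : nat := \sum_(p <- L) Hf m Bz p.1 (nu - p.2)%R.

Lemma rlen_modH0 nu : rlen m (tors `&` Mg nu) (Mg nu) (length_modH0 nu).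
Proof.
have hL p : List.In p L -> has_length m Bz p.1.
  by move=> /pfilt_gprime /pdimP[].
by have := pfilt_rlen gB gM nu sT gT fL hL; rewrite setTI.
Qed.

Lemma Alength_modH0 nu : Alength (Eg nu) = (length_modH0 nu)%:Z%:E.
Proof.
apply: (Alength_rlen mU).
have sMnu : is_Asubmodule (Mg nu) by exact: (graded_piece_Asub gB nu gM).
have sTnu : is_Asubmodule (tors `&` Mg nu) by apply: AsubI => //; exact: Bsub_Asub.
have lin (a : A) x y : torsion_pi ((a%:A : B) *: x + y) =
  (a%:A : B) *: torsion_pi x + torsion_pi y by exact: torsion_piZD.
have := rlen_map lin sTnu (Asub_zero _) (rlen_modH0 nu).
set X := [set z' | _]; have -> : X = Eg nu; last first.
  apply=> x Mx; split=> [/torsion_pi0 tx|[/torsion_pi0]]; [by split|by []].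
apply/seteqP; split=> e.
  by case=> x Mx /eqP; rewrite subr_eq0 => /eqP ->; exists x.
by case=> x Mx <-; exists x => //; rewrite /= subrr.
Qed.

Lemma Alength_large : for_large [set nu | Alength (Mg nu) = (length_modH0 nu)%:Z%:E].
Proof.
have [nu0 h] := torsion_large gBg Bg0 nB s_deg s_ind gM fgM.
exists nu0 => nu /h t0 /=; apply: (Alength_rlen mU).
have <- : tors `&` Mg nu = [set 0]; last exact: rlen_modH0.
apply/seteqP; split=> [x [tx Mx]|_ ->]; first exact: t0.
by split; [exact: Bsub0|exact: (dsum0 dM)].
Qed.

Lemma hilbert_polynomialP P :
  hilbert_polynomial Mg P <-> agrees (fun nu => (length_modH0 nu)%:Z) P.
Proof.
split=> h.
  by apply: for_largeS (for_largeI Alength_large h) => nu [/= ->] /= [].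
by apply: for_largeS (for_largeI Alength_large h) => nu [/= -> /= ->].
Qed.

Lemma dec_length_modH0 (p0 : set B * grade r) :
  (forall p, List.In p L -> (pdim p.1 <= pdim p0.1)%N) ->
  dec (fun nu => (length_modH0 nu)%:Z) (pdim p0.1).
Proof.
move=> p0max.
apply: (@eq_dec _ (fun nu => \sum_(p <- L) (Hf m Bz p.1 (nu - p.2)%R)%:Z)).
  by move=> nu; rewrite -(big_morph Posz PoszD (erefl _)).
apply: (dec_sum (F := fun p nu => (Hf m Bz p.1 (nu - p.2))%:Z)) => p pL.
have [_ dp _ _] := pdimP (pfilt_gprime pL).
by apply: (dec_raise (Ordinal r0) (p0max p pL)); exact: (dec_shift p.2 dp).
Qed.

(* The lower bound on the growth of a relevant prime of maximal dimension. *)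
Lemma msize_length_modH0 p0 P : List.In p0 L -> relevant Bz p0.1 ->
  agrees (fun nu => (length_modH0 nu)%:Z) P -> ~ (msize P <= pdim p0.1 - r)%N.
Proof.
move=> p0L rp0 aP Pd; have pp0 := pfilt_gprime p0L.
have [hp0 _ cp0 /(_ rp0)[rD _]] := pdimP pp0.
have [|c [K [c0 KP]]] := relevant_diag_growth mU gB pp0 rp0 hp0 rD.
  by apply: chain_from_homo cp0; exact: gprime_iprime.
have [C C0 CP] := mpoly_bound Pd; have [N0 N0P] := for_large_diag aP.
set d := (pdim p0.1 - r)%N in Pd KP CP *.
(* The side (c + a0) N leaves room for the shift of [p0]: each coordinate minus this shift is still
   at least cN. *)
pose a0 := (\sum_(i < r) `|p0.2 i|)%N.
apply: (@linear_growth_contra (K%:R * (C * (c + a0)%:R ^+ d)) d N0) => N N0N Npos.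
pose N' := ((c + a0) * N)%N.
have NN' : (N <= N')%N by rewrite leq_pmull // addn_gt0 c0.
have N'pos : (0 < N')%N by exact: leq_trans NN'.
have le1 : (Hf m Bz p0.1 (diag r (c * N)) <= length_modH0 (diag r N'))%N.
  apply: (@leq_trans (Hf m Bz p0.1 (diag r N' - p0.2))).
    apply: (Hf_homo mU gB pp0 rp0 hp0) => i; rewrite !ffunE.
    have le2 : (`|p0.2 i| <= a0)%N by rewrite /a0 (bigD1 i) //= leq_addr.
    have le3 : (a0 <= a0 * N)%N by rewrite leq_pmulr.
    have : ((c * N)%N%:Z + a0%:Z <= N'%:Z)%R by rewrite -PoszD lez_nat /N' mulnDl leq_add2l.
    by move: le2; move: (p0.2 i) => u; lia.
  exact: (sum_In (fun p => Hf m Bz p.1 (diag r N' - p.2))).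
have := N0P N' (leq_trans N0N NN') (diag r N').
move=> /(_ (fun i => ltac:(by rewrite ffunE))) /= eP.
have := CP N' (diag r N') N'pos (fun i => ltac:(by rewrite ffunE /= lez_nat)).
rewrite -eP -pmulrn ger0_norm ?ler0n // => bound.
have Kle := KP N Npos.
apply: (@le_trans _ _ (K%:R * (N'%:R * (length_modH0 (diag r N'))%:R))); last first.
  rewrite -!mulrA; apply: ler_wpM2l => //; apply: le_trans bound _.
  by rewrite natrM exprMn.
rewrite exprS mulrCA; apply: ler_pM => //; rewrite ?exprn_ge0 ?ler0n //.
  by rewrite ler_nat.
rewrite -natrX -natrM ler_nat; apply: leq_trans Kle _.
by rewrite leq_mul2l le1 orbT.
Qed.

(** Every decomposition yields the same Hilbert polynomial, whose coefficient at X^n is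
    Q_{n+1}(1)/n!; so the selected value does not depend on the selection. One decomposition exists
    by [dec_length_modH0]. *)
Lemma mixed_mult_series_coef p0 P n : List.In p0 L -> relevant Bz p0.1 ->
  (forall p, List.In p L -> (pdim p.1 <= pdim p0.1)%N) ->
  agrees (fun nu => (length_modH0 nu)%:Z) P -> (mdeg n + r)%N = pdim p0.1 ->
  (mixed_mult_series Eg (gradeN n))%:~R = P@_n * \prod_(i < r) (n i)`!%:R.
Proof.
move=> p0L rp0 p0max aP nD; set D := pdim p0.1 in nD.
have kE := krull_dimE p0L p0max; rewrite /mixed_mult_series kE.
have -> : [multinom `|(gradeN n i + 1)%R|%N | i < r] = (n + [multinom 1 | _ < r])%MM.
  by apply/mnmP => i; rewrite mnmDE !mnmE ffunE.
have mdegn1 : mdeg (n + [multinom 1 | _ < r])%MM = D.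
  by rewrite mdegD mdeg_ones.
rewrite mdegn1 eqxx; set n1 := (n + _)%MM in mdegn1 *.
have nN : n1 \in mnm_of_deg r D%:Z%:E by rewrite mem_mnm_of_deg mdegn1.
case: xgetP => [c _ [Q [_ Qval] ->]|].
  have tD := @terms_of_deg r (mnm_of_deg r D%:Z%:E) Q D
    (fun k => ltac:(by rewrite mem_mnm_of_deg => /eqP)).
  have [H [aH cH]] := terms_poly tD.
  have -> : P = H.
    apply: agrees_uniq aP _; apply: for_largeS aH => nu /= <-; congr (_%:~R).
    have := Qval nu; rewrite Alength_modH0 kE => -[->].
    by rewrite terms_of_val.
  rewrite cH ?nD // terms_of_mult ?mnm_of_deg_uniq // natr_prod divfK //.
  exact: prod_fact_neq0.
have [ts [tD t0 tE]] := dec_length_modH0 p0max.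
move=> /(_ (laurent_at1 (laurent_of ts n1))) []; exists (laurent_of ts) => //; split.
  by move=> k _; rewrite laurent_of_at1.
move=> nu; rewrite Alength_modH0 kE; congr EFin.
by rewrite tE (laurent_of_val _ tD).
Qed.

(** A prime of the filtration would contain a relevant one of the filtration. The empty list means M
    = H^0. *)
Lemma pfilt_nil_irrelevant : ~ (exists2 p, List.In p L & relevant Bz p.1) -> L = [::].
Proof.
move=> nrel; case LE : L => [//|p L']; case: nrel.
have pL : List.In p L by rewrite LE; left.
have [q [qL rq _]] := prime_over_relevant (gprime_iprime (pfilt_gprime pL)) (pfilt_ann_sub pL).
by exists q; rewrite // -LE.
Qed.

Lemma krull_dim_empty : L = [::] -> krull_dim E = -oo%E.
Proof.
move=> L0; apply: sup_nat0 => n [P [PK _]]; have [/iprimeP pP aP] := PK 0%N isT.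
by have [p []] := prime_over_relevant pP aP; rewrite L0.
Qed.

Lemma dim_pp_empty : L = [::] -> dim_pp M Bg = -oo%E.
Proof.
move=> L0; apply: sup_nat0 => n [Z [ZK _]]; have [[S _ <-] [[P [XP _]] _]] := ZK 0%N isT.
have [[pP rP] aP] := (support_ppP P).1 XP.
by have [p []] := prime_over_relevant (gprime_iprime pP) aP; rewrite L0.
Qed.

Theorem hilbert_polynomial_mixed :
  let d := dim_pp M Bg in
  let e := mixed_mult_series Eg in
  (exists P : {mpoly rat[r]},
     [/\ hilbert_polynomial Mg P,
         total_degree P = d &
         exists2 R : {mpoly rat[r]},
           P = \sum_(n <- mnm_of_deg r d)
                 ((e (gradeN n))%:~R / (\prod_(i < r) (n i)`!)%:R) *: 'X_[n] + R
           & forall k, k \in msupp R -> ((mdeg k)%:Z%:E < d)%E])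
  /\
  (forall n : 'X_{1..r}, (d <= (mdeg n)%:Z%:E)%E ->
     mixed_mult_poly Mg Bg n = (e (gradeN n))%:~R).
Proof.
have [rel|nrel] := pselect (exists2 p, List.In p L & relevant Bz p.1); last first.
  (* Case M = H^0: both dimensions are -oo, the leading sum is empty, and every multiplicity is 0
     because no |n| equals -oo. *)
  have L0 := pfilt_nil_irrelevant nrel.
  rewrite /= (dim_pp_empty L0) /mixed_mult_poly /mixed_mult_series.
  rewrite (krull_dim_empty L0) (dim_pp_empty L0); split; last by move=> n _.
  exists 0; split.
  - apply/hilbert_polynomialP; exists 0 => nu _ /=.
    by rewrite /length_modH0 L0 big_nil meval0.
  - by rewrite /total_degree eqxx.
  - exists 0; first by rewrite mnm_of_degNy big_nil addr0.
    by move=> k; rewrite msupp0.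
have [p0 [p0L rp0 p0max]] := relevant_maximal rel.
have dE := dim_ppE p0L rp0 p0max; have kE := krull_dimE p0L p0max.
rewrite /= dE; set D := pdim p0.1 in dE kE *.
have rD : (r <= D)%N.
  by have [_ _ _ /(_ rp0)[]] := pdimP (pfilt_gprime p0L).
have [P aP Pd] := dec_agrees r0 rD (dec_length_modH0 p0max).
have coefE n : mdeg n = (D - r)%N ->
    (mixed_mult_series Eg (gradeN n))%:~R = P@_n * \prod_(i < r) (n i)`!%:R.
  by move=> nd; apply: (mixed_mult_series_coef p0L rp0 p0max aP); rewrite nd subnK.
split.
  exists P; split; first exact/hilbert_polynomialP.
    have lt : (D - r < msize P)%N.
      by rewrite ltnNge; apply/negP; exact: (msize_length_modH0 p0L rp0 aP).
    rewrite /total_degree ifF; last first.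
      by apply/negbTE; rewrite -msize_poly_eq0 -lt0n; exact: leq_ltn_trans lt.
    have -> : msize P = (D - r).+1 by apply/eqP; rewrite eqn_leq Pd.
    by [].
  (* The coefficients of P - S in degree D - r cancel, and those above vanish by the bound on
     [msize P]. *)
  set S := \sum_(n <- _) _; exists (P - S); first by rewrite addrC subrK.
  move=> k; rewrite lte_fin ltz_nat mcoeff_msupp; apply: contraR; rewrite -leqNgt => dk.
  apply/eqP; rewrite mcoeffB /S raddf_sum /=.
  have -> : \sum_(n <- mnm_of_deg r (D - r)%N%:Z%:E)
      (((mixed_mult_series Eg (gradeN n))%:~R / (\prod_(i < r) (n i)`!)%:R) *: 'X_[n])@_k =
      \sum_(n <- mnm_of_deg r (D - r)%N%:Z%:E) (if n == k then P@_k else 0).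
    rewrite big_seq [RHS]big_seq; apply: eq_bigr => n; rewrite mem_mnm_of_deg => /eqP nd.
    rewrite mcoeffZ mcoeffX coefE // natr_prod mulfK ?prod_fact_neq0 //.
    by case: eqP => [->|_]; rewrite ?mulr1 ?mulr0.
  rewrite -big_mkcond /=; have [kd|kd] := eqVneq (mdeg k) (D - r)%N.
    by rewrite -big_filter filter_pred1_uniq ?mnm_of_deg_uniq ?mem_mnm_of_deg ?kd // big_seq1 subrr.
  rewrite big_seq_cond big1 => [|n /andP[]]; last first.
    by rewrite mem_mnm_of_deg => nd /eqP nk; rewrite -nk nd in kd.
  rewrite subr0; apply/eqP; rewrite mcoeff_eq0; apply: msize_mdeg_ge.
  by apply: leq_trans Pd _; rewrite ltn_neqAle eq_sym kd.
move=> n; rewrite lee_fin lez_nat /mixed_mult_poly dE eqe eqz_nat => dn.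
(* For |n| > D - r both multiplicities are 0: on the series side, |n + 1| = |n| + r exceeds D. *)
case: eqP => nd; last first.
  rewrite /mixed_mult_series kE ifF //; apply/negbTE; rewrite eqe eqz_nat.
  have -> : [multinom `|(gradeN n i + 1)%R|%N | i < r] = (n + [multinom 1 | _ < r])%MM.
    by apply/mnmP => i; rewrite mnmDE !mnmE ffunE.
  by rewrite mdegD mdeg_ones; apply/eqP; lia.
(* Both sides are n! times the coefficient of X^n in the Hilbert polynomial. *)
rewrite coefE //; case: xgetP => [c _ [P' [e [hP' P'E ->]]]|].
  have {hP'} PP' : P' = P by apply: agrees_uniq aP; apply/hilbert_polynomialP.
  by rewrite binom_basis_coef -P'E PP' ?nd // mulrC.
have [e eE] := binom_basis P.
by move=> /(_ (e n)) []; exists P, e; split=> //; exact/hilbert_polynomialP.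
Qed.

End Dimensions.

Theorem theorem3p4 (r : nat) (A : comNzRingType) (B : comAlgType A)
    (Bg : 'X_{1..r} -> set B) (M : lmodType B) (Mg : grade r -> set M) :
  (0 < r)%N ->
  artinian A -> local_ring A ->
  graded_ring Bg -> standard Bg ->
  graded_module Bg Mg -> fin_gen M ->
  let d := dim_pp M Bg in
  let e := mixed_mult_series (modH0_grading Bg Mg) in
  (exists P : {mpoly rat[r]},
     [/\ hilbert_polynomial Mg P,
         total_degree P = d &
         exists2 R : {mpoly rat[r]},
           P = \sum_(n <- mnm_of_deg r d)
                 ((e (gradeN n))%:~R / (\prod_(i < r) (n i)`!)%:R) *: 'X_[n] + R
           & forall m, m \in msupp R -> ((mdeg m)%:Z%:E < d)%E])
  /\
  (forall n : 'X_{1..r}, (d <= (mdeg n)%:Z%:E)%E ->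
     mixed_mult_poly Mg Bg n = (e (gradeN n))%:~R).
Proof.
move=> r0 artA locA gBg [_ Bg0 [s [s_gen sB]]] gMg fgM.
have [m [im m1 mU]] := local_unitP locA.
have mnil := local_nilpotent artA im m1 mU.
have nB := standard_noetherian sB (artinian_local_noetherian artA im m1 mU).
have gM := shift_graded_mod gMg.
have s_deg b : b \in s -> exists i : 'I_r, extend_grading Bg (gradeN U_(i)%MM) b.
  by move=> /s_gen[i Bi]; exists i; right; exists U_(i)%MM.
(* A filtration of [M] that starts at H^0 is a filtration of M/H^0, expressed without the
   quotient. *)
have [L fL] := pfilt_exists (shift_graded_alg gBg Bg0) gM nB fgM
  (torsion_Bsub Bg M) (torsion_gclosed gBg gM).
exact: (hilbert_polynomial_mixed mU mnil r0 gBg Bg0 nB s_deg (generators_ind sB) gM fgM fL).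
Qed.
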